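(* Let $\bm\sigma=\sigma_1\bm e_1+\dots+\sigma_r\bm e_r$ be a very slack changemaker vector with $\sigma_r>1$ and $\bm\sigma\cdot\bm\sigma=n$, and let $L_n=\langle\bm\sigma\rangle^\perp\subseteq\mathbb{Z}^r$. Suppose $L_n$ admits an obtuse superbase $B$. Let $L_{n-\frac12}$ be the $(n-\frac12)$-changemaker lattice and $L_{n-1}$ the $(n-1)$-changemaker lattice with the same stable coefficients as $L_n$. Then (1) $L_{n-\frac12}$ admits an obtuse superbase, which can be taken planar if $B$ is planar; and (2) $L_{n-1}$ is decomposable.
   Context: Lattices are integral: free abelian groups with symmetric positive definite integral bilinear form; $\mathbb{Z}^k$ has the standard pairing. A changemaker vector is $\bm\sigma=\sum_{i=1}^r\sigma_i\bm e_i$ in some orthonormal basis with $\sigma_1=1$, $\sigma_{i-1}\le\sigma_i\le 1+\sigma_1+\dots+\sigma_{i-1}$; its stable coefficients are the $\sigma_i\ge2$. It is very slack if $\sigma_k\le\sigma_1+\dots+\sigma_{k-1}-1$ for every $k$ with $\sigma_k>1$. For an integer $n\ge1$, an $n$-changemaker lattice is $\langle\bm\sigma\rangle^\perp\subseteq\mathbb{Z}^r$ for a changemaker $\bm\sigma$ with $\bm\sigma\cdot\bm\sigma=n$. An $(n-\frac12)$-changemaker lattice is $\langle \bm e_{-1}-\bm e_0,\ \bm e_0+\bm\tau\rangle^\perp\subseteq\mathbb{Z}^{s+2}=\langle\bm e_{-1},\bm e_0,\bm e_1,\dots,\bm e_s\rangle$ where $\bm\tau=\sum_{i=1}^s\tau_i\bm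 e_i$ is a changemaker vector with $\bm\tau\cdot\bm\tau=n-1$; its stable coefficients are those of $\bm\tau$. An obtuse superbase of a rank-$k$ lattice $L$ is a spanning set $\{v_0,\dots,v_k\}$ with $v_i\cdot v_j\le0$ for $i\ne j$ and $\sum v_i=0$; its graph $G_B$ has vertex set $B$ and $|v_i\cdot v_j|$ edges between $v_i\ne v_j$; $B$ is planar if $G_B$ is planar. A lattice is decomposable if it is an orthogonal direct sum of two non-zero sublattices. *)

(* Defs.v *)
From Stdlib Require Import Reals.
From mathcomp Require Import all_boot all_order all_algebra.
Set Implicit Arguments. Unset Strict Implicit. Unset Printing Implicit Defensive.
Import Order.TTheory GRing.Theory Num.Theory.
Local Open Scope ring_scope.

Definition dot (d : nat) (u v : 'rV[int]_d) : int := \sum_(i < d) u 0 i * v 0 i.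

(** Changemaker vectors, written in the standard orthonormal basis;
    index i : 'I_r corresponds to the paper's sigma_{i+1}. *)
Definition is_changemaker (r : nat) (s : 'rV[int]_r) : Prop :=
  (0 < r)%N /\
  (forall i : 'I_r, nat_of_ord i = 0%N -> s 0 i = 1) /\
  (forall i j : 'I_r, (j.+1 = i)%N ->
     s 0 j <= s 0 i /\ s 0 i <= 1 + \sum_(l < r | (l < i)%N) s 0 l).

Definition very_slack (r : nat) (s : 'rV[int]_r) : Prop :=
  forall k : 'I_r, 1 < s 0 k -> s 0 k <= \sum_(l < r | (l < k)%N) s 0 l - 1.

Definition stable_coeffs (r : nat) (s : 'rV[int]_r) : seq int :=
  [seq s 0 i | i <- enum 'I_r & 1 < s 0 i].

Definition cm_lattice (r : nat) (s : 'rV[int]_r) : 'rV[int]_r -> Prop :=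
  fun x => dot x s = 0.

(** The (n-1/2)-changemaker lattice: in Z^(s+2) with basis e_{-1}, e_0,
    e_1..e_s, indexed by 0, 1, 2..s+1. *)
Definition coord_e (d : nat) (j : nat) : 'rV[int]_d :=
  \row_(i < d) (if nat_of_ord i == j then 1 else 0).

Definition shift2 (s : nat) (t : 'rV[int]_s) : 'rV[int]_(s.+2) :=
  \row_(i < s.+2) (if (1 < nat_of_ord i)%N then
                     (if @insub _ (fun j => (j < s)%N) 'I_s (nat_of_ord i - 2)%N
                        is Some o then t 0 o else 0) else 0).

Definition half_cm_lattice (s : nat) (t : 'rV[int]_s) : 'rV[int]_(s.+2) -> Prop :=
  fun x => dot x (coord_e (s.+2) 0 - coord_e (s.+2) 1) = 0 /\
           dot x (coord_e (s.+2) 1 + shift2 t) = 0.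

Definition lattice_rank (d : nat) (L : 'rV[int]_d -> Prop) (k : nat) : Prop :=
  exists b : 'I_k -> 'rV[int]_d,
    (forall i, L (b i)) /\
    (forall c : 'I_k -> int, \sum_(i < k) c i *: b i = 0 -> forall i, c i = 0) /\
    (forall v, L v -> exists c : 'I_k -> int, v = \sum_(i < k) c i *: b i).

Definition obtuse_superbase (d : nat) (L : 'rV[int]_d -> Prop) (k : nat)
    (B : 'I_k.+1 -> 'rV[int]_d) : Prop :=
  lattice_rank L k /\
  (forall i, L (B i)) /\
  (forall v, L v -> exists c : 'I_k.+1 -> int, v = \sum_(i < k.+1) c i *: B i) /\
  (forall i j : 'I_k.+1, i != j -> dot (B i) (B j) <= 0) /\
  \sum_(i < k.+1) B i = 0.

Definition in01 (t : R) : Prop := Rle R0 t /\ Rle t R1.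
Definition in01o (t : R) : Prop := Rlt R0 t /\ Rlt t R1.

Definition arc_continuous (g : R -> R * R) : Prop :=
  forall t, in01 t -> forall eps, Rlt R0 eps -> exists delta, Rlt R0 delta /\
    forall t', in01 t' -> Rlt (Rabs (Rminus t' t)) delta ->
      Rlt (Rabs (Rminus (fst (g t')) (fst (g t)))) eps /\
      Rlt (Rabs (Rminus (snd (g t')) (snd (g t)))) eps.

Definition planar_multigraph (N : nat) (m : 'I_N -> 'I_N -> nat) : Prop :=
  exists (pos : 'I_N -> R * R) (gam : 'I_N -> 'I_N -> nat -> R -> R * R),
    injective pos /\
    forall (i j : 'I_N) (l : nat), (i < j)%N -> (l < m i j)%N ->
      arc_continuous (gam i j l) /\
      (forall t t', in01 t -> in01 t' -> gam i j l t = gam i j l t' -> t = t') /\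
      gam i j l R0 = pos i /\ gam i j l R1 = pos j /\
      (forall t, in01o t -> forall v, gam i j l t <> pos v) /\
      (forall (i' j' : 'I_N) (l' : nat), (i' < j')%N -> (l' < m i' j')%N ->
         (i, j, l) <> (i', j', l') ->
         forall t t', in01o t -> in01o t' -> gam i j l t <> gam i' j' l' t').

Definition planar_superbase (d k : nat) (B : 'I_k.+1 -> 'rV[int]_d) : Prop :=
  planar_multigraph (fun i j : 'I_k.+1 => `|dot (B i) (B j)|%N).

Definition sublattice (d : nat) (L M : 'rV[int]_d -> Prop) : Prop :=
  M 0 /\ (forall x y, M x -> M y -> M (x - y)) /\ (forall x, M x -> L x).

Definition decomposable (d : nat) (L : 'rV[int]_d -> Prop) : Prop :=
  exists L1 L2 : 'rV[int]_d -> Prop,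
    sublattice L L1 /\ sublattice L L2 /\
    (exists x, L1 x /\ x <> 0) /\ (exists y, L2 y /\ y <> 0) /\
    (forall x y, L1 x -> L2 y -> dot x y = 0) /\
    (forall x, L1 x -> L2 x -> x = 0) /\
    (forall v, L v -> exists x y, L1 x /\ L2 y /\ v = x + y).

(* Main.v *)
(**
The vector [sigma] starts with three ones, and [L_n] is generated by standard vectors
[e_A - e_k] with [sigma_k = \sum_(i in A) sigma_i]. Such a vector is irreducible, so it is the sum
of a set of elements of the superbase, that is, a cut of its graph; two of them that are
orthogonal never cut a common edge. Choosing the sets [A] suitably (very slackness leaves room
for this), the vectors with vanishing first coordinate [x] split into two orthogonal families,
and this decomposes [L_(n-1) = L_n :&: (x = 0)]. The two families colour the edges of the graph,
and a function that is constant along one of the colours has [x = 0].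

It follows that two elements [a, b] of the superbase with nonzero first coordinates satisfy
[x a = x b] or [x a = - x b], and separate the graph into two sides. If [x a = x b], twisting one
side is again an obtuse superbase, in which [x a] and [x b] have become [0]. After finitely many
twists the only nonzero values of [x] are [1] and [-1], at two vertices. Since [L_(n-1/2)] is
[L_n] with the form [u . v + x u * x v], the same superbase is obtuse for it, its graph having one
more edge between these two vertices.

Twisting and adding the edge preserve planarity: an arc from [a] to [b] through one side can be
straightened, together with the plane, so that the other side is drawn in a thin lens with tips
[a, b]; lenses, possibly reflected, are then stacked between two fixed points.
*)

Require Import Defs.
From Stdlib Require Import Reals Lra Classical ClassicalEpsilon.
From mathcomp Require Import all_boot all_order all_algebra.
Import Order.TTheory GRing.Theory Num.Theory.

(** * Plane arcs *)

(** In the drawing part the obstacle is that edges are arbitrary continuous arcs. The map that puts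
    a side into a lens is built only on the compact set drawn by that side: the arc through the
    other side is replaced by an inscribed polygon, plane maps shorten this polygon edge by edge,
    and an inversion opens the last segment. Edges may spiral into a vertex, so the drawing is first
    made radial at both ends; from then on a cone condition ([wedge]) is all that has to be carried
    along.

    In the lattice part everything rests on [e_0 - e_1], which has norm 2 and so cuts only two
    edges. Very slackness makes [sigma_k - 1] a sum of entries below [k] other than the first two,
    so that [A] can contain [e_1] and miss [e_0]; such an [A] then contains all the remaining units
    or none of them. The first kind defines one colour, and the two edges cut by [e_0 - e_1] turn
    out to have different colours, which is what makes the first coordinate vanish on functions that
    are constant along one colour. *)

Section PlaneTopology.
Local Open Scope R_scope.

Notation pt := (R * R)%type.

(** The l1 distance, which keeps most estimates linear in absolute values. *)
Definition dst (p q : pt) : R := Rabs (p.1 - q.1) + Rabs (p.2 - q.2).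

Lemma dst_ge0 p q : 0 <= dst p q.
Proof. rewrite /dst; have := Rabs_pos (p.1 - q.1); have := Rabs_pos (p.2 - q.2); lra. Qed.

Lemma dst_sym p q : dst p q = dst q p.
Proof. by rewrite /dst Rabs_minus_sym (Rabs_minus_sym p.2). Qed.

Lemma dst_tri p q r : dst p r <= dst p q + dst q r.
Proof.
rewrite /dst.
have -> : p.1 - r.1 = (p.1 - q.1) + (q.1 - r.1) by lra.
have -> : p.2 - r.2 = (p.2 - q.2) + (q.2 - r.2) by lra.
have := Rabs_triang (p.1 - q.1) (q.1 - r.1).
have := Rabs_triang (p.2 - q.2) (q.2 - r.2).
lra.
Qed.

Lemma dstxx p : dst p p = 0.
Proof. by rewrite /dst !Rminus_diag Rabs_R0; lra. Qed.

Lemma dst_eq0 p q : dst p q = 0 -> p = q.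
Proof.
case: p q => [a b] [c d]; rewrite /dst /= => h.
have h1 := Rabs_pos (a - c); have h2 := Rabs_pos (b - d).
have e1 : a - c = 0 by apply: NNPP => /Rabs_pos_lt; lra.
have e2 : b - d = 0 by apply: NNPP => /Rabs_pos_lt; lra.
by congr pair; lra.
Qed.

Lemma dst_gt0 p q : p <> q -> 0 < dst p q.
Proof. by move=> h; have := dst_ge0 p q; case=> // /esym /dst_eq0. Qed.

Lemma dst_fst p q : Rabs (p.1 - q.1) <= dst p q.
Proof. by rewrite /dst; have := Rabs_pos (p.2 - q.2); lra. Qed.

Lemma dst_snd p q : Rabs (p.2 - q.2) <= dst p q.
Proof. by rewrite /dst; have := Rabs_pos (p.1 - q.1); lra. Qed.

Definition cont01 (g : R -> pt) : Prop :=
  forall t, in01 t -> forall eps, 0 < eps -> exists delta, 0 < delta /\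
    forall t', in01 t' -> Rabs (t' - t) < delta -> dst (g t') (g t) < eps.

Lemma arc_continuousP g : arc_continuous g <-> cont01 g.
Proof.
split=> h t t01 e e0.
  have [d [d0 hd]] := h t t01 (e / 2) ltac:(lra); exists d; split=> // t' t'01 /(hd t' t'01).
  rewrite /dst; lra.
have [d [d0 hd]] := h t t01 e e0; exists d; split=> // t' t'01 /(hd t' t'01).
by have := dst_fst (g t') (g t); have := dst_snd (g t') (g t); lra.
Qed.

Definition inj01 (g : R -> pt) : Prop :=
  forall t t', in01 t -> in01 t' -> g t = g t' -> t = t'.

Definition arc g := cont01 g /\ inj01 g.

Lemma in01_0 : in01 0. Proof. rewrite /in01; lra. Qed.
Lemma in01_1 : in01 1. Proof. rewrite /in01; lra. Qed.
Lemma in01o_in01 t : in01o t -> in01 t. Proof. rewrite /in01 /in01o; lra. Qed.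

(** Compactness of the unit interval without covers: the supremum of the [b] for which [0, b] has a
    common [eta] is reached and cannot lie below 1. Uniform separation and uniform continuity of
    curves are both instances. *)
Lemma compact01 (P : R -> R -> Prop) :
  (forall s, in01 s -> exists d eta, 0 < d /\ 0 < eta /\
     forall s', in01 s' -> Rabs (s' - s) < d -> P s' eta) ->
  (forall s eta eta', P s eta -> 0 < eta' <= eta -> P s eta') ->
  exists eta, 0 < eta /\ forall s, in01 s -> P s eta.
Proof.
move=> loc anti.
pose E b := in01 b /\ exists eta, 0 < eta /\ forall s, 0 <= s <= b -> P s eta.
have [d0 [e0 [d00 [e00 h0]]]] := loc 0 in01_0.
have E0 : E 0.
  split; first exact: in01_0.
  exists e0; split=> // s hs; have -> : s = 0 by lra.
  by apply: h0; [exact: in01_0|rewrite Rminus_diag Rabs_R0].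
have [b [ub lb]] : {b | is_lub E b}.
  apply: completeness; last by exists 0.
  by exists 1 => x [[_ ?] _].
have b0 : 0 <= b by apply: ub.
have b1 : b <= 1 by apply: lb => x [[_ ?] _].
have [d [e [dp [ep hb]]]] := loc b (conj b0 b1).
have [c [[[c0 c1] [e' [e'p hc]]] cb]] : exists c, E c /\ b - d < c.
  apply: NNPP => hn; have : b <= b - d; last by lra.
  apply: lb => x Ex; apply: Rnot_lt_le => hx; apply: hn; by exists x.
have key : forall s, 0 <= s <= 1 -> s < b + d -> P s (Rmin e e').
  move=> s hs hs2.
  have [m1 m2] := (Rmin_l e e', Rmin_r e e').
  have mp : 0 < Rmin e e' by apply: Rmin_glb_lt.
  case: (Rle_dec s c) => hsc.
    by apply: (anti s e') => //; apply: hc; lra.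
  apply: (anti s e) => //; apply: hb; first by split; lra.
  by apply: Rabs_def1; lra.
have mp : 0 < Rmin e e' by apply: Rmin_glb_lt.
case: (Rlt_dec b 1) => hb1; last first.
  exists (Rmin e e'); split=> // s [s0 s1]; apply: key; lra.
have : E (Rmin 1 (b + d/2)).
  have [m1 m2] := (Rmin_l 1 (b + d/2), Rmin_r 1 (b + d/2)).
  have m0 : 0 <= Rmin 1 (b + d/2) by apply: Rmin_glb; lra.
  split; first by split.
  exists (Rmin e e'); split=> // s hs; apply: key; lra.
move/ub; rewrite /Rmin; case: Rle_dec; lra.
Qed.

Definition cont01_2 (F : R -> R -> R) : Prop :=
  forall s t, in01 s -> in01 t -> forall eps, 0 < eps -> exists delta, 0 < delta /\
    forall s' t', in01 s' -> in01 t' -> Rabs (s' - s) < delta -> Rabs (t' - t) < delta ->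
      Rabs (F s' t' - F s t) < eps.

Lemma cont01_2_pos F : cont01_2 F ->
  (forall s t, in01 s -> in01 t -> 0 < F s t) ->
  exists eta, 0 < eta /\ forall s t, in01 s -> in01 t -> eta <= F s t.
Proof.
move=> cF pF.
have [eta [ep h]] : exists eta, 0 < eta /\ forall s, in01 s ->
    (fun s eta => forall t, in01 t -> eta <= F s t) s eta.
  apply: compact01; last by move=> s e e' h he t /h; lra.
  move=> s s01.
  (* A single number is both the radius in [s] and the lower bound, so that [compact01] in [t]
     yields exactly the local data that [compact01] in [s] asks for. *)
  have [e [ep he]] : exists eta, 0 < eta /\ forall t, in01 t ->
     (fun t eta => forall s', in01 s' -> Rabs (s' - s) < eta -> eta <= F s' t) t eta.
    apply: compact01; last by move=> t e e' h he s' s'01 hs; have := h s' s'01; lra.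
    move=> t t01; have Fp := pF s t s01 t01.
    have [d [dp hd]] := cF s t s01 t01 (F s t / 2) ltac:(lra).
    have mp : 0 < Rmin d (F s t / 2) by apply: Rmin_glb_lt; lra.
    exists d, (Rmin d (F s t / 2)); split=> //; split=> // t' t'01 ht s' s'01 hs.
    have [m1 m2] := (Rmin_l d (F s t / 2), Rmin_r d (F s t / 2)).
    have /Rabs_def2 := hd s' t' s'01 t'01 ltac:(lra) ht; lra.
  exists e, e; split=> //; split=> // s' s'01 hs t t01; exact: he.
by exists eta; split=> // s t s01 t01; apply: h.
Qed.

Lemma dst_lip p q p' q' : Rabs (dst p' q' - dst p q) <= dst p' p + dst q' q.
Proof.
have h1 := dst_tri p' p q'; have h2 := dst_tri p q q'.
have h3 := dst_tri p p' q; have h4 := dst_tri p' q' q.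
have := dst_sym p p'; have := dst_sym q q'.
by move=> e1 e2; apply: Rabs_le; lra.
Qed.

Lemma cont01_2_dst g h : cont01 g -> cont01 h -> cont01_2 (fun s t => dst (g s) (h t)).
Proof.
move=> cg ch s t s01 t01 e e0.
have [d1 [d1p h1]] := cg s s01 (e/2) ltac:(lra).
have [d2 [d2p h2]] := ch t t01 (e/2) ltac:(lra).
exists (Rmin d1 d2); split; first exact: Rmin_glb_lt.
move=> s' t' s'01 t'01 hs ht.
have [m1 m2] := (Rmin_l d1 d2, Rmin_r d1 d2).
have := h1 s' s'01 ltac:(lra); have := h2 t' t'01 ltac:(lra).
by have := dst_lip (g s) (h t) (g s') (h t'); lra.
Qed.

Lemma curves_apart g h : cont01 g -> cont01 h ->
  (forall s t, in01 s -> in01 t -> g s <> h t) ->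
  exists eta, 0 < eta /\ forall s t, in01 s -> in01 t -> eta <= dst (g s) (h t).
Proof.
move=> cg ch hd; apply: cont01_2_pos; first exact: cont01_2_dst.
by move=> s t s01 t01; apply: dst_gt0; apply: hd.
Qed.

Lemma cont01_cst p : cont01 (fun=> p).
Proof. by move=> t _ e e0; exists 1; split; [lra|move=> *; rewrite dstxx]. Qed.

Lemma curve_point_apart g p : cont01 g -> (forall s, in01 s -> g s <> p) ->
  exists eta, 0 < eta /\ forall s, in01 s -> eta <= dst (g s) p.
Proof.
move=> cg h; have [|eta [ep he]] := curves_apart g (fun=> p) cg (cont01_cst p).
  by move=> s t s01 _; apply: h.
by exists eta; split=> // s s01; apply: (he s 0) => //; apply: in01_0.
Qed.

Lemma curve_unif g : cont01 g -> forall eps, 0 < eps -> exists d, 0 < d /\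
  forall s t, in01 s -> in01 t -> Rabs (s - t) < d -> dst (g s) (g t) < eps.
Proof.
move=> cg e e0.
have [d [dp h]] : exists eta, 0 < eta /\ forall s, in01 s ->
    (fun s eta => forall t, in01 t -> Rabs (s - t) < eta -> dst (g s) (g t) < e) s eta.
  apply: compact01; last by move=> s x y h hxy t t01 ht; apply: h => //; lra.
  move=> s s01; have [d [dp hd]] := cg s s01 (e/2) ltac:(lra).
  exists (d/2), (d/2); split; first lra; split; first lra.
  move=> s' s'01 hs t t01 ht.
  have a1 := hd s' s'01 ltac:(lra).
  have a2 : dst (g t) (g s) < e/2.
    apply: hd => //; have -> : t - s = (s' - s) - (s' - t) by lra.
    have := Rabs_triang (s' - s) (- (s' - t)); rewrite Rabs_Ropp -/(Rminus (s' - s) (s' - t)); lra.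
  by have := dst_tri (g s') (g s) (g t); rewrite (dst_sym (g s) (g t)); lra.
by exists d; split=> // s t s01 t01; apply: h.
Qed.

Lemma fin_pos (E : finType) (P : E -> R -> Prop) :
  (forall e, exists eta, 0 < eta /\ P e eta) ->
  (forall e eta eta', P e eta -> 0 < eta' <= eta -> P e eta') ->
  exists eta, 0 < eta /\ forall e, P e eta.
Proof.
move=> h anti.
have [eta [ep he]] : exists eta, 0 < eta /\ forall e, e \in enum E -> P e eta.
  elim: (enum E) => [|e s [eta [ep IH]]]; first by exists 1; split; [lra|].
  have [eta' [e'p h']] := h e.
  have mp : 0 < Rmin eta eta' by apply: Rmin_glb_lt.
  have [m1 m2] := (Rmin_l eta eta', Rmin_r eta eta').
  exists (Rmin eta eta'); split=> // x; rewrite inE => /orP[/eqP->|/IH hx].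
    by apply: anti h' _; lra.
  by apply: anti hx _; lra.
by exists eta; split=> // e; apply: he; rewrite mem_enum.
Qed.

(** The time is the supremum of those spent in the closed ball. It serves to cut an arc at its last
    exit from a disc and to choose the vertices of an inscribed polygon. *)
Lemma last_time g p rho s0 : cont01 g -> in01 s0 -> dst (g s0) p <= rho ->
  exists t, in01 t /\ s0 <= t /\ dst (g t) p <= rho /\
    (forall t', in01 t' -> t < t' -> rho < dst (g t') p) /\
    (t < 1 -> dst (g t) p = rho).
Proof.
move=> cg s001 h0.
pose E t := in01 t /\ dst (g t) p <= rho.
have [b [ub lb]] : {b | is_lub E b}.
  apply: completeness; last by exists s0.
  by exists 1 => x [[_ ?] _].
have sb : s0 <= b by apply: ub.
have b01 : in01 b by split; [case: s001; lra|apply: lb => x [[_ ?] _]].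
have hb : dst (g b) p <= rho.
  apply: Rnot_lt_le => hgt.
  have [d [dp hd]] := cg b b01 (dst (g b) p - rho) ltac:(lra).
  have : b <= b - d; last by lra.
  apply: lb => x Ex; apply: Rnot_lt_le => hx; have [x01 hx2] := Ex.
  have xb := ub _ Ex.
  have := hd x x01 ltac:(apply: Rabs_def1; lra).
  by have := dst_tri (g b) (g x) p; rewrite (dst_sym (g b) (g x)); lra.
have hafter : forall t', in01 t' -> b < t' -> rho < dst (g t') p.
  by move=> t' t'01 ht; apply: Rnot_le_lt => hle; have := ub t' (conj t'01 hle); lra.
exists b; split=> //; split=> //; split=> //; split=> // b1.
apply: Rle_antisym => //; apply: Rnot_lt_le => hlt.
have [d [dp hd]] := cg b b01 (rho - dst (g b) p) ltac:(lra).
have [m1 m2] := (Rmin_l 1 (b + d/2), Rmin_r 1 (b + d/2)).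
have tb : b < Rmin 1 (b + d/2) by apply: Rmin_glb_lt; lra.
move: (Rmin 1 (b + d/2)) m1 m2 tb => t' m1 m2 tb.
have t'01 : in01 t' by case: b01 => ? ?; split; lra.
have := hd t' t'01 ltac:(apply: Rabs_def1; lra).
by have := hafter t' t'01 tb; have := dst_tri (g t') (g b) p; lra.
Qed.

Definition cat (g h : R -> pt) (t : R) : pt :=
  if Rle_dec t (1/2) then g (2 * t) else h (2 * t - 1).

Definition sub (g : R -> pt) (a b t : R) : pt := g (a + t * (b - a)).

Definition rev (g : R -> pt) (t : R) : pt := g (1 - t).

Lemma catl g h t : t <= 1/2 -> cat g h t = g (2 * t).
Proof. by rewrite /cat; case: Rle_dec. Qed.

Lemma catr g h t : 1/2 < t -> cat g h t = h (2 * t - 1).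
Proof. by rewrite /cat; case: Rle_dec => // ? ?; lra. Qed.

Lemma cat_cont g h : cont01 g -> cont01 h -> g 1 = h 0 -> cont01 (cat g h).
Proof.
move=> cg ch gh t t01 e e0.
have [d1 [d1p h1]] : exists d, 0 < d /\ forall t', in01 t' -> t' <= 1/2 -> Rabs (t' - t) < d ->
     dst (cat g h t') (cat g h t) < e.
  case: (Rle_dec t (1/2)) => ht.
    have [d [dp hd]] := cg (2 * t) ltac:(case: t01; split; lra) e e0.
    exists (d/2); split=> [|t' [t0 t1] ht' hd']; first lra.
    rewrite !catl //; apply: hd; first by split; lra.
    have -> : 2 * t' - 2 * t = 2 * (t' - t) by lra.
    by rewrite Rabs_mult Rabs_right; lra.
  exists (t - 1/2); split=> [|t' _ ht' /Rabs_def2]; lra.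
have [d2 [d2p h2]] : exists d, 0 < d /\ forall t', in01 t' -> 1/2 < t' -> Rabs (t' - t) < d ->
     dst (cat g h t') (cat g h t) < e.
  case: (Rlt_dec t (1/2)) => ht.
    exists (1/2 - t); split=> [|t' _ ht' /Rabs_def2]; lra.
  have e1 : cat g h t = h (2 * t - 1).
    case: (Rle_dec t (1/2)) => ht2; last by apply: catr; lra.
    rewrite catl //; have -> : 2 * t = 1 by lra.
    by rewrite gh; congr h; lra.
  have [d [dp hd]] := ch (2 * t - 1) ltac:(case: t01; split; lra) e e0.
  exists (d/2); split=> [|t' [t0 t1] ht' hd']; first lra.
  rewrite e1 catr //; apply: hd; first by split; lra.
  have -> : 2 * t' - 1 - (2 * t - 1) = 2 * (t' - t) by lra.
  by rewrite Rabs_mult Rabs_right; lra.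
exists (Rmin d1 d2); split; first exact: Rmin_glb_lt.
have [m1 m2] := (Rmin_l d1 d2, Rmin_r d1 d2).
move=> t' t'01 hd; case: (Rle_dec t' (1/2)) => ht'; [apply: h1|apply: h2] => //; lra.
Qed.

Lemma cat_inj g h : inj01 g -> inj01 h ->
  (forall t t', in01 t -> in01 t' -> g t = h t' -> t = 1 /\ t' = 0) -> inj01 (cat g h).
Proof.
move=> ig ih gh t t' [? ?] [? ?].
rewrite /cat; case: Rle_dec => h1; case: Rle_dec => h2 => heq; try (have {}h1 := Rnot_le_lt _ _ h1); try (have {}h2 := Rnot_le_lt _ _ h2).
- by have := ig (2*t) (2*t') ltac:(split; lra) ltac:(split; lra) heq; lra.
- by have := gh (2*t) (2*t'-1) ltac:(split; lra) ltac:(split; lra) heq; lra.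
- by have := gh (2*t') (2*t-1) ltac:(split; lra) ltac:(split; lra) (esym heq); lra.
- by have := ih (2*t-1) (2*t'-1) ltac:(split; lra) ltac:(split; lra) heq; lra.
Qed.

Lemma cat0 g h : cat g h 0 = g 0.
Proof. by rewrite catl; [rewrite Rmult_0_r|lra]. Qed.
Lemma cat1 g h : cat g h 1 = h 1.
Proof. by rewrite catr; [congr (h _); lra|lra]. Qed.

Lemma sub_cont g a b : 0 <= a <= b -> b <= 1 -> cont01 g -> cont01 (sub g a b).
Proof.
move=> hab hb cg t t01 e e0.
have hin : forall t, in01 t -> in01 (a + t * (b - a)).
  by move=> u [u0 u1]; split; nra.
have [d [dp hd]] := cg _ (hin t t01) e e0; exists d; split=> // t' t'01 ht.
apply: hd; first exact: hin.
have -> : a + t' * (b - a) - (a + t * (b - a)) = (t' - t) * (b - a) by lra.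
rewrite Rabs_mult (Rabs_right (b - a)); last lra.
by have := Rabs_pos (t' - t); nra.
Qed.

Lemma sub_inj g a b : 0 <= a < b -> b <= 1 -> inj01 g -> inj01 (sub g a b).
Proof.
move=> hab hb ig t t' [t0 t1] [t'0 t'1] /ig h.
have : a + t * (b - a) = a + t' * (b - a) by apply: h; split; nra.
by move=> h'; nra.
Qed.

Lemma rev_arc g : arc g -> arc (rev g).
Proof.
move=> [cg ig]; split=> [t [t0 t1] e e0|t t' [t0 t1] [t'0 t'1] /ig h].
  have [d [dp hd]] := cg (1 - t) ltac:(split; lra) e e0.
  exists d; split=> // t' [t'0 t'1] ht; apply: hd; first by split; lra.
  have -> : 1 - t' - (1 - t) = - (t' - t) by lra.
  by rewrite Rabs_Ropp.
by have := h ltac:(split; lra) ltac:(split; lra); lra.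
Qed.

Definition ray (p v : pt) (s : R) : pt := (p.1 + s * v.1, p.2 + s * v.2).

Lemma dst_ray p v s : 0 <= s -> dst (ray p v s) p = s * dst v (0, 0).
Proof.
move=> s0; rewrite /dst /ray /=.
have -> : p.1 + s * v.1 - p.1 = s * v.1 by lra.
have -> : p.2 + s * v.2 - p.2 = s * v.2 by lra.
by rewrite !Rminus_0_r !Rabs_mult (Rabs_right s); lra.
Qed.

Lemma ray_cont p v : cont01 (ray p v).
Proof.
move=> t t01 e e0.
have Np := dst_ge0 v (0, 0).
exists (e / (dst v (0, 0) + 1)); split; first by apply: Rdiv_lt_0_compat; lra.
move=> t' t'01 ht.
have -> : dst (ray p v t') (ray p v t) = Rabs (t' - t) * dst v (0, 0).
  rewrite /dst /ray /= !Rminus_0_r Rmult_plus_distr_l -!Rabs_mult.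
  by congr (Rabs _ + Rabs _); lra.
have h1 : Rabs (t' - t) * (dst v (0, 0) + 1) < e.
  apply: (Rmult_lt_reg_r (/ (dst v (0, 0) + 1))); first by apply: Rinv_0_lt_compat; lra.
  by rewrite Rmult_assoc Rinv_r ?Rmult_1_r; [|lra].
by have := Rabs_pos (t' - t); nra.
Qed.

Lemma ray_inj p v s s' : v <> (0, 0) -> ray p v s = ray p v s' -> s = s'.
Proof.
case: v => a b h [h1 h2]; apply: NNPP => hs; apply: h.
have ha : (s - s') * a = 0 by lra.
have hb : (s - s') * b = 0 by lra.
by case: (Rmult_integral _ _ ha) => ?; case: (Rmult_integral _ _ hb) => ?;
  congr pair; lra.
Qed.

End PlaneTopology.

(** * Making a family of arcs radial near a common endpoint *)

Section Straighten.
Local Open Scope R_scope.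
Notation pt := (R * R)%type.

Lemma ray_dir_inj p v v' s : s <> 0 -> ray p v s = ray p v' s -> v = v'.
Proof.
case: v v' => [a b] [c d] s0 [h1 h2].
by congr pair; apply: (Rmult_eq_reg_l s) => //; lra.
Qed.

(** One time is open and the other closed: distinct arcs may share endpoints, but no endpoint lies
    inside another arc. *)
Definition arcfam (E W : Type) (g : E -> R -> pt) (pos : W -> pt) : Prop :=
  (forall e, arc (g e)) /\
  (forall e e' t t', e <> e' -> in01o t -> in01 t' -> g e t <> g e' t') /\
  (forall e t w, in01o t -> g e t <> pos w).

(** Each arc leaving [P] is cut at its last visit to the circle of radius [rho], and what comes
    before is replaced by the radius to that point. Afterwards the arc stays outside the disc, so
    the radii meet nothing else, and disjoint arcs have distinct last points, hence distinct
    directions. *)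
Lemma straighten (E W : finType) (g : E -> R -> pt) (pos : W -> pt) (P : pt) (S : pred E) r0 :
  arcfam E W g pos -> 0 < r0 ->
  (forall e, S e -> g e 0 = P) -> (forall e, ~~ S e -> forall t, in01 t -> g e t <> P) ->
  exists rho g' D, 0 < rho < r0 /\ arcfam E W g' pos /\
    (forall e, g' e 0 = g e 0 /\ g' e 1 = g e 1) /\
    (forall e t, in01 t -> rho <= dst (g' e t) P -> exists t', in01 t' /\ g' e t = g e t') /\
    (forall e t, in01 t -> dst (g' e t) P < rho ->
       S e /\ exists s, 0 <= s /\ g' e t = ray P (D e) s) /\
    (forall e e' s, S e -> S e' -> e <> e' -> 0 <= s -> D e <> (s * (D e').1, s * (D e').2)) /\
    (forall e, S e -> D e <> (0, 0)) /\
    (forall w, pos w <> P -> rho < dst (pos w) P).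
Proof.
move=> [ga [gpw gav]] r0p hS hNS.
have [eta1 [e1p h1]] : exists eta, 0 < eta /\ forall e : E,
   (fun e eta => (S e -> eta <= dst (g e 1) P) /\
        (~~ S e -> forall t, in01 t -> eta <= dst (g e t) P)) e eta.
  apply: fin_pos; last first.
    by move=> e x y [a b] hy; split=> [/a|/b h t /h]; lra.
  move=> e; case Se: (S e).
    exists (dst (g e 1) P); split; last by split=> // _; lra.
    apply: dst_gt0; rewrite -(hS e Se) => h; have [_ ig] := ga e.
    by have := ig _ _ in01_1 in01_0 h; lra.
  have [|eta [ep he]] := curve_point_apart (g e) P (proj1 (ga e)).
    by apply: hNS; rewrite Se.
  by exists eta.
have [eta2 [e2p h2]] : exists eta, 0 < eta /\ forall w : W,
   (fun w eta => pos w <> P -> eta <= dst (pos w) P) w eta.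
  apply: fin_pos; last by move=> e x y a hy /a; lra.
  move=> w; case: (classic (pos w = P)) => hw; first by exists 1; split; [lra|].
  by exists (dst (pos w) P); split; [exact: dst_gt0|lra].
(* With these bounds the disc meets only arcs in [S], contains none of their far ends and no vertex
   other than one placed at [P]. *)
have [rho [rp [r1 [r2 r3]]]] : exists rho, 0 < rho /\ rho < eta1 /\ rho < eta2 /\ rho < r0.
  exists (Rmin eta1 (Rmin eta2 r0) / 2).
  have a0 : 0 < Rmin eta1 (Rmin eta2 r0) by do 2 (apply: Rmin_glb_lt => //).
  have := Rmin_l eta1 (Rmin eta2 r0); have := Rmin_r eta1 (Rmin eta2 r0).
  have := Rmin_l eta2 r0; have := Rmin_r eta2 r0; lra.
have Tex e : {T | S e -> 0 < T < 1 /\ dst (g e T) P = rho /\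
                  forall t, in01 t -> T < t -> rho < dst (g e t) P}.
  apply: constructive_indefinite_description; case Se: (S e); last by exists 0.
  have [|T [[T0 T1] [_ [a [b c]]]]] := last_time (g e) P rho 0 (proj1 (ga e)) in01_0.
    by rewrite hS // dstxx; lra.
  have [h11 _] := h1 e; have {}h11 := h11 Se.
  have T1' : T < 1 by apply: Rnot_le_lt => hT; have eT : T = 1 by [lra]; subst T; lra.
  exists T => _; split; last by split; [exact: c|].
  split=> //; apply: Rnot_le_lt => hT; have eT : T = 0 by [lra].
  by have := c T1'; rewrite eT hS // dstxx; lra.
pose T e := proj1_sig (Tex e).
have hT e (Se : S e) : 0 < T e < 1 /\ dst (g e (T e)) P = rho /\
     forall t, in01 t -> T e < t -> rho < dst (g e t) P by apply: (proj2_sig (Tex e)).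
clearbody T => {Tex}.
pose D e : pt := ((g e (T e)).1 - P.1, (g e (T e)).2 - P.2).
have DN e : S e -> dst (D e) (0, 0) = rho.
  by move=> Se; have [_ [<- _]] := hT e Se; rewrite /dst /D /= !Rminus_0_r.
have ray1 e : ray P (D e) 1 = g e (T e).
  by rewrite /ray /D /= {3}(surjective_pairing (g e (T e))); congr pair; lra.
pose g' e := if S e then cat (ray P (D e)) (sub (g e) (T e) 1) else g e.
have near e t : S e -> in01 t -> t <= 1/2 ->
    g' e t = ray P (D e) (2 * t) /\ dst (g' e t) P = 2 * t * rho.
  move=> Se [t0 t1] ht; rewrite /g' Se catl //; split=> //.
  by rewrite dst_ray ?DN //; lra.
have far e t : S e -> in01 t -> 1/2 < t -> exists u, T e < u /\ in01 u /\
    (t < 1 -> in01o u) /\ g' e t = g e u /\ rho < dst (g' e t) P.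
  move=> Se [t0 t1] ht; have [hT0 [_ hT2]] := hT e Se.
  rewrite /g' Se catr // /sub; set u := _ + _.
  have hu : T e < u <= 1 by rewrite /u; split; nra.
  exists u; split; first lra; split; first by split; lra.
  split; first by move=> t1'; split; [lra|rewrite /u; nra].
  by split=> //; apply: hT2; [split; lra|lra].
have g'N e : ~~ S e -> g' e = g e by rewrite /g' => /negbTE ->.
have farN e t : ~~ S e -> in01 t -> rho < dst (g e t) P.
  by move=> Se t01; have [_ h] := h1 e; have := h Se t t01; lra.
exists rho, g', D; split; first by split.
split; [split; [|split]|].
- move=> e; case Se: (S e); last by rewrite g'N ?Se.
  have [hT0 [hT1 hT2]] := hT e Se; have [cg ig] := ga e.
  rewrite /g' Se; split.
    apply: cat_cont; [exact: ray_cont|apply: sub_cont => //; lra|].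
    by rewrite ray1 /sub; congr (g e _); lra.
  apply: cat_inj; [|apply: sub_inj => //; lra|].
    move=> t t' _ _; apply: ray_inj => hD; have := DN e Se.
    by rewrite hD dstxx; lra.
  move=> t t' [t0 t1] [t'0 t'1] heq.
  have a : dst (ray P (D e) t) P = t * rho by rewrite dst_ray ?DN.
  rewrite heq /sub in a.
  case: (Req_dec t' 0) => ht'; last first.
    by exfalso; have := hT2 (T e + t' * (1 - T e)) ltac:(split; nra) ltac:(nra); nra.
  rewrite ht' Rmult_0_l Rplus_0_r hT1 in a; split=> //; nra.
- move=> e e' t t' ne to t'01.
  have t01 := in01o_in01 _ to.
  case Se: (S e); case Se': (S e').
  + case: (Rle_dec t (1/2)) => ht; case: (Rle_dec t' (1/2)) => ht'.
    * have [a b] := near e t Se t01 ht; have [a' b'] := near e' t' Se' t'01 ht'.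
      move=> heq; rewrite heq in b; have tt : t = t' by nra.
      subst t'; rewrite a a' in heq.
      have eD : D e = D e'.
        by apply: ray_dir_inj heq; case: to; lra.
      have [hT0 _] := hT e Se; have [hT0' _] := hT e' Se'.
      apply: (gpw e e' (T e) (T e') ne); [exact: hT0|split; lra|].
      by rewrite -!ray1 eD.
    * have [a b] := near e t Se t01 ht.
      have [u [_ [_ [_ [_ c]]]]] := far e' t' Se' t'01 (Rnot_le_lt _ _ ht').
      by move=> heq; rewrite -heq in c; nra.
    * have [a b] := near e' t' Se' t'01 ht'.
      have [u [_ [_ [_ [_ c]]]]] := far e t Se t01 (Rnot_le_lt _ _ ht).
      by move=> heq; rewrite heq in c; case: t'01; nra.
    * have [u [_ [u01 [uo [-> _]]]]] := far e t Se t01 (Rnot_le_lt _ _ ht).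
      have [u' [_ [u'01 [u'o [-> _]]]]] := far e' t' Se' t'01 (Rnot_le_lt _ _ ht').
      by apply: gpw => //; apply: uo; case: to.
  + rewrite (g'N e') ?Se' //; have c := farN e' t' ltac:(by rewrite Se') t'01.
    case: (Rle_dec t (1/2)) => ht.
      have [a b] := near e t Se t01 ht.
      by move=> heq; rewrite heq in b; nra.
    have [u [_ [u01 [uo [-> _]]]]] := far e t Se t01 (Rnot_le_lt _ _ ht).
    by apply: gpw => //; apply: uo; case: to.
  + rewrite (g'N e) ?Se //; have c := farN e t ltac:(by rewrite Se) t01.
    case: (Rle_dec t' (1/2)) => ht'.
      have [a b] := near e' t' Se' t'01 ht'.
      by move=> heq; rewrite -heq in b; nra.
    have [u [_ [u01 [uo [-> _]]]]] := far e' t' Se' t'01 (Rnot_le_lt _ _ ht').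
    by apply: gpw.
  + by rewrite (g'N e) ?Se // (g'N e') ?Se' //; apply: gpw.
- move=> e t w to; have t01 := in01o_in01 _ to.
  case Se: (S e); last by rewrite g'N ?Se //; apply: gav.
  case: (Rle_dec t (1/2)) => ht.
    have [a b] := near e t Se t01 ht => hw; rewrite hw in b.
    case: (classic (pos w = P)) => hwP.
      by rewrite hwP dstxx in b; case: to; nra.
    by have := h2 w hwP; nra.
  have [u [_ [u01 [uo [-> _]]]]] := far e t Se t01 (Rnot_le_lt _ _ ht).
  by apply: gav; apply: uo; case: to.
split=> [e|].
  case Se: (S e); last by rewrite g'N ?Se.
  rewrite /g' Se cat0 cat1 hS // /sub; split.
    by rewrite /ray !Rmult_0_l !Rplus_0_r -surjective_pairing.
  by congr (g e _); lra.
split=> [e t t01|].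
  case Se: (S e); last by rewrite g'N ?Se //; exists t.
  case: (Rle_dec t (1/2)) => ht hd.
    have [a b] := near e t Se t01 ht; rewrite b in hd.
    have tt : t = 1/2 by nra.
    have [hT0 _] := hT e Se.
    exists (T e); split; first by split; lra.
    by rewrite a -ray1; congr (ray _ _ _); lra.
  have [u [_ [u01 [uo [-> _]]]]] := far e t Se t01 (Rnot_le_lt _ _ ht).
  by exists u.
split=> [e t t01|].
  case Se: (S e); last first.
    by rewrite g'N ?Se //; have := farN e t ltac:(by rewrite Se) t01; lra.
  case: (Rle_dec t (1/2)) => ht hd.
    have [a b] := near e t Se t01 ht; split=> //; exists (2 * t).
    by split=> //; case: t01; lra.
  have [u [_ [_ [_ [_ c]]]]] := far e t Se t01 (Rnot_le_lt _ _ ht); lra.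
(* Both directions have norm [rho]; if they were proportional they would coincide, and the two arcs
   would share their last point on the circle. *)
split=> [e e' s Se Se' ne s0 heq|].
  have a := DN e Se; have a' := DN e' Se'.
  have b : dst (D e) (0, 0) = s * dst (D e') (0, 0).
    by rewrite heq /dst /= !Rminus_0_r !Rabs_mult (Rabs_right s); lra.
  have s1 : s = 1 by nra.
  have eD : D e = D e' by rewrite heq s1 !Rmult_1_l -surjective_pairing.
  have [hT0 _] := hT e Se; have [hT0' _] := hT e' Se'.
  apply: (gpw e e' (T e) (T e') ne); [exact: hT0|split; lra|].
  by rewrite -!ray1 eD.
split=> [e Se hD|w hw]; first by have := DN e Se; rewrite hD dstxx; lra.
by have := h2 w hw; lra.
Qed.

End Straighten.

(** * Thin neighbourhoods of a segment that meets a compact set in one end *)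

Section FreeStrip.
Local Open Scope R_scope.
Notation pt := (R * R)%type.

(** Finite unions of curves suffice for drawings: they are stable under unions and continuous
    images, and distances between them are controlled by [fin_pos] and [curves_apart]. *)
Definition compactset (K : pt -> Prop) : Prop :=
  exists (F : finType) (c : F -> R -> pt), (forall f, cont01 (c f)) /\
    forall x, K x <-> exists f t, in01 t /\ x = c f t.

Definition segp (p q : pt) (s : R) : pt :=
  (p.1 + s * (q.1 - p.1), p.2 + s * (q.2 - p.2)).

Definition seg (p q x : pt) : Prop := exists s, in01 s /\ x = segp p q s.

Lemma segp_cont p q : cont01 (segp p q).
Proof. exact: (ray_cont p (q.1 - p.1, q.2 - p.2)). Qed.

Lemma segp0 p q : segp p q 0 = p.
Proof. by rewrite /segp !Rmult_0_l !Rplus_0_r -surjective_pairing. Qed.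

Lemma segp1 p q : segp p q 1 = q.
Proof. by case: p q => [? ?] [? ?]; rewrite /segp /=; congr pair; lra. Qed.

Lemma seg_compact p q : compactset (seg p q).
Proof.
exists unit, (fun=> segp p q); split=> [_|x]; first exact: segp_cont.
by split=> [[s h]|[_ h]]; [exists tt, s|].
Qed.

Lemma compactU K K' : compactset K -> compactset K' -> compactset (fun x => K x \/ K' x).
Proof.
move=> [F [c [cc hK]]] [F' [c' [cc' hK']]].
exists (F + F')%type, (fun f => match f with inl f => c f | inr f => c' f end).
split=> [[f|f]|x]; [exact: cc|exact: cc'|].
split=> [[/hK|/hK'] [f [t h]]|[[f|f] [t h]]].
- by exists (inl f), t.
- by exists (inr f), t.
- by left; apply/hK; exists f, t.
- by right; apply/hK'; exists f, t.
Qed.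

Lemma compact_apart K K' : compactset K -> compactset K' -> (forall x, K x -> K' x -> False) ->
  exists eta, 0 < eta /\ forall x y, K x -> K' y -> eta <= dst x y.
Proof.
move=> [F [c [cc hK]]] [F' [c' [cc' hK']]] hd.
have [eta [ep he]] : exists eta, 0 < eta /\ forall ff : F * F', (fun ff eta =>
     forall s t, in01 s -> in01 t -> eta <= dst (c ff.1 s) (c' ff.2 t)) ff eta.
  apply: fin_pos; last by move=> e x y h hy s t s01 t01; have := h s t s01 t01; lra.
  move=> [f f'] /=; apply: curves_apart => // s t s01 t01 h.
  by apply: (hd (c f s)); [apply/hK; exists f, s|apply/hK'; exists f', t].
exists eta; split=> // x y /hK [f [t [t01 ->]]] /hK' [f' [t' [t'01 ->]]].
exact: (he (f, f')).
Qed.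

(* Dot and cross products of [k - a] with [b - a]. *)
Definition dt (a b k : pt) : R :=
  (k.1 - a.1) * (b.1 - a.1) + (k.2 - a.2) * (b.2 - a.2).
Definition cr (a b k : pt) : R :=
  (k.1 - a.1) * (b.2 - a.2) - (k.2 - a.2) * (b.1 - a.1).

(** Near [a], the set [K] stays out of a cone around the half-line from [a] towards [b]; [C] bounds
    the cotangent of the angle. The apex [a] itself may belong to [K]. *)
Definition wedge (K : pt -> Prop) (a b : pt) : Prop :=
  exists rho C, 0 < rho /\ forall k, K k -> dst k a < rho -> dt a b k <= C * Rabs (cr a b k).

(** The edge from [b] to [c] does not run back over the edge from [a] to [b]: either [c] is off
    their line or it lies beyond [b]. *)
Definition nonfold (a b c : pt) : Prop := cr a b c <> 0 \/ dt a b b < dt a b c.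

Lemma dt_gt0 a b : a <> b -> 0 < dt a b b.
Proof.
case: a b => [a1 a2] [b1 b2] ne; rewrite /dt /=.
have [q1 q2] := (Rle_0_sqr (b1 - a1), Rle_0_sqr (b2 - a2)); rewrite /Rsqr in q1 q2.
case: (Req_dec b1 a1) => h1; last first.
  by have := Rsqr_pos_lt (b1 - a1) ltac:(lra); rewrite /Rsqr; lra.
case: (Req_dec b2 a2) => h2; last first.
  by have := Rsqr_pos_lt (b2 - a2) ltac:(lra); rewrite /Rsqr; lra.
by case: ne; rewrite h1 h2.
Qed.

Definition contpl (phi : pt -> pt) : Prop := forall p eps, 0 < eps ->
  exists delta, 0 < delta /\ forall q, dst q p < delta -> dst (phi q) (phi p) < eps.

Lemma contpl_cont01 phi g : contpl phi -> cont01 g -> cont01 (fun t => phi (g t)).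
Proof.
move=> cp cg t t01 e e0; have [d [dp hd]] := cp (g t) e e0.
by have [d' [d'p hd']] := cg t t01 d dp; exists d'; split=> // t' t'01 /hd' - /(_ t'01) /hd.
Qed.

Lemma compact_image phi K : contpl phi -> compactset K ->
  compactset (fun y => exists x, K x /\ y = phi x).
Proof.
move=> cp [F [c [cc hK]]]; exists F, (fun f t => phi (c f t)); split=> [f|y].
  exact: contpl_cont01.
split=> [[x [/hK [f [t [t01 ->]]] ->]]|[f [t [t01 ->]]]]; first by exists f, t.
by exists (c f t); split=> //; apply/hK; exists f, t.
Qed.

(** [fX] and [fY] are coordinates in the orthogonal frame with origin [a] whose first vector is
    [b - a] and whose second one is a quarter turn of it. *)
Definition fX (a b k : pt) : R := dt a b k / dt a b b.
Definition fY (a b k : pt) : R := cr a b k / dt a b b.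

Section Frame.
Variables (a b : pt).
Hypothesis ab : a <> b.
Notation L := (dt a b b).
Notation X := (fX a b).
Notation Y := (fY a b).
Notation n := (dst b a).

Let Lp : 0 < L. Proof. exact: dt_gt0. Qed.
Let np : 0 < n. Proof. by apply: dst_gt0 => h; apply: ab. Qed.

Lemma frame_dst k x : dst k (segp a b x) <= (Rabs (X k - x) + Rabs (Y k)) * n.
Proof.
have e1 : k.1 - (a.1 + x * (b.1 - a.1)) = (X k - x) * (b.1 - a.1) + Y k * (b.2 - a.2).
  by rewrite /fX /fY; move: Lp; rewrite /dt /cr => h; field; lra.
have e2 : k.2 - (a.2 + x * (b.2 - a.2)) = (X k - x) * (b.2 - a.2) - Y k * (b.1 - a.1).
  by rewrite /fX /fY; move: Lp; rewrite /dt /cr => h; field; lra.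
rewrite /dst /= e1 e2.
have := Rabs_triang ((X k - x) * (b.1 - a.1)) (Y k * (b.2 - a.2)).
have := Rabs_triang ((X k - x) * (b.2 - a.2)) (- (Y k * (b.1 - a.1))).
rewrite Rabs_Ropp !Rabs_mult -/(Rminus ((X k - x) * (b.2 - a.2)) _); lra.
Qed.

Lemma frame_X k p : Rabs (X k - X p) <= dst k p * (n / L).
Proof.
have -> : X k - X p = ((k.1 - p.1) * (b.1 - a.1) + (k.2 - p.2) * (b.2 - a.2)) / L.
  by move: Lp; rewrite /fX /dt => h; field; lra.
rewrite Rabs_mult (Rabs_right (/ L)); last by apply/Rle_ge/Rlt_le/Rinv_0_lt_compat.
rewrite /Rdiv -Rmult_assoc; apply: Rmult_le_compat_r.
  exact/Rlt_le/Rinv_0_lt_compat.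
have := Rabs_triang ((k.1 - p.1) * (b.1 - a.1)) ((k.2 - p.2) * (b.2 - a.2)).
rewrite !Rabs_mult /dst.
have := Rabs_pos (k.1 - p.1); have := Rabs_pos (k.2 - p.2).
have := Rabs_pos (b.1 - a.1); have := Rabs_pos (b.2 - a.2); nra.
Qed.

Lemma frame_Y k p : Rabs (Y k - Y p) <= dst k p * (n / L).
Proof.
have -> : Y k - Y p = ((k.1 - p.1) * (b.2 - a.2) - (k.2 - p.2) * (b.1 - a.1)) / L.
  by rewrite /fY /cr; field; lra.
rewrite Rabs_mult (Rabs_right (/ L)); last by apply/Rle_ge/Rlt_le/Rinv_0_lt_compat.
rewrite /Rdiv -Rmult_assoc; apply: Rmult_le_compat_r.
  exact/Rlt_le/Rinv_0_lt_compat.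
have := Rabs_triang ((k.1 - p.1) * (b.2 - a.2)) (- ((k.2 - p.2) * (b.1 - a.1))).
rewrite Rabs_Ropp !Rabs_mult -/(Rminus ((k.1 - p.1) * (b.2 - a.2)) _) /dst.
have := Rabs_pos (k.1 - p.1); have := Rabs_pos (k.2 - p.2).
have := Rabs_pos (b.1 - a.1); have := Rabs_pos (b.2 - a.2); nra.
Qed.

(** Close to [a] this is the wedge condition. Elsewhere [K] has positive distance from the rest of
    the segment, so [|Y|] is bounded below while [X] is at most [1 + eps]. *)
Lemma free_strip K : compactset K -> wedge K a b -> (forall x, K x -> seg a b x -> x = a) ->
  exists eps C, 0 < eps /\ 0 <= C /\
    forall k, K k -> - eps <= X k <= 1 + eps -> X k <= C * Rabs (Y k).
Proof.
move=> cK [rho [C0 [rp hw]]] hfree.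
(* With this [x0], the bounds [0 < X < x0] and [|Y| < x0] put [k] within [rho] of [a], where the
   wedge applies. *)
pose x0 := Rmin 1 (rho / (3 * n)).
have r3 : 0 < rho / (3 * n) by apply: Rdiv_lt_0_compat; lra.
have x0p : 0 < x0 by apply: Rmin_glb_lt => //; lra.
have x01 : x0 <= 1 by apply: Rmin_l.
have x0n : x0 * n <= rho / 3.
  have := Rmin_r 1 (rho / (3 * n)); rewrite -/x0 => h.
  apply: Rle_trans (Rmult_le_compat_r n _ _ ltac:(lra) h) _.
  by apply: Req_le; field; lra.
have hsf x : K x -> seg (segp a b x0) b x -> False.
  move=> Kx [s [[s0 s1] hs]].
  have hx : x = segp a b (x0 + s * (1 - x0)) by rewrite hs /segp /=; congr pair; ring.
  have xa : x = a.
    by apply: hfree => //; exists (x0 + s * (1 - x0)); split=> //; split; nra.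
  have e1 : X x = 0 by move: Lp; rewrite xa /fX /dt => h; field; lra.
  have e2 : X x = x0 + s * (1 - x0).
    by rewrite hx /fX; move: Lp; rewrite /dt /segp /= => h; field; lra.
  nra.
have [eta [ep heta]] := compact_apart _ _ cK (seg_compact (segp a b x0) b) hsf.
pose eps := eta / (2 * n).
have epsp : 0 < eps by apply: Rdiv_lt_0_compat; lra.
have epsn : eps * n = eta / 2 by rewrite /eps; field; lra.
(* [r] turns [eps <= |Y|] into [X <= 1 + eps <= r |Y|]. *)
have [r [hr re]] : exists r, 0 < r /\ r * eps = 1 + eps.
  by exists ((1 + eps) / eps); split; [apply: Rdiv_lt_0_compat; lra|field; lra].
have C0a := Rabs_pos C0; have C0b := Rle_abs C0.
exists eps, (Rabs C0 + 1 + r); split=> //; split; first lra.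
move=> k Kk [hX1 hX2].
have Yp := Rabs_pos (Y k).
have sY : Rabs (cr a b k) = L * Rabs (Y k).
  have -> : cr a b k = L * Y k by rewrite /fY; field; lra.
  by rewrite Rabs_mult (Rabs_right L); lra.
have sX : dt a b k = L * X k by rewrite /fX; field; lra.
case: (Rle_dec (X k) 0) => hX0.
  by have := Rmult_le_pos (Rabs C0 + 1 + r) (Rabs (Y k)) ltac:(lra) Yp; lra.
case: (Rlt_dec (X k) x0) => hXx0.
  case: (Rlt_dec (Rabs (Y k)) x0) => hY; last first.
    by have := Rmult_le_pos (Rabs C0 + r) (Rabs (Y k)) ltac:(lra) Yp; lra.
  have := frame_dst k 0; rewrite segp0 Rminus_0_r (Rabs_right (X k)); last lra.
  move=> hd; have := hw k Kk ltac:(nra); rewrite sX sY => h.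
  have q0 : 0 <= L * Rabs (Y k) by apply: Rmult_le_pos; lra.
  have q1 := Rmult_le_pos (L * Rabs (Y k)) (Rabs C0 - C0) q0 ltac:(lra).
  have : L * X k <= L * (Rabs C0 * Rabs (Y k)) by lra.
  move/(Rmult_le_reg_l _ _ _ Lp).
  by have := Rmult_le_pos (1 + r) (Rabs (Y k)) ltac:(lra) Yp; lra.
have hYe : eps <= Rabs (Y k).
  pose x' := Rmin (X k) 1.
  have m1 : x' <= 1 by apply: Rmin_r.
  have m2 : x0 <= x' by apply: Rmin_glb; lra.
  have m3 : Rabs (X k - x') <= eps.
    by rewrite /x' /Rmin; case: Rle_dec => h; rewrite Rabs_right; lra.
  have hk : eta <= dst k (segp a b x').
    apply: heta => //.
    case: (Req_dec x0 1) => h1.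
      exists 1; split; first exact: in01_1.
      have -> : x' = 1 by lra.
      by rewrite segp1 segp1.
    exists ((x' - x0) / (1 - x0)); split.
      have i := Rinv_0_lt_compat (1 - x0) ltac:(lra).
      have e : (1 - x0) * / (1 - x0) = 1 by apply: Rinv_r; lra.
      by rewrite /Rdiv; split; nra.
    by rewrite /segp /=; congr pair; field; lra.
  have := frame_dst k x' => h.
  apply: Rnot_lt_le => hlt; nra.
nra.
Qed.

End Frame.
End FreeStrip.

(** * Pushing the first vertex of a polygon onto the second *)

Section SlideVertex.
Local Open Scope R_scope.
Notation pt := (R * R)%type.

(** The peak 1 at [0] moves [0] to [1], and the support ends at [- eps] and [1 + eps]. The
    descending slope [1 / (1 + eps)] is below 1, so [x + s * tent eps x] stays strictly increasing
    for [s] between 0 and 1. *)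
Definition tent (eps x : R) : R :=
  Rmax 0 (Rmin ((x + eps) * / eps) ((1 + eps - x) * / (1 + eps))).

Section Tent.
Variable eps : R.
Hypothesis ep : 0 < eps.

Lemma tent_inv : 0 < / eps /\ eps * / eps = 1 /\
  0 < / (1 + eps) < 1 /\ (1 + eps) * / (1 + eps) = 1.
Proof.
have i := Rinv_0_lt_compat eps ep; have j := Rinv_0_lt_compat (1 + eps) ltac:(lra).
have ii : eps * / eps = 1 by apply: Rinv_r; lra.
have jj : (1 + eps) * / (1 + eps) = 1 by apply: Rinv_r; lra.
by do 3 (split=> //); nra.
Qed.

Lemma tent0 : tent eps 0 = 1.
Proof.
have [_ [ii [_ jj]]] := tent_inv.
rewrite /tent Rplus_0_l ii Rminus_0_r jj Rmin_left; last lra.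
by rewrite Rmax_right //; lra.
Qed.

Lemma tent_out x : x <= - eps \/ 1 + eps <= x -> tent eps x = 0.
Proof.
have [i0 [ii [[j0 j1] jj]]] := tent_inv => hx; rewrite /tent Rmax_left //.
case: hx => hx.
  by apply: Rle_trans (Rmin_l _ _) _; nra.
by apply: Rle_trans (Rmin_r _ _) _; nra.
Qed.

Lemma tent_ge0 x : 0 <= tent eps x.
Proof. exact: Rmax_l. Qed.

Lemma tent_le x : x <= 1 + eps -> tent eps x <= 1 - x * / (1 + eps).
Proof.
have [i0 [ii [[j0 j1] jj]]] := tent_inv => hx; apply: Rmax_lub; first nra.
by apply: Rle_trans (Rmin_r _ _) _; nra.
Qed.

Lemma tent_le1 x : tent eps x <= 1.
Proof.
have [i0 [ii [[j0 j1] jj]]] := tent_inv; apply: Rmax_lub; first lra.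
case: (Rle_dec x 0) => hx; first by apply: Rle_trans (Rmin_l _ _) _; nra.
by apply: Rle_trans (Rmin_r _ _) _; nra.
Qed.

Lemma tent_step x y : x <= y ->
  tent eps x <= tent eps y + (y - x) * / (1 + eps) /\
  tent eps y <= tent eps x + (y - x) * / eps.
Proof.
have [i0 [ii [[j0 j1] jj]]] := tent_inv => xy.
have q : 0 <= (y - x) * / (1 + eps) by nra.
have q' : 0 <= (y - x) * / eps by nra.
have m z : Rmin ((z + eps) * / eps) ((1 + eps - z) * / (1 + eps)) <= tent eps z.
  exact: Rmax_r.
have hx := m x; have hy := m y.
have x0 := tent_ge0 x; have y0 := tent_ge0 y.
split; [rewrite {1}/tent|rewrite {1}/tent]; apply: Rmax_lub; try lra.
  by apply: Rle_trans (Rplus_le_compat_r _ _ _ hy); rewrite /Rmin; case: Rle_dec; case: Rle_dec; lra.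
by apply: Rle_trans (Rplus_le_compat_r _ _ _ hx); rewrite /Rmin; case: Rle_dec; case: Rle_dec; lra.
Qed.

Lemma tent_incr s x y : 0 <= s <= 1 -> x < y -> x + s * tent eps x < y + s * tent eps y.
Proof.
have [i0 [ii [[j0 j1] jj]]] := tent_inv => hs xy.
have [hb _] := tent_step x y (Rlt_le _ _ xy).
have b0 := tent_ge0 x; have b0' := tent_ge0 y.
have : s * (tent eps x - tent eps y) < y - x; last lra.
case: (Rle_dec (tent eps x - tent eps y) 0) => h; first by nra.
by apply: Rle_lt_trans (_ : 1 * (tent eps x - tent eps y) < _); nra.
Qed.

Lemma tent_lip x y : Rabs (tent eps x - tent eps y) <= Rabs (x - y) * (/ eps + 1).
Proof.
have [i0 [ii [[j0 j1] jj]]] := tent_inv.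
have aux u v : u <= v -> Rabs (tent eps u - tent eps v) <= (v - u) * (/ eps + 1).
  move=> uv.
  have q : 0 <= (v - u) * / (1 + eps) <= v - u by split; nra.
  have q' : 0 <= (v - u) * / eps by nra.
  by have [a a'] := tent_step u v uv; apply: Rabs_le; split; lra.
case: (Rle_dec x y) => xy.
  by rewrite (Rabs_minus_sym x) (Rabs_right (y - x)); [apply: aux|lra].
rewrite Rabs_minus_sym (Rabs_right (x - y)); last lra.
by apply: aux; lra.
Qed.
End Tent.

Lemma Rmax0_lip u v : Rabs (Rmax 0 u - Rmax 0 v) <= Rabs (u - v).
Proof.
have := Rle_abs (u - v); have := Rle_abs (v - u); rewrite (Rabs_minus_sym v).
have := Rabs_pos (u - v).
rewrite /Rmax; case: Rle_dec => h1; case: Rle_dec => h2 *; apply: Rabs_le; split; lra.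
Qed.

(** [phi] moves points only parallel to [a b], inside a thin strip around that segment, and is
    monotone on each parallel line, hence injective. [T] is the remaining polygon. The conclusions
    say that the image of [K] stands to the polygon starting at [b] as [K] stood to the one starting
    at [a], so the construction can be iterated. *)
Lemma slide (K T : pt -> Prop) (a b c : pt) :
  a <> b -> b <> c -> compactset K -> compactset T ->
  (forall x, T x -> seg a b x -> False) ->
  wedge K a b -> (forall x, K x -> seg a b x -> x = a) -> nonfold a b c ->
  exists phi, contpl phi /\ (forall p q, phi p = phi q -> p = q) /\ phi a = b /\
    (exists rho, 0 < rho /\ forall x k, T x -> dst (phi k) x < rho -> phi k = k) /\
    (forall x, T x -> phi x = x) /\
    (forall k, K k -> seg b c (phi k) -> phi k = b \/ phi k = k) /\
    wedge (fun y => exists k, K k /\ y = phi k) b c.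
Proof.
move=> ab bc cK cT hT hw hfree hnf.
have [e0 [C [e0p [C0 hC]]]] := free_strip a b ab K cK hw hfree.
have [eta [etap heta]] := compact_apart _ _ cT (seg_compact a b) hT.
have Lp := dt_gt0 a b ab; have np : 0 < dst b a by apply: dst_gt0 => h; apply: ab.
pose p0 := dt a b c - dt a b b; pose d0 := cr a b c.
(* [M0] is the steepness at [b] of the backward wedge that is to contain the image of [K]: large
   enough that the direction of [c - b], with components [p0] along and [d0] across [a b], lies
   outside that wedge. *)
have [M0 [M01 hM]] : exists M0, 1 <= M0 /\ (d0 <> 0 -> Rabs d0 + 2 * Rabs p0 <= M0 * Rabs d0).
  case: (Req_dec d0 0) => h; first by exists 1; split; [lra|].
  have dp : 0 < Rabs d0 by apply: Rabs_pos_lt.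
  have h0 : 0 <= 2 * Rabs p0 / Rabs d0.
    apply: Rmult_le_pos; first by have := Rabs_pos p0; lra.
    exact/Rlt_le/Rinv_0_lt_compat.
  exists (1 + 2 * Rabs p0 / Rabs d0); split=> [|_]; first lra.
  by apply: Req_le; field; lra.
have h4 : 0 < eta / (4 * dst b a) by apply: Rdiv_lt_0_compat; lra.
have [eps [ep [ee0 een]]] : exists eps, 0 < eps /\ eps <= e0 /\ eps * dst b a <= eta / 4.
  exists (Rmin e0 (eta / (4 * dst b a))); split; first exact: Rmin_glb_lt.
  split; first exact: Rmin_l.
  apply: Rle_trans (Rmult_le_compat_r _ _ _ (Rlt_le _ _ np) (Rmin_r _ _)) _.
  by apply: Req_le; field; lra.
have h1 : 0 < / (C + M0) by apply: Rinv_0_lt_compat; lra.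
(* The shift fades across the strip at rate [1 / kap], which has to beat both the rate [C] at which
   [K] leaves the segment and the steepness [M0]. The quarters of [eta] keep the strip away from
   [T]. *)
have [kap [kp [kn hk]]] : exists kap, 0 < kap /\ kap * dst b a <= eta / 4 /\ C + M0 <= / kap.
  exists (Rmin (/ (C + M0)) (eta / (4 * dst b a))).
  have mp : 0 < Rmin (/ (C + M0)) (eta / (4 * dst b a)) by apply: Rmin_glb_lt.
  split=> //; split.
    apply: Rle_trans (Rmult_le_compat_r _ _ _ (Rlt_le _ _ np) (Rmin_r _ _)) _.
    by apply: Req_le; field; lra.
  rewrite -{1}(Rinv_inv (C + M0)); apply: Rinv_le_contravar => //; exact: Rmin_l.
have ik := Rinv_0_lt_compat kap kp.
have kk : kap * / kap = 1 by apply: Rinv_r; lra.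
pose s y := Rmax 0 (1 - Rabs y * / kap).
have s01 y : 0 <= s y <= 1.
  split; first exact: Rmax_l.
  by apply: Rmax_lub; [lra|have := Rabs_pos y; nra].
have sout y : kap <= Rabs y -> s y = 0.
  by move=> h; rewrite /s Rmax_left //; nra.
have sin y : Rabs y < kap -> s y = 1 - Rabs y * / kap.
  by move=> h; rewrite /s Rmax_right //; nra.
pose f k := s (fY a b k) * tent eps (fX a b k).
pose phi (k : pt) : pt := (k.1 + f k * (b.1 - a.1), k.2 + f k * (b.2 - a.2)).
have f01 k : 0 <= f k <= 1.
  have := s01 (fY a b k); have := tent_ge0 eps (fX a b k); have := tent_le1 eps ep (fX a b k).
  by rewrite /f; move=> *; split; nra.
have Xphi k : fX a b (phi k) = fX a b k + f k.
  by move: Lp; rewrite /phi /fX; move: (f k) => fk; rewrite /dt /= => h; field; lra.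
have Yphi k : fY a b (phi k) = fY a b k.
  by move: Lp; rewrite /phi /fY; move: (f k) => fk; rewrite /cr /dt /= => h; field; lra.
have moved k : phi k <> k -> Rabs (fY a b k) < kap /\ - eps < fX a b k < 1 + eps.
  move=> hm; have fk : f k <> 0.
    by move=> h; apply: hm; rewrite /phi h !Rmult_0_l !Rplus_0_r -surjective_pairing.
  split; first by apply: Rnot_le_lt => h; apply: fk; rewrite /f sout // Rmult_0_l.
  split; apply: Rnot_le_lt => h; apply: fk; rewrite /f tent_out ?Rmult_0_r //; lra.
have Xrange k : - eps < fX a b k < 1 + eps -> - eps < fX a b k + f k < 1 + eps.
  move=> [x1 x2]; have := f01 k; split; first lra.
  have := tent_incr eps ep (s (fY a b k)) _ _ (s01 _) x2.
  by rewrite (tent_out eps ep (1 + eps)) ?Rmult_0_r ?Rplus_0_r //; lra.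
(* On [K] one has [X <= C |Y|], and the shift is at most [1 - |Y| / kap] with [1 / kap >= C + M0];
   so the image falls short of [b] by at least [M0 |Y|]. *)
have thin k : K k -> Rabs (fY a b k) < kap -> - eps <= fX a b k <= 1 + eps ->
    M0 * Rabs (fY a b k) <= 1 - fX a b (phi k).
  move=> Kk hY hX; rewrite Xphi.
  have Yp := Rabs_pos (fY a b k).
  have hXC := hC k Kk ltac:(lra).
  have q : (C + M0) * Rabs (fY a b k) <= / kap * Rabs (fY a b k) by apply: Rmult_le_compat_r.
  have es := sin _ hY; have := s01 (fY a b k); rewrite /f es => -[q0 q1].
  have b1 := tent_le1 eps ep (fX a b k); have b2 := tent_le eps ep (fX a b k) (proj2 hX).
  have [i0 [ii [[j0 j1] jj]]] := tent_inv eps ep.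
  set sv := 1 - _ * / kap in q0 q1 es *.
  have esv : sv = 1 - Rabs (fY a b k) * / kap by [].
  case: (Rle_dec 0 (fX a b k)) => hX0.
    have : sv * tent eps (fX a b k) <= sv * (1 - fX a b k * / (1 + eps)).
      by apply: Rmult_le_compat_l.
    have : 0 <= sv * (fX a b k * / (1 + eps)).
      by apply: Rmult_le_pos => //; nra.
    by nra.
  have : sv * tent eps (fX a b k) <= sv * 1 by apply: Rmult_le_compat_l.
  have := Rmult_le_pos C (Rabs (fY a b k)) C0 Yp.
  by nra.
have thin' k : K k -> Rabs (fY a b (phi k)) < kap -> - eps <= fX a b (phi k) <= 1 + eps ->
    M0 * Rabs (fY a b (phi k)) <= 1 - fX a b (phi k).
  move=> Kk; rewrite Yphi => hY hX; apply: thin => //.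
  rewrite Xphi in hX; have := f01 k.
  have out : fX a b k < - eps \/ 1 + eps < fX a b k -> f k = 0.
    by move=> h; rewrite /f tent_out ?Rmult_0_r //; lra.
  case: (Rle_dec (- eps) (fX a b k)) => u1; last by have := out (or_introl (Rnot_le_lt _ _ u1)); lra.
  case: (Rle_dec (fX a b k) (1 + eps)) => u2; last by have := out (or_intror (Rnot_le_lt _ _ u2)); lra.
  by split.
exists phi; split.
  move=> p e e_p.
  pose Q := 1 + (dst b a / dt a b b) * (/ kap + (/ eps + 1)) * dst b a.
  have Qp : 0 < Q.
    have [i0 _] := tent_inv eps ep.
    have r1 : 0 < dst b a / dt a b b by apply: Rdiv_lt_0_compat.
    have := Rmult_lt_0_compat _ _ (Rmult_lt_0_compat _ (/ kap + (/ eps + 1)) r1 ltac:(lra)) np.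
    by rewrite /Q; lra.
  exists (e / Q); split; first exact: Rdiv_lt_0_compat.
  move=> q hq.
  have lf : Rabs (f q - f p) <= dst q p * (dst b a / dt a b b) * (/ kap + (/ eps + 1)).
    have hX := frame_X a b ab q p; have hY := frame_Y a b ab q p.
    have ls : Rabs (s (fY a b q) - s (fY a b p)) <= Rabs (fY a b q - fY a b p) * / kap.
      apply: Rle_trans (Rmax0_lip _ _) _.
      have -> : 1 - Rabs (fY a b q) * / kap - (1 - Rabs (fY a b p) * / kap) =
                - ((Rabs (fY a b q) - Rabs (fY a b p)) * / kap) by lra.
      rewrite Rabs_Ropp Rabs_mult (Rabs_right (/ kap)); last lra.
      by apply: Rmult_le_compat_r; [lra|exact: Rabs_triang_inv2].
    have lb := tent_lip eps ep (fX a b q) (fX a b p).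
    have [i0 _] := tent_inv eps ep.
    move: (dst q p * (dst b a / dt a b b)) hX hY => A hX hY.
    have e1 : f q - f p = (s (fY a b q) - s (fY a b p)) * tent eps (fX a b q) +
              s (fY a b p) * (tent eps (fX a b q) - tent eps (fX a b p)) by rewrite /f; lra.
    rewrite e1; apply: Rle_trans (Rabs_triang _ _) _; rewrite !Rabs_mult.
    rewrite (Rabs_right (tent _ _)); last exact/Rle_ge/tent_ge0.
    rewrite (Rabs_right (s (fY a b p))); last by apply: Rle_ge; case: (s01 (fY a b p)).
    have b1 := tent_le1 eps ep (fX a b q); have b0 := tent_ge0 eps (fX a b q).
    have s1 := s01 (fY a b p).
    have k1 : Rabs (s (fY a b q) - s (fY a b p)) * tent eps (fX a b q) <= A * / kap.
      apply: Rle_trans (_ : Rabs (s (fY a b q) - s (fY a b p)) * 1 <= _).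
        by apply: Rmult_le_compat_l => //; apply: Rabs_pos.
      by rewrite Rmult_1_r; apply: Rle_trans ls _; apply: Rmult_le_compat_r; lra.
    have k2 : s (fY a b p) * Rabs (tent eps (fX a b q) - tent eps (fX a b p)) <= A * (/ eps + 1).
      apply: Rle_trans (_ : 1 * Rabs (tent eps (fX a b q) - tent eps (fX a b p)) <= _).
        by apply: Rmult_le_compat_r; [apply: Rabs_pos|lra].
      by rewrite Rmult_1_l; apply: Rle_trans lb _; apply: Rmult_le_compat_r; lra.
    by lra.
  have : dst (phi q) (phi p) <= dst q p + Rabs (f q - f p) * dst b a.
    rewrite /phi /dst /=; move: (f q) (f p) => fq fp.
    have -> : q.1 + fq * (b.1 - a.1) - (p.1 + fp * (b.1 - a.1)) = (q.1 - p.1) + (fq - fp) * (b.1 - a.1) by lra.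
    have -> : q.2 + fq * (b.2 - a.2) - (p.2 + fp * (b.2 - a.2)) = (q.2 - p.2) + (fq - fp) * (b.2 - a.2) by lra.
    have := Rabs_triang (q.1 - p.1) ((fq - fp) * (b.1 - a.1)).
    have := Rabs_triang (q.2 - p.2) ((fq - fp) * (b.2 - a.2)).
    by rewrite !Rabs_mult; lra.
  have h2 := Rmult_le_compat_r _ _ _ (Rlt_le _ _ np) lf.
  have h3 : dst q p * Q < e.
    apply: (Rmult_lt_reg_r (/ Q)); first exact: Rinv_0_lt_compat.
    by rewrite Rmult_assoc Rinv_r ?Rmult_1_r //; lra.
  by rewrite /Q in h3; lra.
split.
  move=> p q h.
  have eY : fY a b p = fY a b q by rewrite -Yphi h Yphi.
  have eX : fX a b p = fX a b q.
    have : fX a b (phi p) = fX a b (phi q) by rewrite h.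
    rewrite !Xphi /f eY => hh; have s1 := s01 (fY a b q).
    case: (Rtotal_order (fX a b p) (fX a b q)) => [hl|[//|hl]].
      by have := tent_incr eps ep _ _ _ s1 hl; lra.
    by have := tent_incr eps ep _ _ _ s1 hl; lra.
  have ef : f p = f q by rewrite /f eX eY.
  move: h; rewrite /phi ef => -[h2 h3].
  by rewrite (surjective_pairing p) (surjective_pairing q); congr pair; lra.
have Xa : fX a b a = 0 by rewrite /fX /dt !Rminus_diag !Rmult_0_l Rplus_0_l /Rdiv Rmult_0_l.
have Ya : fY a b a = 0 by rewrite /fY /cr !Rminus_diag !Rmult_0_l Rminus_0_r /Rdiv Rmult_0_l.
split.
  have -> : phi a = segp a b 1.
    rewrite /phi /segp; have -> : f a = 1; last by [].
    by rewrite /f Xa Ya tent0 // sin Rabs_R0 //; lra.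
  exact: segp1.
have away x w : T x -> Rabs (fY a b w) < kap -> - eps < fX a b w < 1 + eps -> eta / 2 <= dst x w.
  move=> Tx hY hX.
  pose xx := Rmax 0 (Rmin 1 (fX a b w)).
  have x01 : in01 xx.
    by rewrite /xx; split; [exact: Rmax_l|apply: Rmax_lub; [lra|exact: (Rmin_l 1)]].
  have h5 := heta x (segp a b xx) Tx (ex_intro _ xx (conj x01 erefl)).
  have h6 := frame_dst a b ab w xx.
  have h7 : Rabs (fX a b w - xx) <= eps.
    rewrite /xx; move: (fX a b w) hX => X' hX'; apply: Rabs_le.
    case: (Rle_dec X' 1) => u1; last by rewrite Rmin_left ?Rmax_right; lra.
    rewrite (Rmin_right 1 X') //.
    case: (Rle_dec 0 X') => u2; first by rewrite Rmax_right; lra.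
    by rewrite Rmax_left; lra.
  by have := dst_tri x w (segp a b xx); nra.
split.
  exists (eta / 2); split; first lra.
  move=> x k Tx hd; apply: NNPP => hm; have [hY hX] := moved k hm.
  have := Xrange k hX; rewrite -Xphi => hX'.
  by have := away x (phi k) Tx; rewrite Yphi (dst_sym x) => /(_ hY hX'); lra.
split.
  move=> x Tx; apply: NNPP => hm; have [hY hX] := moved x hm.
  by have := away x x Tx hY hX; rewrite dstxx; lra.
(* In the frame of [a, b], the image of K near b lies in a thin wedge pointing backwards. *)
have geo k : K k -> Rabs (fY a b (phi k)) < kap -> - eps <= fX a b (phi k) <= 1 + eps ->
    M0 * Rabs (cr a b (phi k)) <= dt a b b - dt a b (phi k).
  move=> Kk hY hX; have := thin' k Kk hY hX.
  have -> : cr a b (phi k) = dt a b b * fY a b (phi k) by rewrite /fY; field; lra.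
  have -> : dt a b (phi k) = dt a b b * fX a b (phi k) by rewrite /fX; field; lra.
  rewrite Rabs_mult (Rabs_right (dt a b b)); last lra.
  by move=> h; nra.
split.
  move=> k Kk [t [[t0 t1] ht]]; case: (classic (phi k = k)) => hm; [by right|left].
  have [hY hX] := moved k hm.
  have := Xrange k hX; rewrite -Xphi => hX'; rewrite -Yphi in hY.
  have g := geo k Kk hY ltac:(lra).
  case: (Req_dec t 0) => t0'; first by rewrite ht t0' segp0.
  exfalso; move: g; rewrite ht.
  have -> : cr a b (segp b c t) = t * d0 by rewrite /d0 /cr /segp /=; ring.
  have -> : dt a b b - dt a b (segp b c t) = - (t * p0) by rewrite /p0 /dt /segp /=; ring.
  rewrite Rabs_mult (Rabs_right t); last lra.
  move=> g; have g' : M0 * Rabs d0 <= - p0.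
    by apply: (Rmult_le_reg_l t); lra.
  case: hnf => [hd|hd].
    rewrite -/d0 in hd; by have := hM hd; have := Rabs_pos_lt _ hd; have := Rle_abs (- p0); rewrite Rabs_Ropp; have := Rabs_pos p0; lra.
  have := Rmult_le_pos M0 (Rabs d0) ltac:(lra) (Rabs_pos _); rewrite /p0 in g' *; lra.
have [rho [rp hrho]] : exists rho, 0 < rho /\ forall q, dst q b < rho ->
    Rabs (fY a b q) < kap /\ - eps <= fX a b q <= 1 + eps.
  pose r := dst b a / dt a b b; have rp : 0 < r by apply: Rdiv_lt_0_compat.
  exists (Rmin kap eps / r); have mp : 0 < Rmin kap eps by apply: Rmin_glb_lt.
  split; first exact: Rdiv_lt_0_compat.
  move=> q hq; have hX := frame_X a b ab q b; have hY := frame_Y a b ab q b.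
  have eX : fX a b b = 1 by rewrite /fX; field; lra.
  have eY : fY a b b = 0 by rewrite /fY /cr; field; lra.
  have hd : dst q b * r < Rmin kap eps.
    have -> : Rmin kap eps = Rmin kap eps / r * r by field; lra.
    exact: Rmult_lt_compat_r.
  have [m1 m2] := (Rmin_l kap eps, Rmin_r kap eps).
  rewrite eY Rminus_0_r -/r in hY; rewrite eX -/r in hX.
  split; first lra.
  by have /Rabs_def2 := Rle_lt_trans _ _ _ hX hd; lra.
exists rho.
have [CC [CC0 hCC]] : exists CC, 0 <= CC /\ (d0 <> 0 -> 2 * (Rabs p0 + Rabs d0) <= CC * Rabs d0).
  case: (Req_dec d0 0) => h; first by exists 0; split; [lra|].
  have dp : 0 < Rabs d0 by apply: Rabs_pos_lt.
  exists (2 * (Rabs p0 + Rabs d0) / Rabs d0); split=> [|_].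
    apply: Rmult_le_pos; last exact/Rlt_le/Rinv_0_lt_compat.
    by have := Rabs_pos p0; lra.
  by apply: Req_le; field; lra.
exists CC; split=> // q [k [Kk ->]] hd.
have [hY hX] := hrho _ hd.
have g := geo k Kk hY hX.
move: (phi k) g => {hd hY hX Kk} {}q g.
(* Up to scaling, [u] and [v] are the components of [q - b] along and across [a b]. The backward
   wedge gives [u <= 0] and [|v| <= |u|], and [M0] makes the [u d0] term dominate in the cross
   product with [c - b]. *)
pose u := dt a b q - dt a b b; pose v := cr a b q.
have e1 : dt a b b * dt b c q = u * p0 + v * d0 by rewrite /u /v /p0 /d0 /dt /cr; ring.
have e2 : dt a b b * cr b c q = v * p0 - u * d0 by rewrite /u /v /p0 /d0 /dt /cr; ring.
have gu : M0 * Rabs v <= - u by rewrite /u /v; lra.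
have vp := Rabs_pos v.
have u0 : u <= 0 by nra.
apply: (Rmult_le_reg_l (dt a b b)) => //.
have -> : dt a b b * (CC * Rabs (cr b c q)) = CC * Rabs (v * p0 - u * d0).
  by rewrite -e2 Rabs_mult (Rabs_right (dt a b b)); lra.
rewrite e1.
case: (Req_dec d0 0) => hd0.
  case: hnf => hd; first by case: hd.
  have : 0 <= CC * Rabs (v * p0 - u * d0) by apply: Rmult_le_pos => //; apply: Rabs_pos.
  by rewrite hd0 /p0 in hd *; nra.
have dp : 0 < Rabs d0 by apply: Rabs_pos_lt.
have hu : Rabs u = - u by rewrite Rabs_left1.
have vu : Rabs v <= Rabs u by rewrite hu; nra.
have low : Rabs u * Rabs d0 <= 2 * Rabs (v * p0 - u * d0).
  have h3 := Rabs_triang_inv (u * d0) (v * p0).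
  rewrite Rabs_minus_sym !Rabs_mult in h3.
  have h5 := hM hd0.
  have : 2 * (Rabs v * Rabs p0) <= Rabs u * Rabs d0.
    have a1 : Rabs v * (Rabs d0 + 2 * Rabs p0) <= Rabs v * (M0 * Rabs d0) by apply: Rmult_le_compat_l.
    have a2 : (M0 * Rabs v) * Rabs d0 <= Rabs u * Rabs d0 by apply: Rmult_le_compat_r; lra.
    have := Rmult_le_pos _ _ vp (Rlt_le _ _ dp); lra.
  lra.
have up : u * p0 + v * d0 <= Rabs u * (Rabs p0 + Rabs d0).
  have := Rle_abs (u * p0); have := Rle_abs (v * d0); rewrite !Rabs_mult => b1 b2.
  have : Rabs v * Rabs d0 <= Rabs u * Rabs d0 by apply: Rmult_le_compat_r; lra.
  lra.
have h6 := Rmult_le_compat_l (Rabs u) _ _ (Rabs_pos u) (hCC hd0).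
have h7 := Rmult_le_compat_l CC _ _ CC0 low.
lra.
Qed.

End SlideVertex.

(** * Opening a segment so that its complement fits into a lens *)

Section LensMap.
Local Open Scope R_scope.
Notation pt := (R * R)%type.

Definition cpt (f : pt -> R) (p : pt) : Prop := forall eps, 0 < eps ->
  exists delta, 0 < delta /\ forall q, dst q p < delta -> Rabs (f q - f p) < eps.

(** Continuity at single points, because the lens map contains an inversion whose centre lies off
    [K]. *)
Definition contAt (F : pt -> pt) (p : pt) : Prop := forall eps, 0 < eps ->
  exists delta, 0 < delta /\ forall q, dst q p < delta -> dst (F q) (F p) < eps.

Lemma cpt_cst c p : cpt (fun=> c) p.
Proof. by move=> e e0; exists 1; split; [lra|move=> q _; rewrite Rminus_diag Rabs_R0]. Qed.

Lemma cpt_fst p : cpt (fun q => q.1) p.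
Proof. by move=> e e0; exists e; split=> // q; apply: Rle_lt_trans; exact: dst_fst. Qed.

Lemma cpt_snd p : cpt (fun q => q.2) p.
Proof. by move=> e e0; exists e; split=> // q; apply: Rle_lt_trans; exact: dst_snd. Qed.

Lemma cpt_plus f g p : cpt f p -> cpt g p -> cpt (fun q => f q + g q) p.
Proof.
move=> cf cg e e0.
have [d [dp hd]] := cf (e / 2) ltac:(lra); have [d' [d'p hd']] := cg (e / 2) ltac:(lra).
exists (Rmin d d'); split; first exact: Rmin_glb_lt.
move=> q hq; have [m1 m2] := (Rmin_l d d', Rmin_r d d').
have := hd q ltac:(lra); have := hd' q ltac:(lra).
have -> : f q + g q - (f p + g p) = (f q - f p) + (g q - g p) by lra.
by have := Rabs_triang (f q - f p) (g q - g p); lra.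
Qed.

Lemma cpt_opp f p : cpt f p -> cpt (fun q => - f q) p.
Proof.
move=> cf e e0; have [d [dp hd]] := cf e e0; exists d; split=> // q /hd.
have -> : - f q - - f p = - (f q - f p) by lra.
by rewrite Rabs_Ropp.
Qed.

Lemma cpt_minus f g p : cpt f p -> cpt g p -> cpt (fun q => f q - g q) p.
Proof. by move=> cf cg; apply: cpt_plus => //; apply: cpt_opp. Qed.

Lemma cpt_mult f g p : cpt f p -> cpt g p -> cpt (fun q => f q * g q) p.
Proof.
move=> cf cg e e0.
have fp := Rabs_pos (f p); have gp := Rabs_pos (g p).
pose M := Rabs (f p) + Rabs (g p) + 1.
have Mp : 0 < M by rewrite /M; lra.
pose r := Rmin 1 (e / (2 * M)).
have rp : 0 < r by apply: Rmin_glb_lt; [lra|apply: Rdiv_lt_0_compat; lra].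
have r1 : r <= 1 by apply: Rmin_l.
have rM : r * M <= e / 2.
  apply: Rle_trans (Rmult_le_compat_r M _ _ ltac:(lra) (Rmin_r _ _)) _.
  by apply: Req_le; field; lra.
have [d [dp hd]] := cf r rp; have [d' [d'p hd']] := cg r rp.
exists (Rmin d d'); split; first exact: Rmin_glb_lt.
move=> q hq; have [m1 m2] := (Rmin_l d d', Rmin_r d d').
have h1 := hd q ltac:(lra); have h2 := hd' q ltac:(lra).
have -> : f q * g q - f p * g p =
  (f q - f p) * (g q - g p) + (f p * (g q - g p) + g p * (f q - f p)) by lra.
apply: Rle_lt_trans (Rabs_triang _ _) _.
have := Rabs_triang (f p * (g q - g p)) (g p * (f q - f p)); rewrite !Rabs_mult.
have := Rabs_pos (f q - f p); have := Rabs_pos (g q - g p).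
move: (Rabs (f q - f p)) (Rabs (g q - g p)) h1 h2 => u v h1 h2 v0 u0.
have a1 : u * v <= r * 1 by apply: Rmult_le_compat; lra.
have a2 : Rabs (f p) * v <= Rabs (f p) * r by apply: Rmult_le_compat_l; lra.
have a3 : Rabs (g p) * u <= Rabs (g p) * r by apply: Rmult_le_compat_l; lra.
rewrite /M in rM; lra.
Qed.

Lemma cpt_inv f p : f p <> 0 -> cpt f p -> cpt (fun q => / f q) p.
Proof.
move=> fn cf e e0.
have fp := Rabs_pos_lt _ fn.
have r0 : 0 < Rabs (f p) * Rabs (f p) * e / 2 by do 2 (apply: Rmult_lt_0_compat; try nra); lra.
pose r := Rmin (Rabs (f p) / 2) (Rabs (f p) * Rabs (f p) * e / 2).
have rp : 0 < r by apply: Rmin_glb_lt => //; lra.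
have [d [dp hd]] := cf r rp; exists d; split=> // q /hd h.
have [m1 m2] := (Rmin_l (Rabs (f p) / 2) (Rabs (f p) * Rabs (f p) * e / 2), Rmin_r (Rabs (f p) / 2) (Rabs (f p) * Rabs (f p) * e / 2)).
rewrite -/r in m1 m2.
have fq : Rabs (f p) / 2 < Rabs (f q).
  by have := Rabs_triang_inv (f p) (f q); rewrite Rabs_minus_sym; lra.
have fqn : f q <> 0 by move=> h0; rewrite h0 Rabs_R0 in fq; lra.
have -> : / f q - / f p = - (f q - f p) * / (f q * f p) by field.
rewrite Rabs_mult Rabs_Ropp Rabs_inv Rabs_mult.
have pp : 0 < Rabs (f q) * Rabs (f p) by nra.
apply: (Rmult_lt_reg_r (Rabs (f q) * Rabs (f p))) => //.
rewrite Rmult_assoc Rinv_l ?Rmult_1_r; last lra.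
apply: Rlt_le_trans h _; apply: Rle_trans m2 _.
have : Rabs (f p) / 2 * Rabs (f p) <= Rabs (f q) * Rabs (f p) by nra.
by move=> h'; nra.
Qed.

Lemma cpt_abs f p : cpt f p -> cpt (fun q => Rabs (f q)) p.
Proof.
move=> cf e e0; have [d [dp hd]] := cf e e0; exists d; split=> // q /hd.
by apply: Rle_lt_trans; exact: Rabs_triang_inv2.
Qed.

Lemma contAt_pair f g p : cpt f p -> cpt g p -> contAt (fun q => (f q, g q)) p.
Proof.
move=> cf cg e e0.
have [d [dp hd]] := cf (e / 2) ltac:(lra); have [d' [d'p hd']] := cg (e / 2) ltac:(lra).
exists (Rmin d d'); split; first exact: Rmin_glb_lt.
move=> q hq; have [m1 m2] := (Rmin_l d d', Rmin_r d d').
by have := hd q ltac:(lra); have := hd' q ltac:(lra); rewrite /dst /=; lra.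
Qed.

Lemma contAt_comp F G p : contAt G p -> contAt F (G p) -> contAt (fun q => F (G q)) p.
Proof.
move=> cG cF e e0; have [d [dp hd]] := cF e e0; have [d' [d'p hd']] := cG d dp.
by exists d'; split=> // q /hd' /hd.
Qed.

Definition lens (p : pt) : Prop :=
  Rabs p.1 < 1 /\ Rabs p.2 < (1 - p.1 * p.1) / 2.

(** In coordinates with [a], [b] at -1 and 1, the inversion in the unit circle fixes both ends and
    carries the open segment without its midpoint to the outer rays of the line. The wedge
    conditions become [|x1| <= 1 + C |y1|]; dividing [x1] by [D] and compressing [y1] then squeezes
    this region into the lens. *)
Lemma segment_lens (K : pt -> Prop) a b : a <> b -> compactset K ->
  wedge K a b -> wedge K b a -> (forall x, K x -> seg a b x -> x = a \/ x = b) ->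
  exists Psi, (forall p, K p -> contAt Psi p) /\
    (forall p q, K p -> K q -> Psi p = Psi q -> p = q) /\
    Psi a = (-1, 0) /\ Psi b = (1, 0) /\
    (forall p, K p -> p <> a -> p <> b -> lens (Psi p)).
Proof.
move=> ab cK wa wb hfree.
have Lp := dt_gt0 a b ab.
(* [free_strip] allows [K] to touch one end only, so it is applied to the two halves of the segment,
   each starting at its own end. *)
have half u v : u <> v -> wedge K u v -> (forall x, K x -> seg u v x -> x = u \/ x = v) ->
   exists C, 0 <= C /\ forall k, K k -> 0 <= fX u v k <= 1/2 -> fX u v k <= C * Rabs (fY u v k).
  move=> uv [rho [C [rp hC]]] fuv.
  pose m := segp u v (1/2).
  have e1 k : dt u m k = dt u v k / 2 by rewrite /m /dt /segp /=; field.
  have e2 k : cr u m k = cr u v k / 2 by rewrite /m /cr /segp /=; field.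
  have e3 : dt u m m = dt u v v / 4 by rewrite /m /dt /segp /=; field.
  have Lp' := dt_gt0 u v uv.
  have um : u <> m.
    move=> h; have : dt u m m = 0 by rewrite -h /dt; ring.
    by rewrite e3; lra.
  have X2 k : fX u m k = 2 * fX u v k by rewrite /fX e1 e3; field; lra.
  have Y2 k : fY u m k = 2 * fY u v k by rewrite /fY e2 e3; field; lra.
  have [||eps [C' [ep [C'p hC']]]] := free_strip u m um K cK.
  - exists rho, C; split=> // k Kk hk; have := hC k Kk hk; rewrite e1 e2 Rabs_mult (Rabs_right (/2)); lra.
  - move=> x Kx [t [[t0 t1] hx]].
    have hx' : x = segp u v (t/2) by rewrite hx /m /segp /=; congr pair; field.
    have hs : seg u v x by exists (t/2); split=> //; split; lra.
    case: (fuv x Kx hs) => // xv; exfalso.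
    have : fX u v x = 1 by rewrite xv /fX; field; lra.
    have : fX u v x = t/2.
      rewrite hx' /fX; have -> : dt u v (segp u v (t/2)) = t / 2 * dt u v v by rewrite /dt /segp /=; ring.
      by field; lra.
    lra.
  exists C'; split=> // k Kk hk; have := hC' k Kk; rewrite X2 Y2 Rabs_mult (Rabs_right 2); last lra.
  by move=> h; have := h ltac:(lra); lra.
have [C1 [C1p h1]] := half a b ab wa hfree.
have hfree' x : K x -> seg b a x -> x = b \/ x = a.
  move=> Kx [t [[t0 t1] hx]].
  have hs : seg a b x by exists (1 - t); split; [split; lra|rewrite hx /segp /=; congr pair; ring].
  by case: (hfree x Kx hs); [right|left].
have [C2 [C2p h2]] := half b a (fun h => ab (esym h)) wb hfree'.
pose x k := 2 * fX a b k - 1; pose y k := 2 * fY a b k.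
have Xs k : fX b a k = 1 - fX a b k.
  rewrite /fX; have -> : dt b a a = dt a b b by rewrite /dt; ring.
  have -> : dt b a k = dt a b b - dt a b k by rewrite /dt; ring.
  by field; lra.
have Ys k : Rabs (fY b a k) = Rabs (fY a b k).
  rewrite /fY; have -> : dt b a a = dt a b b by rewrite /dt; ring.
  have -> : cr b a k = - cr a b k by rewrite /cr; ring.
  by rewrite /Rdiv Ropp_mult_distr_l_reverse Rabs_Ropp.
pose C := C1 + C2 + 1.
have hC k : K k -> Rabs (x k) <= 1 -> 1 - Rabs (x k) <= C * Rabs (y k).
  move=> Kk hx; have [l1 l2] : - 1 <= x k <= 1.
    by have := Rle_abs (x k); have := Rle_abs (- x k); rewrite Rabs_Ropp; lra.
  have yp := Rabs_pos (fY a b k).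
  have -> : Rabs (y k) = 2 * Rabs (fY a b k) by rewrite /y Rabs_mult (Rabs_right 2); lra.
  have p1 := Rmult_le_pos _ _ C1p yp; have p2 := Rmult_le_pos _ _ C2p yp.
  case: (Rle_dec (x k) 0) => x0.
    rewrite (Rabs_left1 (x k)) //; have := h1 k Kk ltac:(rewrite /x in l1 x0; lra).
    by rewrite /x /C; lra.
  rewrite (Rabs_right (x k)); last lra.
  have := h2 k Kk; rewrite Xs Ys => h; have := h ltac:(rewrite /x in l2 x0; lra).
  by rewrite /x /C; lra.
have Cp : 1 <= C by rewrite /C; lra.
pose N k := x k * x k + y k * y k.
have Np k : K k -> 0 < N k.
  move=> Kk; case: (Req_dec (y k) 0) => hy.
    have : 1 <= Rabs (x k).
      apply: Rnot_lt_le => hx; have := hC k Kk ltac:(lra); rewrite hy Rabs_R0; lra.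
    move=> hx; have : x k <> 0 by move=> h; rewrite h Rabs_R0 in hx; lra.
    by move/Rsqr_pos_lt; rewrite /N /Rsqr hy; lra.
  by have := Rsqr_pos_lt _ hy; have := Rle_0_sqr (x k); rewrite /N /Rsqr; lra.
pose x1 k := x k * / N k; pose y1 k := y k * / N k.
(* The factor 2 makes [|x1| < D] strict whenever [y1] is nonzero; only [a] and [b] then reach
   [|x2| = 1]. *)
pose D k := 1 + 2 * C * Rabs (y1 k).
have Dp k : 1 <= D k by have := Rabs_pos (y1 k); rewrite /D; nra.
have hx1 k : K k -> Rabs (x1 k) <= 1 + C * Rabs (y1 k).
  move=> Kk; have n := Np k Kk; have i := Rinv_0_lt_compat _ n.
  rewrite /x1 /y1 (Rabs_mult (x k)) (Rabs_mult (y k)) (Rabs_right (/ N k)); last lra.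
  have ii : N k * / N k = 1 by apply: Rinv_r; lra.
  have xp := Rabs_pos (x k); have yp := Rabs_pos (y k).
  suff : Rabs (x k) <= N k + C * Rabs (y k).
    move: (N k) i ii => Nk i ii h.
    by have := Rmult_le_compat_r _ _ _ (Rlt_le _ _ i) h; rewrite Rmult_plus_distr_r ii; lra.
  have sx : x k * x k = Rabs (x k) * Rabs (x k) by rewrite -Rabs_mult Rabs_right //; nra.
  have cy : 0 <= C * Rabs (y k) by nra.
  have yy : 0 <= y k * y k by nra.
  rewrite /N sx.
  case: (Rle_dec (Rabs (x k)) 1) => h; last by nra.
  by have := hC k Kk h; nra.
pose x2 k := x1 k * / D k.
(* An injective compression of [y1] into the interval from -1/4 to 1/4, well inside the half-height
   of the lens. *)
pose th k := y1 k * / (4 * (1 + Rabs (y1 k))).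
pose Psi k : pt := (x2 k, th k * (1 - x2 k * x2 k)).
have inv k : K k -> x k = x1 k * / (x1 k * x1 k + y1 k * y1 k) /\
                   y k = y1 k * / (x1 k * x1 k + y1 k * y1 k).
  move=> Kk; have n := Np k Kk.
  have -> : x1 k * x1 k + y1 k * y1 k = / N k.
    rewrite /x1 /y1; have e : N k = x k * x k + y k * y k by [].
    apply: (Rmult_eq_reg_r (N k)); last lra.
    rewrite Rinv_l; last lra.
    have -> : (x k * / N k * (x k * / N k) + y k * / N k * (y k * / N k)) * N k
            = (x k * x k + y k * y k) * / N k * (/ N k * N k) by ring.
    by rewrite -e Rinv_l ?Rinv_r; lra.
  by rewrite Rinv_inv /x1 /y1; split; field; lra.
have coord k k' : x k = x k' -> y k = y k' -> k = k'.
  rewrite /x /y => hx hy.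
  have eX : fX a b k = fX a b k' by lra.
  have eY : fY a b k = fY a b k' by lra.
  apply: dst_eq0; apply: Rle_antisym; last exact: dst_ge0.
  have k1 : k' = segp a b (fX a b k') \/ True by right.
  have e1 : (k.1 - k'.1) * dt a b b = 0.
    have -> : (k.1 - k'.1) * dt a b b = dt a b b * ((fX a b k - fX a b k') * (b.1 - a.1) + (fY a b k - fY a b k') * (b.2 - a.2)).
      by move: Lp; rewrite /fX /fY /dt /cr => h; field; lra.
    by rewrite eX eY; ring.
  have e2 : (k.2 - k'.2) * dt a b b = 0.
    have -> : (k.2 - k'.2) * dt a b b = dt a b b * ((fX a b k - fX a b k') * (b.2 - a.2) - (fY a b k - fY a b k') * (b.1 - a.1)).
      by move: Lp; rewrite /fX /fY /dt /cr => h; field; lra.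
    by rewrite eX eY; ring.
  case: (Rmult_integral _ _ e1) => d1; last lra.
  case: (Rmult_integral _ _ e2) => d2; last lra.
  by rewrite /dst d1 d2 Rabs_R0; lra.
have xa : x a = -1.
  by rewrite /x /fX; have -> : dt a b a = 0 by [rewrite /dt; ring]; field; lra.
have ya : y a = 0.
  by rewrite /y /fY; have -> : cr a b a = 0 by [rewrite /cr; ring]; field; lra.
have xb : x b = 1 by rewrite /x /fX; field; lra.
have yb : y b = 0.
  by rewrite /y /fY; have -> : cr a b b = 0 by [rewrite /cr; ring]; field; lra.
have x2lt k : K k -> k <> a -> k <> b -> Rabs (x2 k) < 1.
  move=> Kk ka kb; have n := Np k Kk; have i := Rinv_0_lt_compat _ n.
  have D1 := Dp k; have iD := Rinv_0_lt_compat (D k) ltac:(lra).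
  rewrite /x2 Rabs_mult (Rabs_right (/ D k)); last lra.
  apply: (Rmult_lt_reg_r (D k)); first lra.
  rewrite Rmult_assoc Rinv_l ?Rmult_1_r ?Rmult_1_l; last lra.
  case: (Req_dec (y1 k) 0) => hy1; last first.
    have := Rabs_pos_lt _ hy1; have := hx1 k Kk; rewrite /D; nra.
  have hy : y k = 0.
    rewrite /y1 in hy1; case: (Rmult_integral _ _ hy1) => //; lra.
  rewrite /D hy1 Rabs_R0.
  have hx : 1 < Rabs (x k).
    have : 1 <= Rabs (x k).
      apply: Rnot_lt_le => hx; have := hC k Kk ltac:(lra); rewrite hy Rabs_R0; lra.
    case=> // h1x; exfalso.
    case: (Rle_dec 0 (x k)) => x0.
      by apply: kb; apply: coord; rewrite ?xb ?yb //; rewrite Rabs_right in h1x; lra.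
    by apply: ka; apply: coord; rewrite ?xa ?ya //; rewrite Rabs_left in h1x; lra.
  have eN : N k = Rabs (x k) * Rabs (x k).
    by rewrite /N hy -Rabs_mult Rabs_right; nra.
  rewrite /x1 Rabs_mult (Rabs_right (/ N k)); last lra.
  apply: (Rmult_lt_reg_r (N k)) => //.
  rewrite Rmult_assoc Rinv_l ?Rmult_1_r; last lra.
  by rewrite eN; nra.
have thlt k : Rabs (th k) < 1/4.
  have yp := Rabs_pos (y1 k).
  rewrite /th Rabs_mult (Rabs_right (/ _)); last by apply/Rle_ge/Rlt_le/Rinv_0_lt_compat; lra.
  apply: (Rmult_lt_reg_r (4 * (1 + Rabs (y1 k)))); first lra.
  by rewrite Rmult_assoc Rinv_l; lra.
have Psia : Psi a = (-1, 0).
  have n : N a = 1 by rewrite /N xa ya; lra.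
  have e1 : x1 a = -1 by rewrite /x1 n xa; field.
  have e2 : y1 a = 0 by rewrite /y1 ya; lra.
  by rewrite /Psi /x2 /th /D e1 e2 Rabs_R0; congr pair; field.
have Psib : Psi b = (1, 0).
  have n : N b = 1 by rewrite /N xb yb; lra.
  have e1 : x1 b = 1 by rewrite /x1 n xb; field.
  have e2 : y1 b = 0 by rewrite /y1 yb; lra.
  by rewrite /Psi /x2 /th /D e1 e2 Rabs_R0; congr pair; field.
have hlens p : K p -> p <> a -> p <> b -> lens (Psi p).
  move=> Kp pa pb; have h := x2lt p Kp pa pb; split=> //=.
  have q : 0 < 1 - x2 p * x2 p.
    have -> : x2 p * x2 p = Rabs (x2 p) * Rabs (x2 p) by rewrite -Rabs_mult Rabs_right //; nra.
    by have := Rabs_pos (x2 p); nra.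
  rewrite Rabs_mult (Rabs_right (1 - _)); last lra.
  by have := thlt p; nra.
exists Psi; split.
  move=> p Kp; have n := Np p Kp; have Dp' := Dp p.
  have cX : cpt x p.
    rewrite /x /fX /dt; apply: cpt_minus; last exact: cpt_cst.
    apply: cpt_mult; first exact: cpt_cst.
    apply: cpt_mult; last exact: cpt_cst.
    by apply: cpt_plus; apply: cpt_mult; (try exact: cpt_cst); apply: cpt_minus; (try exact: cpt_cst); [exact: cpt_fst|exact: cpt_snd].
  have cY : cpt y p.
    rewrite /y /fY /cr; apply: cpt_mult; first exact: cpt_cst.
    apply: cpt_mult; last exact: cpt_cst.
    by apply: cpt_minus; apply: cpt_mult; (try exact: cpt_cst); apply: cpt_minus; (try exact: cpt_cst); [exact: cpt_fst|exact: cpt_snd].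
  have cN : cpt N p by apply: cpt_plus; apply: cpt_mult.
  have cNi : cpt (fun q => / N q) p by apply: cpt_inv => //; lra.
  have cx1 : cpt x1 p by apply: cpt_mult.
  have cy1 : cpt y1 p by apply: cpt_mult.
  have cD : cpt D p.
    apply: cpt_plus; first exact: cpt_cst.
    by apply: cpt_mult; [exact: cpt_cst|exact: cpt_abs].
  have cx2 : cpt x2 p by apply: cpt_mult => //; apply: cpt_inv => //; lra.
  have cth : cpt th p.
    apply: cpt_mult => //; apply: cpt_inv; first by have := Rabs_pos (y1 p); lra.
    apply: cpt_mult; first exact: cpt_cst.
    by apply: cpt_plus; [exact: cpt_cst|exact: cpt_abs].
  apply: contAt_pair => //; apply: cpt_mult => //.
  by apply: cpt_minus; [exact: cpt_cst|exact: cpt_mult].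
split; last by [].
move=> p q Kp Kq h.
have nl u : Psi u = (-1, 0) \/ Psi u = (1, 0) -> ~ lens (Psi u).
  case=> -> [/=]; first by rewrite Rabs_Ropp Rabs_R1; lra.
  by rewrite Rabs_R1; lra.
have ends u : K u -> ~ lens (Psi u) -> u = a \/ u = b.
  move=> Ku hu; apply: NNPP => h'; apply: hu; apply: hlens => // e; apply: h'; [by left|by right].
have ne : Psi a <> Psi b by rewrite Psia Psib => -[]; lra.
case: (classic (lens (Psi p))) => hl; last first.
  have hl' := hl; rewrite h in hl'.
  case: (ends p Kp hl) h => ->; case: (ends q Kq hl') => -> // h.
  by case: ne; rewrite h.
have [hl1 _] := hl; rewrite /= in hl1.
case: h => e1 e2.
have q0 : 1 - x2 p * x2 p <> 0.
  have -> : x2 p * x2 p = Rabs (x2 p) * Rabs (x2 p) by rewrite -Rabs_mult Rabs_right //; nra.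
  by have := Rabs_pos (x2 p); nra.
rewrite -e1 in e2; have {e2}eth := Rmult_eq_reg_r _ _ _ e2 q0.
have ey : y1 p = y1 q.
  have sg u : Rabs (th u) = Rabs (y1 u) * / (4 * (1 + Rabs (y1 u))).
    have yp := Rabs_pos (y1 u).
    by rewrite /th Rabs_mult (Rabs_right (/ _)) //; apply/Rle_ge/Rlt_le/Rinv_0_lt_compat; lra.
  have yp := Rabs_pos (y1 p); have yq := Rabs_pos (y1 q).
  have ea : Rabs (y1 p) = Rabs (y1 q).
    have : Rabs (th p) = Rabs (th q) by rewrite eth.
    rewrite !sg => hh.
    have : Rabs (y1 p) * (4 * (1 + Rabs (y1 q))) = Rabs (y1 q) * (4 * (1 + Rabs (y1 p))).
      have -> : Rabs (y1 p) * (4 * (1 + Rabs (y1 q))) = Rabs (y1 p) * / (4 * (1 + Rabs (y1 p))) * (4 * (1 + Rabs (y1 p))) * (4 * (1 + Rabs (y1 q))) by field; lra.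
      by rewrite hh; field; lra.
    lra.
  move: eth; rewrite /th ea => eth.
  apply: (Rmult_eq_reg_r (/ (4 * (1 + Rabs (y1 q))))) => //.
  by apply/not_eq_sym/Rlt_not_eq/Rinv_0_lt_compat; lra.
have ex : x1 p = x1 q.
  move: e1; rewrite /x2 /D ey => e1.
  apply: (Rmult_eq_reg_r (/ (1 + 2 * C * Rabs (y1 q)))) => //.
  apply/not_eq_sym/Rlt_not_eq/Rinv_0_lt_compat.
  by have := Dp q; rewrite /D; lra.
have [ip1 ip2] := inv p Kp; have [iq1 iq2] := inv q Kq.
by apply: coord; rewrite ?ip1 ?iq1 ?ip2 ?iq2 ex ey.
Qed.

End LensMap.

(** * Inscribed polygons and their removal *)

Section Polygon.
Local Open Scope R_scope.
Notation pt := (R * R)%type.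

Fixpoint onpath (p : pt) (l : seq pt) (x : pt) : Prop :=
  match l with [::] => x = p | q :: l' => seg p q x \/ onpath q l' x end.

(** Consecutive edges share [b], so disjointness is required only from [c] onwards and [nonfold]
    controls the corner. *)
Fixpoint simple (a b : pt) (l : seq pt) : Prop :=
  a <> b /\ match l with
  | [::] => True
  | c :: l' => nonfold a b c /\ (forall x, seg a b x -> onpath c l' x -> False) /\ simple b c l'
  end.

Fixpoint prev (a b : pt) (l : seq pt) : pt :=
  match l with [::] => a | c :: l' => prev b c l' end.

Lemma onpath_compact p l : compactset (onpath p l).
Proof.
elim: l p => [|q l IH] p /=; last by apply: compactU; [exact: seg_compact|exact: IH].
exists unit, (fun _ _ => p); split=> [_|x]; first exact: cont01_cst.
by split=> [->|[_ [t [_ ->]]]] //; exists tt, 0; split=> //; exact: in01_0.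
Qed.

Lemma onpath_last p l : onpath p l (last p l).
Proof. by elim: l p => //= q l IH p; right; apply: IH. Qed.

(** Induction on the number of edges: [slide] pushes the start onto the second vertex, and the
    single remaining edge is treated by [segment_lens]. Points of [K] that meet the rest of the
    polygon are not moved. *)
Lemma polygon_lens l K a b : compactset K -> simple a b l ->
  (forall x, K x -> onpath a (b :: l) x -> x = a \/ x = last b l) ->
  wedge K a b -> wedge K (last b l) (prev a b l) ->
  exists Psi, (forall p, K p -> contAt Psi p) /\
    (forall p q, K p -> K q -> Psi p = Psi q -> p = q) /\
    Psi a = (-1, 0) /\ Psi (last b l) = (1, 0) /\
    (forall p, K p -> p <> a -> p <> last b l -> lens (Psi p)).
Proof.
elim: l K a b => [|c l IH] K a b cK.
  move=> [ab _] /= hf wa wb; apply: segment_lens => // x Kx hx; apply: hf => //; by left.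
move=> [ab [nf [hd sbc]]] hf wa wz; rewrite /= in hf wz *.
have bc : b <> c by case: (l) sbc => [|? ?] [].
have bz : b <> last c l.
  move=> h; apply: (hd b); first by exists 1; rewrite segp1; split=> //; exact: in01_1.
  by rewrite h; apply: onpath_last.
have [|phi [cphi [iphi [pa [[rho [rp hT]] [fT [hbc w']]]]]]] :=
    slide K (onpath c l) a b c ab bc cK (onpath_compact c l) ltac:(by move=> x Tx sx; apply: (hd x)) wa _ nf.
  move=> x Kx sx; case: (hf x Kx (or_introl sx)) => // hx; exfalso.
  by apply: (hd x) => //; rewrite hx; apply: onpath_last.
pose K' y := exists k, K k /\ y = phi k.
have Tz := onpath_last c l.
have fixT k x : onpath c l x -> phi k = x -> k = x.
  by move=> Tx h; rewrite -(hT x k Tx) h // dstxx.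
have [|||||Psi [cP [iP [Pb [Pz lP]]]]] := IH K' b c.
- exact: compact_image.
- exact: sbc.
- move=> x [k [Kk xk]] [sx|Tx].
    rewrite xk in sx; case: (hbc k Kk sx) => h; first by left; rewrite xk.
    rewrite h in sx; case: (hf k Kk (or_intror (or_introl sx))) => hk.
      by exfalso; apply: ab; rewrite -pa -hk h.
    by right; rewrite xk h.
  have kx := fixT k x Tx (esym xk); subst k.
  case: (hf x Kk (or_intror (or_intror Tx))) => hk; last by right.
  by left; rewrite xk hk pa.
- exact: w'.
(* Near the last vertex [phi] is the identity, so the wedge there survives with a smaller radius. *)
- have [r [C [r0 hC]]] := wz.
  exists (Rmin r rho), C; split; first exact: Rmin_glb_lt.
  move=> y [k [Kk ->]] hd'; have [m1 m2] := (Rmin_l r rho, Rmin_r r rho).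
  have -> : phi k = k by apply: (hT (last c l)) => //; lra.
  apply: hC => //; have e : phi k = k by apply: (hT (last c l)) => //; lra.
  by rewrite -e; lra.
exists (fun p => Psi (phi p)); split.
  move=> p Kp; apply: contAt_comp; first by move=> e; apply: cphi.
  by apply: cP; exists p.
split=> [p q Kp Kq h|].
  by apply: iphi; apply: iP => //; [exists p|exists q].
split; first by rewrite pa.
split; first by rewrite fT.
move=> p Kp pa' pz; apply: lP; first by exists p.
  by move=> h; apply: pa'; apply: iphi; rewrite h pa.
by move=> h; apply: pz; apply: fixT.
Qed.

(* Greedy polygon inscribed in an arc: each vertex is the last visit to the eta-ball of
   the previous one, so distinct non-adjacent vertices are more than eta apart. *)
Fixpoint greedy (A : R -> pt) (eta s : R) (l : seq R) : Prop :=
  match l with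
  | [::] => s = 1
  | s' :: l' => s < s' /\ s' <= 1 /\ dst (A s') (A s) <= eta /\
      (forall t, in01 t -> s' < t -> eta < dst (A t) (A s)) /\ greedy A eta s' l'
  end.

(** Uniform continuity gives a [d] by which every step that stops before time 1 must advance, so
    finitely many steps suffice. *)
Lemma greedy_ex A eta : cont01 A -> 0 < eta -> exists l, greedy A eta 0 l.
Proof.
move=> cA ep.
have [d [dp hd]] := curve_unif A cA eta ep.
have key n : forall s, in01 s -> 1 - s <= INR n * d -> exists l, greedy A eta s l.
  elim: n => [|n IH] s s01 hs.
    by exists [::] => /=; case: s01 => *; rewrite /= in hs; lra.
  case: (Req_dec s 1) => s1; first by exists [::].
  have [|t [t01 [st [ht1 [ht2 ht3]]]]] := last_time A (A s) eta s cA s01.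
    by rewrite dstxx; lra.
  have t1 : t <= 1 by case: t01.
  have stl : s + d <= t \/ t = 1.
    case: (Req_dec t 1) => h; [by right|left].
    apply: Rnot_lt_le => hlt; have := ht3 ltac:(lra).
    by have := hd t s t01 s01 ltac:(apply: Rabs_def1; lra); lra.
  have [|l hl] := IH t t01.
    rewrite S_INR in hs; have := pos_INR n; case: stl => h; nra.
  exists (t :: l) => /=; split; last by [].
  case: stl => h; first lra.
  by case: s01; lra.
have [n hn] := INR_archimed d 1 dp.
by apply: (key n); [exact: in01_0|lra].
Qed.

Lemma dst_segp p q s t : dst (segp p q s) (segp p q t) = Rabs (s - t) * dst p q.
Proof.
rewrite /dst /segp /= Rmult_plus_distr_l -!Rabs_mult.
by congr (_ + _); rewrite -Rabs_Ropp; congr Rabs; ring.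
Qed.

Lemma seg_split p q x : seg p q x -> dst p x + dst x q = dst p q.
Proof.
move=> [s [[s0 s1] ->]].
have h1 := dst_segp p q 0 s; have h2 := dst_segp p q s 1.
rewrite segp0 in h1; rewrite segp1 in h2; rewrite h1 h2.
by rewrite (Rabs_left1 (0 - s)) ?(Rabs_left1 (s - 1)); lra.
Qed.

(** Two opposite sides of a quadrilateral are together at most as long as its diagonals, here the
    crossing segments. *)
Lemma segs_cross a b c d x : seg a b x -> seg c d x ->
  dst a c + dst b d <= dst a b + dst c d.
Proof.
move=> /seg_split h1 /seg_split h2.
have := dst_tri a x c; have := dst_tri b x d.
have := dst_sym b x; have := dst_sym x c; lra.
Qed.

(** If [c] folded back it would lie on the line, either on the segment, making [a c] at most as long
    as [a b], or behind [a], making [b c] longer than [a c]. *)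
Lemma nonfold_of_dst a b c :
  a <> b -> dst a b < dst a c -> dst b c <= dst a c -> nonfold a b c.
Proof.
move=> ab h h'; apply: NNPP => hn.
have [h1 h2] : cr a b c = 0 /\ dt a b c <= dt a b b.
  by split; [apply: NNPP => h3; apply: hn; left|apply: Rnot_lt_le => h3; apply: hn; right].
have Lp := dt_gt0 a b ab.
pose m := dt a b c / dt a b b.
have m1 : m <= 1.
  apply: (Rmult_le_reg_r (dt a b b)) => //; rewrite /m Rmult_1_l.
  by have -> : dt a b c / dt a b b * dt a b b = dt a b c by field; lra.
have hc : c = segp a b m.
  apply: dst_eq0; apply: Rle_antisym; last exact: dst_ge0.
  have := frame_dst a b ab c m; rewrite /fX /fY h1 -/m.
  by rewrite Rminus_diag /Rdiv Rmult_0_l Rabs_R0; lra.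
have e1 := dst_segp a b 0 m; have e2 := dst_segp a b 1 m.
rewrite segp0 -hc in e1; rewrite segp1 -hc in e2.
rewrite e1 in h h'; rewrite e2 in h'.
have dp := dst_gt0 a b ab.
rewrite (Rabs_right (1 - m)) in h'; last lra.
case: (Rle_dec m 0) => m0.
  by rewrite (Rabs_right (0 - m)) in h h'; nra.
by rewrite (Rabs_left (0 - m)) in h h'; nra.
Qed.

(* Two segments of the greedy polygon that are not adjacent do not meet (segs_cross). *)
Lemma greedy_simple A eta s s' l : cont01 A -> inj01 A -> in01 s -> greedy A eta s (s' :: l) ->
  simple (A s) (A s') [seq A t | t <- l].
Proof.
move=> cA iA; elim: l s s' => [|s2 l IH] s s' s01 [ss' [s'1 [h1 [h2 h3]]]].
  split=> //; have s'01 : in01 s' by (split; case: s01; lra).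
  move=> h; have := iA _ _ s01 s'01 h; lra.
have s'01 : in01 s' by split; case: s01; lra.
have ne : A s <> A s' by move=> h; have := iA _ _ s01 s'01 h; lra.
have [s's2 [s21 [g1 [g2 g3]]]] := h3.
have s201 : in01 s2 by split; case: s'01; lra.
have far := h2 s2 s201 s's2.
split=> //; split.
  apply: nonfold_of_dst => //; rewrite ?(dst_sym (A s)) ?(dst_sym (A s') (A s2)); lra.
split; last exact: IH.
move=> x hx.
have key : forall u m, in01 u -> s2 <= u -> greedy A eta u m -> onpath (A u) [seq A t | t <- m] x -> False.
  move=> u m; elim: m u => [|v m IHm] u u01 hu /=.
    move=> _ xu; rewrite xu in hx; have := seg_split _ _ _ hx.
    have := h2 u u01 ltac:(lra); rewrite (dst_sym (A u)) (dst_sym (A s) (A s')).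
    by have := dst_ge0 (A u) (A s'); lra.
  move=> [uv [v1 [k1 [k2 k3]]]]; have v01 : in01 v by split; case: u01; lra.
  case; last by apply: IHm => //; lra.
  move=> hx'; have := segs_cross _ _ _ _ _ hx hx'.
  have := h2 u u01 ltac:(lra); have := g2 v v01 ltac:(lra).
  rewrite (dst_sym (A u)) (dst_sym (A v) (A s')) (dst_sym (A s) (A s')) (dst_sym (A v)) in k1 *; lra.
by apply: key g3; [|lra].
Qed.

Lemma greedy_last A eta s l : greedy A eta s l -> last (A s) [seq A t | t <- l] = A 1.
Proof. by elim: l s => [s /= ->|s' l IH s] //= [_ [_ [_ [_ /IH]]]]. Qed.

End Polygon.

(** * From a free arc to a free polygon *)

Section Route.
Local Open Scope R_scope.
Notation pt := (R * R)%type.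

Lemma wedge_scale K a D s : 0 < s -> wedge K a (ray a D 1) -> wedge K a (ray a D s).
Proof.
move=> s0 [rho [C [rp h]]]; exists rho, C; split=> // k Kk /(h k Kk).
have -> : dt a (ray a D s) k = s * dt a (ray a D 1) k by rewrite /dt /ray /=; ring.
have -> : cr a (ray a D s) k = s * cr a (ray a D 1) k by rewrite /cr /ray /=; ring.
by rewrite Rabs_mult (Rabs_right s); nra.
Qed.

Lemma wedge_ray K a D : wedge K a (ray a D 1) -> exists rho, 0 < rho /\
  forall s, 0 <= s -> K (ray a D s) -> dst (ray a D s) a < rho -> ray a D s = a.
Proof.
move=> [rho [C [rp h]]]; exists rho; split=> // s s0 Ks hs.
have := h _ Ks hs.
have -> : dt a (ray a D 1) (ray a D s) = s * (D.1 * D.1 + D.2 * D.2) by rewrite /dt /ray /=; ring.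
have -> : cr a (ray a D 1) (ray a D s) = 0 by rewrite /cr /ray /=; ring.
rewrite Rabs_R0 Rmult_0_r => hle.
case: (Req_dec s 0) => s0'; first by rewrite s0' /ray !Rmult_0_l !Rplus_0_r -surjective_pairing.
have q1 := Rle_0_sqr D.1; have q2 := Rle_0_sqr D.2; rewrite /Rsqr in q1 q2.
have z : D.1 * D.1 + D.2 * D.2 <= 0.
  by apply: (Rmult_le_reg_l s); lra.
have d1 : D.1 = 0 by apply: Rsqr_0_uniq; rewrite /Rsqr; lra.
have d2 : D.2 = 0 by apply: Rsqr_0_uniq; rewrite /Rsqr; lra.
by rewrite /ray d1 d2 !Rmult_0_r !Rplus_0_r -surjective_pairing.
Qed.

Lemma seg_ray a D u v x : 0 <= u -> 0 <= v -> seg (ray a D u) (ray a D v) x ->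
  exists s, 0 <= s /\ x = ray a D s.
Proof.
move=> u0 v0 [t [[t0 t1] ->]]; exists (u + t * (v - u)); split; first nra.
by rewrite /segp /ray /=; congr pair; ring.
Qed.

Lemma greedy_prev A eta s s' l : in01 s -> greedy A eta s (s' :: l) -> exists u, in01 u /\ u < 1 /\
  prev (A s) (A s') [seq A t | t <- l] = A u /\ dst (A 1) (A u) <= eta.
Proof.
elim: l s s' => [|s2 l IH] s s' s01 [h1 [h2 [h3 [h4 h5]]]].
  by exists s; split=> //; split; [lra|split=> //; rewrite -h5].
by apply: IH h5; split; case: s01; lra.
Qed.

Definition on_ray (A : R -> pt) (p D : pt) : Prop := exists rho, 0 < rho /\
  forall t, in01 t -> dst (A t) p < rho -> exists s, 0 <= s /\ A t = ray p D s.

(** A polygon inscribed in [A] with small mesh avoids [K] as [A] does: in the middle because the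
    mesh is below the distance to [K], near the ends because the polygon runs along the same ray as
    [A] and the wedge keeps [K] off that ray. *)
Lemma arc_lens K A Da Db : compactset K -> arc A ->
  (forall t, in01 t -> K (A t) -> t = 0 \/ t = 1) ->
  on_ray A (A 0) Da -> on_ray A (A 1) Db ->
  wedge K (A 0) (ray (A 0) Da 1) -> wedge K (A 1) (ray (A 1) Db 1) ->
  exists Psi, (forall p, K p -> contAt Psi p) /\
    (forall p q, K p -> K q -> Psi p = Psi q -> p = q) /\
    Psi (A 0) = (-1, 0) /\ Psi (A 1) = (1, 0) /\
    (forall p, K p -> p <> A 0 -> p <> A 1 -> lens (Psi p)).
Proof.
move=> cK [cA iA] hK [ra [rap ha]] [rb [rbp hb]] wa wb.
have [wra [wrap hwa]] := wedge_ray _ _ _ wa; have [wrb [wrbp hwb]] := wedge_ray _ _ _ wb.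
have nab : A 0 <> A 1 by move=> h; have := iA _ _ in01_0 in01_1 h; lra.
have dab := dst_gt0 _ _ nab.
have [rho [rp [r1 [r2 [r3 [r4 r5]]]]]] : exists rho, 0 < rho /\ rho <= ra /\ rho <= rb /\
    rho <= wra /\ rho <= wrb /\ rho <= dst (A 0) (A 1) / 2.
  exists (Rmin ra (Rmin rb (Rmin wra (Rmin wrb (dst (A 0) (A 1) / 2))))).
  have m1 := Rmin_l wrb (dst (A 0) (A 1) / 2); have m2 := Rmin_r wrb (dst (A 0) (A 1) / 2).
  have p1 : 0 < Rmin wrb (dst (A 0) (A 1) / 2) by apply: Rmin_glb_lt; lra.
  move: (Rmin wrb (dst (A 0) (A 1) / 2)) m1 m2 p1 => x1 m1 m2 p1.
  have m3 := Rmin_l wra x1; have m4 := Rmin_r wra x1; have p2 : 0 < Rmin wra x1 by apply: Rmin_glb_lt.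
  move: (Rmin wra x1) m3 m4 p2 => x2 m3 m4 p2.
  have m5 := Rmin_l rb x2; have m6 := Rmin_r rb x2; have p3 : 0 < Rmin rb x2 by apply: Rmin_glb_lt.
  move: (Rmin rb x2) m5 m6 p3 => x3 m5 m6 p3.
  have m7 := Rmin_l ra x3; have m8 := Rmin_r ra x3; have p4 : 0 < Rmin ra x3 by apply: Rmin_glb_lt.
  lra.
have [eta0 [e0p he0]] : exists eta, 0 < eta /\ forall t k, in01 t -> K k ->
    rho / 2 <= dst (A t) (A 0) -> rho / 2 <= dst (A t) (A 1) -> eta <= dst (A t) k.
  have [F [c [cc hF]]] := cK.
  have [eta [ep he]] : exists eta, 0 < eta /\ forall f : F, (fun f eta => forall t s,
     in01 t -> in01 s -> rho / 2 <= dst (A t) (A 0) -> rho / 2 <= dst (A t) (A 1) ->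
       eta <= dst (A t) (c f s)) f eta.
    apply: fin_pos; last by move=> f x y h hxy t s t01 s01 u v; have := h t s t01 s01 u v; lra.
    move=> f.
    (* The truncated terms vanish at distance [rho / 2] from both ends and keep [G] positive at the
       ends, where [A] may touch [K]; so a bound over all times gives one for the middle part. *)
    pose G t s := dst (A t) (c f s) + (Rmax 0 (rho / 2 - dst (A t) (A 0)) + Rmax 0 (rho / 2 - dst (A t) (A 1))).
    have [||eta [ep he]] := cont01_2_pos G.
    - move=> s t s01 t01 e ep.
      have [d [dp hd]] := cont01_2_dst A (c f) cA (cc f) s t s01 t01 (e/4) ltac:(lra).
      have [d' [d'p hd']] := cA s s01 (e/4) ltac:(lra).
      exists (Rmin d d'); split; first exact: Rmin_glb_lt.
      move=> s' t' s'01 t'01 hs ht; have [m1 m2] := (Rmin_l d d', Rmin_r d d').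
      have k1 := hd s' t' s'01 t'01 ltac:(lra) ltac:(lra); have k2 := hd' s' s'01 ltac:(lra).
      have k3 : forall p, Rabs (Rmax 0 (rho / 2 - dst (A s') p) - Rmax 0 (rho / 2 - dst (A s) p)) < e / 4.
        move=> p; apply: Rle_lt_trans (Rmax0_lip _ _) _.
        have -> : rho / 2 - dst (A s') p - (rho / 2 - dst (A s) p) = - (dst (A s') p - dst (A s) p) by lra.
        by rewrite Rabs_Ropp; have := dst_lip (A s) p (A s') p; rewrite dstxx; lra.
      have := k3 (A 0); have := k3 (A 1); move: k1; rewrite /G /=.
      move=> /Rabs_def2 [? ?] /Rabs_def2 [? ?] /Rabs_def2 [? ?]; apply: Rabs_def1; lra.
    - move=> s t s01 t01; rewrite /G.
      have m1 := Rmax_l 0 (rho / 2 - dst (A s) (A 0)); have m2 := Rmax_l 0 (rho / 2 - dst (A s) (A 1)).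
      have m1' := Rmax_r 0 (rho / 2 - dst (A s) (A 0)); have m2' := Rmax_r 0 (rho / 2 - dst (A s) (A 1)).
      have d0 := dst_ge0 (A s) (c f t).
      case: (classic (A s = c f t)) => h; last by have := dst_gt0 _ _ h; lra.
      have Kx : K (A s) by apply/hF; exists f, t.
      by case: (hK s s01 Kx) => h'; subst s; rewrite !dstxx in m1 m1' m2 m2' *; lra.
    exists eta; split=> // t s t01 s01 u v; have := he t s t01 s01.
    by rewrite /G !(Rmax_left 0); lra.
  exists eta; split=> // t k t01 /hF [f [s [s01 ->]]]; exact: he.
have [eta [ep [e1 e2]]] : exists eta, 0 < eta /\ eta < eta0 /\ eta <= rho / 4.
  exists (Rmin (eta0 / 2) (rho / 4)); have := Rmin_l (eta0 / 2) (rho / 4).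
  by split; [apply: Rmin_glb_lt; lra|split; [lra|exact: Rmin_r]].
have [l hl] := greedy_ex A eta cA ep.
case: l hl => [/=|s1 l hl]; first by lra.
have steps : forall l s, in01 s -> greedy A eta s l -> forall x, K x ->
    onpath (A s) [seq A t | t <- l] x -> x = A 0 \/ x = A 1.
  elim=> [|s' m IH] s s01 /=; first by move=> -> x _ ->; right.
  move=> [ss' [s'1 [h1 [h2 h3]]]] x Kx.
  have s'01 : in01 s' by split; case: s01; lra.
  case; last by apply: IH h3 x Kx.
  move=> hx; have xs := seg_split _ _ _ hx.
  have d1 := dst_ge0 (A s) x; have d2 := dst_ge0 x (A s').
  rewrite (dst_sym (A s) (A s')) in xs.
  have near p D r w : r <= rho -> rho <= w -> 
      (forall t, in01 t -> dst (A t) p < w -> exists s, 0 <= s /\ A t = ray p D s) ->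
      dst (A s) p < rho / 2 -> (exists u, 0 <= u /\ x = ray p D u) /\ dst x p < rho.
    move=> _ hw hr hs; have t1 := dst_tri (A s') (A s) p; have t2 := dst_tri x (A s) p.
    rewrite (dst_sym x (A s)) in t2; split; last lra.
    have [u [u0 hu]] := hr s s01 ltac:(lra); have [v [v0 hv]] := hr s' s'01 ltac:(lra).
    by rewrite hu hv in hx; exact: seg_ray hx.
  case: (Rlt_dec (dst (A s) (A 0)) (rho / 2)) => hs0.
    have [[u [u0 hu]] hd] := near (A 0) Da rho ra (Rle_refl _) r1 ha hs0.
    by left; rewrite hu in Kx hd *; apply: hwa => //; lra.
  case: (Rlt_dec (dst (A s) (A 1)) (rho / 2)) => hs1.
    have [[u [u0 hu]] hd] := near (A 1) Db rho rb (Rle_refl _) r2 hb hs1.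
    by right; rewrite hu in Kx hd *; apply: hwb => //; lra.
  by have := he0 s x s01 Kx ltac:(lra) ltac:(lra); lra.
have lastE := greedy_last A eta 0 (s1 :: l) hl; rewrite /= in lastE.
have [u [u01 [u1 [pu du]]]] := greedy_prev A eta 0 s1 l in01_0 hl.
have simp := greedy_simple A eta 0 s1 l cA iA in01_0 hl.
have [s1p [s11 [d1 _]]] := hl.
have s101 : in01 s1 by split; lra.
have [|||Psi [cP [iP [Pa [Pb lP]]]]] := polygon_lens [seq A t | t <- l] K (A 0) (A s1) cK simp.
- by move=> x Kx hx; rewrite lastE; apply: (steps (s1 :: l) 0 in01_0 hl x Kx).
- have [s [s0 hs]] := ha s1 s101 ltac:(lra).
  rewrite hs; apply: wedge_scale => //.
  case: s0 => // s0; have := iA _ _ s101 in01_0.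
  by rewrite hs -s0 /ray !Rmult_0_l !Rplus_0_r -surjective_pairing => /(_ erefl); lra.
- rewrite lastE pu; rewrite dst_sym in du.
  have [s [s0 hs]] := hb u u01 ltac:(lra).
  rewrite hs; apply: wedge_scale => //.
  case: s0 => // s0; have := iA _ _ u01 in01_1.
  by rewrite hs -s0 /ray !Rmult_0_l !Rplus_0_r -surjective_pairing => /(_ erefl); lra.
by rewrite lastE in Pb lP; exists Psi.
Qed.

End Route.

(** * Drawings of multigraphs *)

Section Drawing.
Local Open Scope R_scope.
Notation pt := (R * R)%type.
Variable V : finType.

(** Every edge occurs in both directions, with reversed parametrisations, so that exchanging [a] and
    [b] does not interfere with the order of the vertices; accordingly the last clause identifies an
    edge with its reversal. *)
Definition drawing (S : pred V) (m : V -> V -> nat) (pos : V -> pt)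
    (G : V -> V -> nat -> R -> pt) : Prop :=
  (forall u v, S u -> S v -> pos u = pos v -> u = v) /\
  (forall i j l, S i -> S j -> i <> j -> (l < m i j)%N ->
     arc (G i j l) /\ G i j l 0 = pos i /\ G i j l 1 = pos j /\
     forall t v, in01o t -> S v -> G i j l t <> pos v) /\
  (forall i j l t, i <> j -> G j i l t = G i j l (1 - t)) /\
  (forall i j l i' j' l' t t', S i -> S j -> i <> j -> (l < m i j)%N ->
     S i' -> S j' -> i' <> j' -> (l' < m i' j')%N -> in01o t -> in01o t' ->
     G i j l t = G i' j' l' t' -> l = l' /\ ((i = i' /\ j = j') \/ (i = j' /\ j = i'))).

Lemma in01_cases t : in01 t -> t = 0 \/ t = 1 \/ in01o t.
Proof.
move=> [t0 t1]; case: (Req_dec t 0) => h0; first by left.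
case: (Req_dec t 1) => h1; first by right; left.
by right; right; split; lra.
Qed.

(** * Redrawing one side of a separation inside a lens *)

Section Side.
Variables (m : V -> V -> nat) (pos : V -> pt) (G : V -> V -> nat -> R -> pt).
Hypothesis msym : forall i j, m i j = m j i.
Hypothesis dr : drawing predT m pos G.

Let pinj u v : pos u = pos v -> u = v. Proof. by case: dr => h _; apply: h. Qed.

(** Edges numbered 0 are concatenated, and uniqueness of the vertices gives injectivity. About the
    image it is recorded only which vertices bound the edges used; this is what later keeps the arc
    off the other side. *)
Lemma path_arc (e : rel V) x p : (forall u v, e u v -> (0 < m u v)%N) ->
  path e x p -> uniq (x :: p) -> p <> [::] ->
  exists A, arc A /\ A 0 = pos x /\ A 1 = pos (last x p) /\
    forall t, in01 t -> (exists v, v \in x :: p /\ A t = pos v) \/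
      (exists i j l u, i \in x :: p /\ j \in x :: p /\ i <> j /\ (l < m i j)%N /\
         in01o u /\ A t = G i j l u).
Proof.
move=> he; have [_ [hG [_ hD]]] := dr.
elim: p x => [//|y p IH] x /= /andP[exy hp] /andP[xn un] _.
have xy : x <> y by move=> h; rewrite h inE eqxx in xn.
have mxy := he _ _ exy.
have [aG [G0 [G1 Gv]]] := hG x y 0%N isT isT xy mxy.
have Gim t : in01 t -> (exists v, v \in [:: x; y] /\ G x y 0%N t = pos v) \/ in01o t.
  case/in01_cases => [->|[->|h]]; [left; exists x|left; exists y|by right];
  by rewrite !inE eqxx ?orbT.
case: (classic (p = [::])) => pn.
  subst p; exists (G x y 0%N); do 3 (split=> //).
  move=> t /Gim[h|to]; [by left|right].
  by exists x, y, 0%N, t; rewrite !inE !eqxx orbT.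
have [A [aA [A0 [A1 hA]]]] := IH y hp un pn.
have [cG iG] := aG; have [cA iA] := aA.
exists (cat (G x y 0%N) A); split.
  split; first by apply: cat_cont => //; rewrite G1 A0.
  apply: cat_inj => // t t' t01 t'01 heq.
  case: (hA t' t'01) => [[v [vin hv]]|[i [j [l [u [iin [jin [ij [hl [uo hu]]]]]]]]]].
    case: (in01_cases t t01) => [t0|[t1|to]].
    - exfalso; rewrite t0 G0 hv in heq.
      by move: xn; rewrite (pinj _ _ heq) vin.
    - split=> //; apply: iA => //; first exact: in01_0.
      by rewrite A0 -heq t1.
    - by case: (Gv t v to isT); rewrite heq.
  case: (in01_cases t t01) => [t0|[t1|to]].
  - have [_ [_ [_ Gv']]] := hG i j l isT isT ij hl.
    by case: (Gv' u x uo isT); rewrite -hu -heq t0.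
  - have [_ [_ [_ Gv']]] := hG i j l isT isT ij hl.
    by case: (Gv' u y uo isT); rewrite -hu -heq t1.
  - rewrite hu in heq.
    have [_ [[h1 _]|[h1 _]]] := hD _ _ _ _ _ _ _ _ isT isT xy mxy isT isT ij hl to uo heq.
      by move: xn; rewrite h1 iin.
    by move: xn; rewrite h1 jin.
split; first by rewrite cat0.
split; first by rewrite cat1.
move=> t [t0 t1]; case: (Rle_dec t (1/2)) => ht.
  rewrite catl //; case: (Gim (2 * t) ltac:(split; lra)) => [[v [vin hv]]|to].
    left; exists v; split=> //; move: vin; rewrite !inE.
    by case/orP => /eqP->; rewrite eqxx ?orbT.
  by right; exists x, y, 0%N, (2 * t); rewrite !inE !eqxx orbT.
rewrite catr; last exact: Rnot_le_lt.
have := Rnot_le_lt _ _ ht => ht'.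
case: (hA (2 * t - 1) ltac:(split; lra)) => [[v [vin hv]]|[i [j [l [u [iin [jin H]]]]]]].
  by left; exists v; rewrite in_cons vin orbT.
by right; exists i, j, l, u; rewrite in_cons iin orbT in_cons jin orbT.
Qed.

Variables (a b : V) (Z : pred V).
Hypotheses (ab : a <> b) (Za : ~~ Z a) (Zb : ~~ Z b).

Let S : pred V := [pred v | Z v || (v == a) || (v == b)].
Let eY : rel V := [rel u v | (0 < m u v)%N && ~~ Z u && ~~ Z v].
(** The edges between [a] and [b] are dropped: they belong to neither side, and the free arc may run
    along one of them. *)
Definition side_mult (i j : V) : nat :=
  if ((i == a) && (j == b)) || ((i == b) && (j == a)) then 0%N else m i j.

Hypothesis conY : connect eY a b.

Let M := (\max_(p : V * V) m p.1 p.2)%N.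

(* Edges are oriented so that they leave a and enter b. *)
Let key (v : V) : nat :=
  if v == a then 0%N else if v == b then #|V|.+1 else (enum_rank v).+1.

Let key_inj : injective key.
Proof.
move=> u v; rewrite /key; have ba : b != a by apply/eqP => h; apply: ab.
have lt (w : V) : (enum_rank w < #|V|)%N by exact: ltn_ord.
case: (eqVneq u a) => [->|ua]; case: (eqVneq v a) => [->|va] //; try by case: eqP.
case: (eqVneq u b) => [->|ub]; case: (eqVneq v b) => [->|vb] //.
- by move=> [h]; have := lt v; rewrite -h ltnn.
- by move=> [h]; have := lt u; rewrite h ltnn.
- by move=> [/ord_inj/enum_rank_inj].
Qed.

Let key_a v : (key v < key a)%N = false. Proof. by rewrite /key eqxx. Qed.
Let key_b v : (key b < key v)%N = false.
Proof.
rewrite /key; have -> : (b == a) = false by apply/eqP => h; apply: ab.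
rewrite eqxx; case: eqP => // _; case: eqP => _; first by rewrite ltnn.
by rewrite ltnS ltnNge ltnW ?ltn_ord.
Qed.

Let valid (x : V * V * 'I_M) : bool :=
  let: (i, j, l) := x in [&& (key i < key j)%N, S i, S j & (l < side_mult i j)%N].

Let E := {x : V * V * 'I_M | valid x}.

Let code (x : E) : V * V * nat := ((val x).1.1, (val x).1.2, nat_of_ord (val x).2).

Lemma side_mult_lt i j l : (l < side_mult i j)%N -> (l < m i j)%N.
Proof. by rewrite /side_mult; case: ifP. Qed.

Let valid_code (x : E) : exists i j l, code x = (i, j, l) /\ (key i < key j)%N /\ S i /\ S j /\
  (l < side_mult i j)%N.
Proof.
case: x => [[[i j] l] /= h]; have := h; rewrite /valid /code /=.
by case/and4P => h1 h2 h3 h4; exists i, j, (nat_of_ord l).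
Qed.

Let code_inj : injective code.
Proof.
move=> [[[i j] l] h] [[[i' j'] l'] h'] [/= e1 e2 e3]; apply: val_inj => /=.
by rewrite e1 e2; congr pair; apply: val_inj.
Qed.

Let side_multC i j : side_mult i j = side_mult j i.
Proof. by rewrite /side_mult msym orbC (andbC (i == b)) (andbC (i == a)). Qed.

Let code_ex i j l : S i -> S j -> i <> j -> (l < side_mult i j)%N ->
  (exists x : E, code x = (i, j, l)) \/ (exists x : E, code x = (j, i, l)).
Proof.
have mk i' j' : S i' -> S j' -> (key i' < key j')%N -> (l < side_mult i' j')%N ->
    exists x : E, code x = (i', j', l).
  move=> h1 h2 h3 h4.
  have lM : (l < M)%N.
    by apply: leq_trans (side_mult_lt _ _ _ h4) _; apply: (leq_bigmax (i', j')).
  have v : valid (i', j', Ordinal lM) by rewrite /valid h1 h2 h3 h4.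
  by exists (exist (fun x => is_true (valid x)) (i', j', Ordinal lM) v).
move=> Si Sj ij hl; case: (ltngtP (key i) (key j)) => [h|h|/key_inj //].
  by left; apply: mk.
by right; apply: mk => //; rewrite side_multC.
Qed.


Let Sa : S a. Proof. by rewrite /S /= eqxx orbT. Qed.
Let Sb : S b. Proof. by rewrite /S /= eqxx !orbT. Qed.
Let S_nZ v : S v -> ~~ Z v -> v = a \/ v = b.
Proof. by rewrite /S /= => /orP[/orP[->//|/eqP]|/eqP]; [left|right]. Qed.

Let free_arc : exists A, arc A /\ A 0 = pos a /\ A 1 = pos b /\
    forall t, in01 t -> (exists v, ~~ Z v /\ A t = pos v) \/
      (exists i j l u, ~~ Z i /\ ~~ Z j /\ i <> j /\ (l < m i j)%N /\
         in01o u /\ A t = G i j l u).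
Proof.
case/connectP: conY => p hp hb; case: (shortenP hp) hb => p' hp' up' _ hb.
have pn : p' <> [::] by move=> h; apply: ab; rewrite hb h.
have he u v : eY u v -> (0 < m u v)%N by case/andP => /andP[].
have [A [aA [A0 [A1 hA]]]] := path_arc eY a p' he hp' up' pn.
have nZ : forall v, v \in a :: p' -> ~~ Z v.
  elim: (p') (a) Za hp' => [|y q IH] x Zx /=; first by move=> _ v; rewrite inE => /eqP->.
  case/andP => /andP[_ Zy] hq v; rewrite inE => /orP[/eqP->//|]; exact: IH.
exists A; do 2 (split=> //); split; first by rewrite hb.
move=> t /hA[[v [/nZ vin h]]|[i [j [l [u [/nZ iin [/nZ jin h]]]]]]]; first by left; exists v.
by right; exists i, j, l, u.
Qed.

(* The arc through the other side joins [a] to [b] without meeting the drawing of [Z]; after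
   [arc_lens] it is a diameter of the lens. *)
Lemma side_lens : exists pos' G', drawing S side_mult pos' G' /\
  pos' a = (-1, 0) /\ pos' b = (1, 0) /\ (forall v, Z v -> lens (pos' v)) /\
  (forall i j l t, S i -> S j -> i <> j -> (l < side_mult i j)%N -> in01o t -> lens (G' i j l t)).
Proof.
have [A [aA [A0 [A1 hA]]]] := free_arc.
have [_ [hG [Grev hD]]] := dr.
(* [None] is the free arc. It is straightened together with the edges, so that its directions at
   both ends differ from theirs. *)
pose g (e : option E) := if e is Some x then G (code x).1.1 (code x).1.2 (code x).2 else A.
pose posW (w : {v : V | S v}) := pos (val w).
have gE x i j l : code x = (i, j, l) -> g (Some x) = G i j l by rewrite /g => ->.
have vc x : exists i j l, code x = (i, j, l) /\ (key i < key j)%N /\ S i /\ S j /\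
    (l < side_mult i j)%N /\ i <> j /\ (l < m i j)%N.
  have [i [j [l [h1 [h2 [h3 [h4 h5]]]]]]] := valid_code x.
  exists i, j, l; do 5 (split=> //); split; last exact: side_mult_lt.
  by move=> h; rewrite h ltnn in h2.
have gx x : exists i j l, code x = (i, j, l) /\ (key i < key j)%N /\ S i /\ S j /\
    g (Some x) = G i j l /\ arc (G i j l) /\ G i j l 0 = pos i /\ G i j l 1 = pos j /\
    forall t v, in01o t -> G i j l t <> pos v.
  have [i [j [l [h1 [h2 [h3 [h4 [h5 [h6 h7]]]]]]]]] := vc x.
  have [k1 [k2 [k3 k4]]] := hG i j l isT isT h6 h7.
  exists i, j, l; do 4 (split=> //); split; first exact: gE.
  by split=> //; split=> //; split=> // t v to; apply: k4.
have gend x i j l : code x = (i, j, l) -> g (Some x) 0 = pos i /\ g (Some x) 1 = pos j.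
  move=> hx; have [i0 [j0 [l0 [h1 [_ [_ [_ [-> [_ [h2 [h3 _]]]]]]]]]]] := gx x.
  by rewrite hx in h1; case: h1 => -> -> _.
have Apos t v : in01 t -> A t = pos v -> ~~ Z v.
  move=> t01 h; case: (hA t t01) => [[w [Zw hw]]|[i [j [l [u [_ [_ [ij [hl [uo hu]]]]]]]]]].
    by rewrite (pinj v w) // -h.
  have [_ [_ [_ k]]] := hG i j l isT isT ij hl.
  by case: (k u v uo isT); rewrite -hu.
have AS t v : in01o t -> S v -> A t <> pos v.
  move=> to Sv h; have [_ iA] := aA; have t01 := in01o_in01 _ to.
  case: (S_nZ v Sv (Apos t v t01 h)) => hv; subst v.
    by have := iA t 0 t01 in01_0; rewrite A0 => /(_ h); case: to; lra.
  by have := iA t 1 t01 in01_1; rewrite A1 => /(_ h); case: to; lra.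
have AG t x i j l u : in01 t -> code x = (i, j, l) -> in01o u -> A t <> G i j l u.
  move=> t01 hx uo h.
  have [i0 [j0 [l0 [h1 [h2 [h3 [h4 [h5 [h6 h7]]]]]]]]] := vc x.
  rewrite hx in h1; case: h1 => ? ? ?; subst i0 j0 l0.
  case: (hA t t01) => [[w [Zw hw]]|[i' [j' [l' [u' [Zi [Zj [ij [hl [u'o hu]]]]]]]]]].
    have [_ [_ [_ k]]] := hG i j l isT isT h6 h7.
    by case: (k u w uo isT); rewrite -h.
  rewrite h in hu.
  have [_ [[e1 e2]|[e1 e2]]] := hD _ _ _ _ _ _ _ _ isT isT h6 h7 isT isT ij hl uo u'o hu; subst i' j'.
    case: (S_nZ i h3 Zi) => hi; case: (S_nZ j h4 Zj) => hj; subst i j; try by case: h6.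
      by rewrite /side_mult !eqxx in h5.
    by rewrite /side_mult !eqxx orbT in h5.
  case: (S_nZ i h3 Zj) => hi; case: (S_nZ j h4 Zi) => hj; subst i j; try by case: h6.
    by rewrite /side_mult !eqxx in h5.
  by rewrite /side_mult !eqxx orbT in h5.
have fam : arcfam (option E) {v : V | S v} g posW.
  split; [|split].
  - move=> [x|] //; by have [i [j [l [_ [_ [_ [_ [-> []]]]]]]]] := gx x.
  - move=> [x|] [y|] t t' ne to t'01 //.
    + have [i [j [l [hx [kx [Si [Sj [-> [aG [G0 [G1 Gv]]]]]]]]]]] := gx x.
      have [i' [j' [l' [hy [ky [Si' [Sj' [-> [aG' [G0' [G1' Gv']]]]]]]]]]] := gx y.
      case/in01_cases: t'01 => [->|[->|t'o]]; rewrite ?G0' ?G1'; try exact: Gv.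
      have [i0 [j0 [l0 [q1 [_ [_ [_ [_ [q6 q7]]]]]]]]] := vc x.
      rewrite hx in q1; case: q1 => ? ? ?; subst i0 j0 l0.
      have [i0 [j0 [l0 [q1 [_ [_ [_ [_ [q8 q9]]]]]]]]] := vc y.
      rewrite hy in q1; case: q1 => ? ? ?; subst i0 j0 l0.
      move=> h; have [el [[e1 e2]|[e1 e2]]] := hD _ _ _ _ _ _ _ _ isT isT q6 q7 isT isT q8 q9 to t'o h.
        by apply: ne; congr Some; apply: code_inj; rewrite hx hy e1 e2 el.
      by subst; move: (ltn_trans kx ky); rewrite ltnn.
    + have [i [j [l [hx [kx [Si [Sj [-> [aG [G0 [G1 Gv]]]]]]]]]]] := gx x.
      by move=> h; apply: (AG t' x i j l t t'01 hx to).
    + have [i [j [l [hy [ky [Si [Sj [-> [aG [G0 [G1 Gv]]]]]]]]]]] := gx y.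
      case/in01_cases: t'01 => [->|[->|t'o]]; rewrite ?G0 ?G1; try exact: AS.
      by apply: AG hy t'o; exact: in01o_in01.
  - move=> [x|] t [w Sw] to; last exact: AS.
    have [i [j [l [_ [_ [_ [_ [-> [_ [_ [_ Gv]]]]]]]]]]] := gx x.
    exact: Gv.
(* Radii below [d / 2] give disjoint discs around [a] and [b], so the second straightening preserves
   the effect of the first. *)
pose d := dst (pos a) (pos b).
have dp : 0 < d by apply: dst_gt0 => /pinj.
pose S1 (e : option E) := if e is Some x then (code x).1.1 == a else true.
pose S2 (e : option E) := if e is Some x then (code x).1.2 == b else true.
have [||r1 [g1 [D1 [r1p [fam1 [end1 [far1 [near1 [dir1 [nz1 w1]]]]]]]]]] :=
   straighten (option E) _ g posW (pos a) S1 (d / 2) fam ltac:(lra).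
- move=> [x|] hx; last by [].
  have {}hx : (code x).1.1 = a by apply/eqP.
  have [i [j [l [h1 _]]]] := vc x.
  by rewrite (proj1 (gend x i j l h1)); move: hx; rewrite h1 /= => ->.
- move=> [x|] // hx t t01; have {}hx : (code x).1.1 != a by [].
  have [i [j [l [h1 [kx [_ [_ [hg [_ [_ [_ h4]]]]]]]]]]] := gx x.
  have [h2 h3] := gend x i j l h1.
  rewrite h1 /= in hx.
  case/in01_cases: t01 => [->|[->|to]]; last by rewrite hg; exact: h4.
    by rewrite h2 => /pinj h; rewrite h eqxx in hx.
  by rewrite h3 => /pinj h; rewrite h key_a in kx.
pose g1r e := rev (g1 e).
have [ga1 [gp1 gv1]] := fam1.
have rev01 t : in01 t -> in01 (1 - t) by rewrite /in01; lra.
have rev01o t : in01o t -> in01o (1 - t) by rewrite /in01o; lra.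
have fam1r : arcfam (option E) {v : V | S v} g1r posW.
  split; first by move=> e; apply: rev_arc.
  split=> [e e' t t' ne to t'01|e t w to]; first by apply: gp1 => //; [exact: rev01o|exact: rev01].
  by apply: gv1; exact: rev01o.
have g1_0 e : g1r e 0 = g e 1.
  by rewrite /g1r /rev Rminus_0_r; case: (end1 e).
have g1_1 e : g1r e 1 = g e 0.
  by rewrite /g1r /rev Rminus_diag; case: (end1 e).
have [||r2 [g2 [D2 [r2p [fam2 [end2 [far2 [near2 [dir2 [nz2 w2]]]]]]]]]] :=
   straighten (option E) _ g1r posW (pos b) S2 (d / 2) fam1r ltac:(lra).
- move=> [x|] hx; last by rewrite g1_0.
  have {}hx : (code x).1.2 = b by apply/eqP.
  rewrite g1_0; have [i [j [l [h1 _]]]] := vc x.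
  by rewrite (proj2 (gend x i j l h1)); move: hx; rewrite h1 /= => ->.
- move=> [x|] // hx t t01; have {}hx : (code x).1.2 != b by [].
  have [i [j [l [h1 [kx _]]]]] := vc x; rewrite h1 /= in hx.
  have [p0 p1] := gend x i j l h1.
  case/in01_cases: t01 => [->|[->|to]].
  + by rewrite g1_0 p1 => /pinj h; rewrite h eqxx in hx.
  + by rewrite g1_1 p0 => /pinj h; rewrite h key_b in kx.
  + by apply: (gv1 (Some x) (1 - t) (exist (fun v => is_true (S v)) b Sb)); exact: rev01o.
have [ga2 [gp2 gv2]] := fam2.
(* g3 runs in the original direction *)
pose g3 e := rev (g2 e).
have g3_0 e : g3 e 0 = g e 0 by rewrite /g3 /rev Rminus_0_r; case: (end2 e) => _ ->; rewrite g1_1.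
have g3_1 e : g3 e 1 = g e 1 by rewrite /g3 /rev Rminus_diag; case: (end2 e) => -> _; rewrite g1_0.
have ga3 e : arc (g3 e) by apply: rev_arc.
have gp3 e e' t t' : e <> e' -> in01o t -> in01 t' -> g3 e t <> g3 e' t'.
  by move=> ne to t'01; apply: gp2 => //; [exact: rev01o|exact: rev01].
have gv3 e t v : in01o t -> S v -> g3 e t <> pos v.
  by move=> to Sv; apply: (gv2 e (1 - t) (exist (fun v => is_true (S v)) v Sv)); exact: rev01o.
have nearA e t : in01 t -> dst (g3 e t) (pos a) < r1 ->
    S1 e /\ exists s, 0 <= s /\ g3 e t = ray (pos a) (D1 e) s.
  move=> t01 hd.
  have [|t' [t'01 h]] := far2 e (1 - t) (rev01 t t01).
    have := dst_tri (pos a) (g2 e (1 - t)) (pos b); rewrite -/d (dst_sym (pos a)).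
    by rewrite /g3 /rev in hd; lra.
  have e1 : g3 e t = g1 e (1 - t') by [].
  by rewrite e1 in hd *; apply: near1 => //; exact: rev01.
have nearB e t : in01 t -> dst (g3 e t) (pos b) < r2 ->
    S2 e /\ exists s, 0 <= s /\ g3 e t = ray (pos b) (D2 e) s.
  by move=> t01; apply: near2; exact: rev01.
pose K (x : pt) := (exists (y : E) t, in01 t /\ x = g3 (Some y) t) \/ (exists v, S v /\ x = pos v).
have cK : compactset K.
  exists (E + {v : V | S v})%type, (fun f => match f with inl y => g3 (Some y) | inr w => fun=> pos (val w) end).
  split=> [[y|w]|x]; [by case: (ga3 (Some y))|exact: cont01_cst|split].
    move=> [[y [t [t01 ->]]]|[v [Sv ->]]]; first by exists (inl y), t.
    by exists (inr (exist (fun v => is_true (S v)) v Sv)), 0; split=> //; exact: in01_0.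
  move=> [[y|w] [t [t01 ->]]]; first by left; exists y, t.
  by right; exists (val w); split=> //; exact: (valP w).
have g30 : g3 None 0 = pos a by rewrite g3_0.
have g31 : g3 None 1 = pos b by rewrite g3_1.
(* near each terminal K consists of radii none of which is parallel to the free arc *)
have mkwedge p (SS : option E -> bool) (D : option E -> pt) r : SS None -> 0 < r ->
    (forall e e' s, SS e -> SS e' -> e <> e' -> 0 <= s -> D e <> (s * (D e').1, s * (D e').2)) ->
    D None <> (0, 0) ->
    (forall e t, in01 t -> dst (g3 e t) p < r -> SS e /\ exists s, 0 <= s /\ g3 e t = ray p (D e) s) ->
    (forall v, S v -> pos v <> p -> r < dst (pos v) p) ->
    wedge K p (ray p (D None) 1).
  move=> SN rp hdir hnz hnear hw.
  pose dot e := (D e).1 * (D None).1 + (D e).2 * (D None).2.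
  pose crs e := (D e).1 * (D None).2 - (D e).2 * (D None).1.
  have [eta [ep he]] : exists eta, 0 < eta /\ forall e : option E, (fun e eta =>
      SS e -> e <> None -> 0 < dot e -> dot e * eta <= Rabs (crs e)) e eta.
    apply: fin_pos; last by move=> e u v h huv Se ne h0; have := h Se ne h0; nra.
    move=> e; case: (classic (SS e /\ e <> None /\ 0 < dot e)) => [[Se [ne h0]]|hn]; last first.
      by exists 1; split; [lra|move=> *; case: hn].
    have cn : crs e <> 0.
      move=> c0; have Lp : 0 < (D None).1 * (D None).1 + (D None).2 * (D None).2.
        have := dt_gt0 (0,0) (D None) (fun h => hnz (esym h)); rewrite /dt /=; lra.
      pose s := dot e / ((D None).1 * (D None).1 + (D None).2 * (D None).2).
      apply: (hdir e None s Se SN ne); first by apply/Rlt_le/Rdiv_lt_0_compat.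
      rewrite (surjective_pairing (D e)) /s; move: c0; rewrite /dot /crs.
      case: (D e) (D None) Lp => [x y] [u v] /= Lp c0.
      have xv : x * v = y * u by lra.
      have e1 : x * u * u + y * u * v = x * (u * u + v * v).
        by rewrite -xv; ring.
      have e2 : x * u * v + y * v * v = y * (u * u + v * v).
        by have -> : x * u * v = (x * v) * u by [ring]; rewrite xv; ring.
      congr pair.
        apply: (Rmult_eq_reg_r (u * u + v * v)); last lra.
        by rewrite -e1; field; lra.
      apply: (Rmult_eq_reg_r (u * u + v * v)); last lra.
      by rewrite -e2; field; lra.
    exists (Rabs (crs e) / dot e); split.
      by apply: Rdiv_lt_0_compat => //; apply: Rabs_pos_lt.
    by move=> _ _ _; apply: Req_le; field; lra.
  exists r, (/ eta); split=> // k Kk hk.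
  have ie := Rinv_0_lt_compat _ ep.
  case: Kk hk => [[y [t [t01 ->]]]|[v [Sv ->]]] hk; last first.
    have -> : pos v = p by apply: NNPP => hv; have := hw v Sv hv; lra.
    have -> : dt p (ray p (D None) 1) p = 0 by rewrite /dt; ring.
    have -> : cr p (ray p (D None) 1) p = 0 by rewrite /cr; ring.
    by rewrite Rabs_R0; lra.
  have [Sy [s [s0 hs]]] := hnear _ t t01 hk.
  rewrite hs.
  have -> : dt p (ray p (D None) 1) (ray p (D (Some y)) s) = s * dot (Some y) by rewrite /dt /ray /dot /=; ring.
  have -> : cr p (ray p (D None) 1) (ray p (D (Some y)) s) = s * crs (Some y) by rewrite /cr /ray /crs /=; ring.
  rewrite Rabs_mult (Rabs_right s); last lra.
  have cp := Rabs_pos (crs (Some y)).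
  have c1 : 0 <= / eta * (s * Rabs (crs (Some y))).
    by apply: Rmult_le_pos; [lra|apply: Rmult_le_pos].
  case: (Rle_dec (dot (Some y)) 0) => hdot; first by nra.
  have h := he (Some y) Sy ltac:(by []) (Rnot_le_lt _ _ hdot).
  have -> : s * dot (Some y) = / eta * (s * (dot (Some y) * eta)) by field; lra.
  by apply: Rmult_le_compat_l; [lra|apply: Rmult_le_compat_l].
have [|||||Psi [cP [iP [Pa [Pb lP]]]]] := arc_lens K (g3 None) (D1 None) (D2 None) cK (ga3 None).
- move=> t t01 Kt; case/in01_cases: (t01) => [|[|to]]; [by left|by right|exfalso].
  case: Kt => [[y [t' [t'01 h]]]|[v [Sv h]]]; last by case: (gv3 None t v to Sv).
  by case: (gp3 None (Some y) t t').
- by exists r1; split; [lra|rewrite g30 => t t01 /(nearA None t t01)[]].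
- by exists r2; split; [lra|rewrite g31 => t t01 /(nearB None t t01)[]].
- rewrite g30; apply: (mkwedge (pos a) S1 D1 r1) => //; [lra|exact: nz1|].
  by move=> v Sv hv; apply: (w1 (exist (fun v => is_true (S v)) v Sv)).
- rewrite g31; apply: (mkwedge (pos b) S2 D2 r2) => //; [lra|exact: nz2|].
  by move=> v Sv hv; apply: (w2 (exist (fun v => is_true (S v)) v Sv)).
rewrite g30 in Pa lP; rewrite g31 in Pb lP.
have Kpos v : S v -> K (pos v) by move=> Sv; right; exists v.
have Kg y t : in01 t -> K (g3 (Some y) t) by move=> t01; left; exists y, t.
(* [E] holds each edge in one orientation, hence the two lookups; the default value is taken only
   for triples that are not edges. *)
pose G' i j l t : pt :=
  if [pick y : E | code y == (i, j, l)] is Some y then Psi (g3 (Some y) t)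
  else if [pick y : E | code y == (j, i, l)] is Some y then Psi (g3 (Some y) (1 - t))
  else (0, 0).
have pickE y i j l : code y = (i, j, l) -> [pick z : E | code z == (i, j, l)] = Some y.
  move=> h; case: pickP => [z /eqP hz|/(_ y)]; last by rewrite h eqxx.
  by congr Some; apply: code_inj; rewrite hz h.
have pickN y i j l : code y = (i, j, l) -> [pick z : E | code z == (j, i, l)] = None.
  move=> h; case: pickP => // z /eqP hz.
  have [i0 [j0 [l0 [q1 [kx _]]]]] := vc y; rewrite h in q1; case: q1 => ? ? ?; subst i0 j0 l0.
  have [i0 [j0 [l0 [q1 [ky _]]]]] := vc z; rewrite hz in q1; case: q1 => ? ? ?; subst i0 j0 l0.
  by move: (ltn_trans kx ky); rewrite ltnn.
have G'1 y i j l : code y = (i, j, l) -> G' i j l = fun t => Psi (g3 (Some y) t).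
  by move=> h; rewrite /G' (pickE y).
have G'2 y i j l : code y = (j, i, l) -> G' i j l = fun t => Psi (g3 (Some y) (1 - t)).
  by move=> h; rewrite /G' (pickN y _ _ _ h) (pickE y _ _ _ h).
have lensG y t : in01o t -> lens (Psi (g3 (Some y) t)).
  by move=> to; apply: lP; [apply: Kg; exact: in01o_in01|exact: gv3|exact: gv3].
have arcG y : arc (fun t => Psi (g3 (Some y) t)).
  have [cg ig] := ga3 (Some y); split.
    move=> t t01 e e0; have [dl [dlp hd]] := cP _ (Kg y t t01) e e0.
    have [d' [d'p hd']] := cg t t01 dl dlp; exists d'; split=> // t' t'01 ht.
    by apply: hd; apply: hd'.
  move=> t t' t01 t'01 h; apply: ig => //; apply: iP => //; exact: Kg.
have tag i j l : S i -> S j -> i <> j -> (l < side_mult i j)%N ->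
    exists y (f : bool), code y = (if f then (i, j, l) else (j, i, l)) /\
      forall t, G' i j l t = Psi (g3 (Some y) (if f then t else 1 - t)).
  move=> Si Sj ij hl; case: (code_ex i j l Si Sj ij hl) => [[y hy]|[y hy]].
    by exists y, true; rewrite (G'1 y).
  by exists y, false; rewrite (G'2 y).
exists (fun v => Psi (pos v)), G'; split; last first.
  do 2 (split=> //); split.
    move=> v Zv; have Sv : S v by rewrite /S /= Zv.
    by apply: lP; [exact: Kpos|move=> /pinj h; move: Za; rewrite -h Zv|move=> /pinj h; move: Zb; rewrite -h Zv].
  move=> i j l t Si Sj ij hl to.
  have [y [f [_ ->]]] := tag i j l Si Sj ij hl.
  by case: f; apply: lensG => //; exact: rev01o.
split; first by move=> u v Su Sv h; apply: pinj; apply: iP => //; exact: Kpos.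
split.
  move=> i j l Si Sj ij hl; case: (code_ex i j l Si Sj ij hl) => [[y hy]|[y hy]].
    rewrite (G'1 y) //; split; first exact: arcG.
    rewrite g3_0 g3_1; have [-> ->] := gend y i j l hy; do 2 (split=> //).
    move=> t v to Sv h; apply: (gv3 (Some y) t v to Sv); apply: iP => //; last exact: Kpos.
    by apply: Kg; exact: in01o_in01.
  rewrite (G'2 y) //; split; first exact: (rev_arc (fun t => Psi (g3 (Some y) t))).
  rewrite Rminus_0_r Rminus_diag g3_0 g3_1; have [-> ->] := gend y j i l hy; do 2 (split=> //).
  move=> t v to Sv h; apply: (gv3 (Some y) (1 - t) v (rev01o _ to) Sv); apply: iP => //; last exact: Kpos.
  by apply: Kg; apply: rev01; exact: in01o_in01.
split.
  move=> i j l t ij; rewrite /G'.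
  case: (pickP (fun y : E => code y == (i, j, l))) => [y /eqP hy|h1].
    rewrite (pickN y _ _ _ hy) //.
  case: (pickP (fun y : E => code y == (j, i, l))) => [y /eqP hy|h2] //.
  by congr (Psi (g3 _ _)); lra.
move=> i j l i' j' l' t t' Si Sj ij hl Si' Sj' ij' hl' to t'o.
have [y [f [hy ->]]] := tag i j l Si Sj ij hl.
have [y' [f' [hy' ->]]] := tag i' j' l' Si' Sj' ij' hl'.
have to1 : in01o (if f then t else 1 - t) by case: (f) => //; exact: rev01o.
have to2 : in01o (if f' then t' else 1 - t') by case: (f') => //; exact: rev01o.
move: (if f then t else _) (if f' then t' else _) to1 to2 => u u' uo u'o h.
have hg : g3 (Some y) u = g3 (Some y') u'.
  by apply: iP => //; apply: Kg; exact: in01o_in01.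
have yy : y = y'.
  apply: NNPP => ne; apply: (gp3 (Some y) (Some y') u u' _ uo (in01o_in01 _ u'o) hg).
  by move=> [].
subst y'; rewrite hy in hy'.
by case: (f) (f') hy' => [] [] [-> -> ->]; split=> //; [left|right|right|left].
Qed.

End Side.
End Drawing.

(** * Stacking lenses between two fixed points *)

Section Glue.
Local Open Scope R_scope.
Notation pt := (R * R)%type.

Lemma planar_drawing N (m : 'I_N -> 'I_N -> nat) : (forall i j, m i j = m j i) ->
  planar_multigraph m -> exists pos G, drawing 'I_N predT m pos G.
Proof.
move=> msym [pos [gam [pinj h]]].
pose G (i j : 'I_N) l := if (i < j)%N then gam i j l else rev (gam j i l).
have ne_lt (i j : 'I_N) : i <> j -> (i < j)%N \/ (j < i)%N.
  by move=> ij; case: (ltngtP i j) => [| |/ord_inj //]; [left|right].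
have G1 (i j : 'I_N) l : (i < j)%N -> G i j l = gam i j l by rewrite /G => ->.
have G2 (i j : 'I_N) l : (j < i)%N -> G i j l = rev (gam j i l).
  by rewrite /G => ji; rewrite ltnNge (ltnW ji).
exists pos, G; split; first by move=> u v _ _; apply: pinj.
split.
  move=> i j l _ _ ij hl; case: (ne_lt i j ij) => lt.
    rewrite G1 //; have [c [inj [g0 [g1 [gv _]]]]] := h i j l lt hl.
    split; first by split=> //; apply/arc_continuousP.
    by do 2 (split=> //); move=> t v to _; apply: gv.
  rewrite G2 //; rewrite msym in hl; have [c [inj [g0 [g1 [gv _]]]]] := h j i l lt hl.
  split; first by apply: rev_arc; split=> //; apply/arc_continuousP.
  rewrite /rev Rminus_0_r Rminus_diag; do 2 (split=> //); move=> t v to _; apply: gv.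
  by move: to; rewrite /in01o; lra.
split.
  move=> i j l t ij; case: (ne_lt i j ij) => lt; rewrite (G1 _ _ _ lt) (G2 _ _ _ lt) //.
  by rewrite /rev; congr (gam _ _ _ _); lra.
have flip (i j : 'I_N) l t : i <> j -> (l < m i j)%N -> in01o t -> exists (i0 j0 : 'I_N) t0, (i0 < j0)%N /\ (l < m i0 j0)%N /\ in01o t0 /\
    G i j l t = gam i0 j0 l t0 /\ ((i = i0 /\ j = j0) \/ (i = j0 /\ j = i0)).
  move=> ij hl to; case: (ne_lt i j ij) => lt.
    by exists i, j, t; rewrite G1 //; do 4 (split=> //); left.
  exists j, i, (1 - t); rewrite G2 // -msym; do 2 (split=> //); split; last by split=> //; right.
  by move: to; rewrite /in01o; lra.
move=> i j l i' j' l' t t' _ _ ij hl _ _ ij' hl' to t'o heq.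
have [i0 [j0 [t0 [k1 [k2 [k3 [k4 k5]]]]]]] := flip i j l t ij hl to.
have [i1 [j1 [t1 [n1 [n2 [n3 [n4 n5]]]]]]] := flip i' j' l' t' ij' hl' t'o.
have e : (i0, j0, l) = (i1, j1, l').
  apply: NNPP => ne; have [_ [_ [_ [_ [_ hd]]]]] := h i0 j0 l k1 k2.
  by apply: (hd i1 j1 l' n1 n2 ne t0 t1 k3 n3); rewrite -k4 heq.
case: e => e1 e2 e3; subst i1 j1 l'; split=> //.
case: k5 => -[-> ->]; case: n5 => -[-> ->]; [left|right|right|left]; by split.
Qed.

(** The lens sheared upwards by [c (1 - x^2)], which keeps its tips. Levels 0 and 1 receive the two
    sides, and level [2 + l] the edge number [l] between the tips. *)
Definition inlens (c : R) (p : pt) : Prop :=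
  Rabs p.1 < 1 /\ Rabs (p.2 - c * (1 - p.1 * p.1)) < (1 - p.1 * p.1) / 2.

Lemma inlens_disj c c' p : inlens c p -> inlens c' p -> Rabs (c - c') < 1.
Proof.
move=> [h1 h2] [_ h3].
have q : 0 < 1 - p.1 * p.1.
  have -> : p.1 * p.1 = Rabs p.1 * Rabs p.1 by rewrite -Rabs_mult Rabs_right //; nra.
  by have := Rabs_pos p.1; nra.
have := Rabs_triang (p.2 - c' * (1 - p.1 * p.1)) (- (p.2 - c * (1 - p.1 * p.1))).
have -> : p.2 - c' * (1 - p.1 * p.1) + - (p.2 - c * (1 - p.1 * p.1)) = (c - c') * (1 - p.1 * p.1) by ring.
rewrite Rabs_Ropp Rabs_mult (Rabs_right (1 - _)); last lra.
by move=> h; apply: (Rmult_lt_reg_r (1 - p.1 * p.1)); lra.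
Qed.

Lemma inlens_end c : ~ inlens c (-1, 0) /\ ~ inlens c (1, 0).
Proof. by split=> -[/= h _]; rewrite ?Rabs_Ropp Rabs_R1 in h; lra. Qed.

Section GlueMain.
Variables (N : nat) (m m' : 'I_N -> 'I_N -> nat) (a b : 'I_N) (Z : pred 'I_N) (fl : bool).
Hypotheses (msym : forall i j, m i j = m j i) (m'sym : forall i j, m' i j = m' j i).
Hypotheses (ab : a <> b) (Za : ~~ Z a) (Zb : ~~ Z b).
Let Y : pred 'I_N := [pred v | ~~ Z v && (v != a) && (v != b)].
Let sw v := if fl then (if v == a then b else if v == b then a else v) else v.
Hypothesis connY : connect [rel u v | (0 < m u v)%N && ~~ Z u && ~~ Z v] a b.
Hypothesis connZ : connect [rel u v | (0 < m u v)%N && ~~ Y u && ~~ Y v] a b.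
Hypothesis mZ : forall z z', Z z -> Z z' -> m' z z' = m z z'.
Hypothesis mY : forall y y', Y y -> ~~ Z y' -> m' y y' = m y y'.
Hypothesis mZab : forall z, Z z -> m' z a = m z (sw a) /\ m' z b = m z (sw b).
Hypothesis mZY : forall z y, Z z -> Y y -> m' z y = 0%N.

Let PZ (p : pt) : pt := if fl then (- p.1, p.2) else p.
Let PY (p : pt) : pt := (p.1, p.2 + (1 - p.1 * p.1)).
Let dl (l : nat) (t : R) : pt := (2 * t - 1, (2 + INR l) * (1 - (2 * t - 1) * (2 * t - 1))).

Let contPZ : contpl PZ.
Proof.
move=> p; rewrite /PZ; case: (fl); last by move=> e e0; exists e.
by apply: contAt_pair; [apply: cpt_opp; exact: cpt_fst|exact: cpt_snd].
Qed.

Let contPY : contpl PY.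
Proof.
move=> p; apply: contAt_pair; first exact: cpt_fst.
apply: cpt_plus; first exact: cpt_snd.
by apply: cpt_minus; [exact: cpt_cst|apply: cpt_mult; exact: cpt_fst].
Qed.

Let injPZ p q : PZ p = PZ q -> p = q.
Proof.
rewrite /PZ; case: (fl) => // -[h1 h2].
by rewrite (surjective_pairing p) (surjective_pairing q); congr pair; lra.
Qed.

Let injPY p q : PY p = PY q -> p = q.
Proof.
case: p q => [x y] [x' y'] [/= -> h]; congr pair; lra.
Qed.

Let lensPZ p : lens p -> inlens 0 (PZ p).
Proof.
rewrite /PZ /lens /inlens; case: (fl) => /= -[h1 h2]; rewrite ?Rabs_Ropp Rmult_0_l Rminus_0_r; split=> //.
by rewrite Rmult_opp_opp.
Qed.

Let lensPY p : lens p -> inlens 1 (PY p).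
Proof.
rewrite /PY /lens /inlens /= => -[h1 h2]; split=> //.
by have -> : p.2 + (1 - p.1 * p.1) - 1 * (1 - p.1 * p.1) = p.2 by ring.
Qed.

Let dl_arc l : arc (dl l).
Proof.
split; last by move=> t t' _ _ [h _]; lra.
have c1 : contpl (fun p : pt => (p.1, (2 + INR l) * (1 - p.1 * p.1))).
  move=> p; apply: contAt_pair; first exact: cpt_fst.
  apply: cpt_mult; first exact: cpt_cst.
  by apply: cpt_minus; [exact: cpt_cst|apply: cpt_mult; exact: cpt_fst].
have c2 := contpl_cont01 _ _ c1 (ray_cont (-1, 0) (2, 0)).
move=> t t01 e e0; have [d [dp hd]] := c2 t t01 e e0; exists d; split=> // t' t'01 ht.
have e1 u : dl l u = (fun p : pt => (p.1, (2 + INR l) * (1 - p.1 * p.1))) (ray (-1, 0) (2, 0) u).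
  by rewrite /dl /ray /=; congr pair; ring.
by rewrite !e1; apply: hd.
Qed.

Let dl_lens l t : in01o t -> inlens (2 + INR l) (dl l t).
Proof.
move=> [t0 t1]; rewrite /dl /inlens /=; split; first by apply: Rabs_def1; lra.
by rewrite Rminus_diag Rabs_R0; nra.
Qed.

Let swK : involutive sw.
Proof.
move=> v; rewrite /sw; case: (fl) => //; have ba : (b == a) = false by apply/eqP => h; apply: ab.
case: (eqVneq v a) => [->|va]; first by rewrite ba eqxx.
case: (eqVneq v b) => [->|vb]; first by rewrite eqxx.
by rewrite (negbTE va) (negbTE vb).
Qed.

Let swZ v : Z v -> sw v = v.
Proof.
rewrite /sw; case: (fl) => // Zv; case: eqP => [va|_]; first by move: Za; rewrite -va Zv.
by case: eqP => // vb; move: Zb; rewrite -vb Zv.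
Qed.

Let swab : (sw a = a /\ sw b = b) \/ (sw a = b /\ sw b = a).
Proof.
rewrite /sw; case: (fl); last by left.
by right; rewrite !eqxx; split=> //; case: eqP => // h; case: ab.
Qed.

Let vcase v : [\/ v = a, v = b, Z v | Y v].
Proof.
case: (eqVneq v a) => va; first by constructor 1.
case: (eqVneq v b) => vb; first by constructor 2.
case Zv : (Z v); first by constructor 3.
by constructor 4; rewrite /Y /= Zv va vb.
Qed.

Let nYa : ~~ Y a. Proof. by rewrite /Y /= eqxx andbF. Qed.
Let nYb : ~~ Y b. Proof. by rewrite /Y /= eqxx !andbF. Qed.
Let nYZ v : Z v -> ~~ Y v. Proof. by rewrite /Y /= => ->. Qed.
Let nZY v : Y v -> ~~ Z v. Proof. by rewrite /Y /= => /andP[/andP[]]. Qed.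

(** The multiplicity [m' a b] is arbitrary, since edges between [a] and [b] are redrawn as parabolas
    above both sides. One statement thus covers the twist, with [fl] true, and the additional edge,
    with [fl] false. *)
Lemma planar_glue : planar_multigraph m -> planar_multigraph m'.
Proof.
case/(planar_drawing N m msym) => pos [G dr].
have [posZ [GZ [dZ [Za1 [Zb1 [ZL ZG]]]]]] := side_lens 'I_N m pos G msym dr a b Z ab Za Zb connY.
have [posY [GY [dY [Ya1 [Yb1 [YL YG]]]]]] := side_lens 'I_N m pos G msym dr a b Y ab nYa nYb connZ.
pose SZ := [pred v | Z v || (v == a) || (v == b)].
pose SY := [pred v | Y v || (v == a) || (v == b)].
pose isab i j := ((i == a) && (j == b)) || ((i == b) && (j == a)).
pose cls i j (l : nat) : R := if isab i j then 2 + INR l else if Z i || Z j then 0 else 1.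
pose pos' v := if v == a then (-1, 0) else if v == b then (1, 0) else if Z v then PZ (posZ v) else PY (posY v).
(* [sw] exchanges the ends in the combinatorics and [PZ] reflects the picture, so that [a] and [b]
   return to their own tips while the edges at them are exchanged. *)
pose G' i j l := if isab i j then (if i == a then dl l else rev (dl l))
   else if Z i || Z j then (fun t => PZ (GZ (sw i) (sw j) l t)) else (fun t => PY (GY i j l t)).
have ba : (b == a) = false by apply/eqP => h; apply: ab.
have pa : pos' a = (-1, 0) by rewrite /pos' eqxx.
have pb : pos' b = (1, 0) by rewrite /pos' ba eqxx.
have pZ v : Z v -> pos' v = PZ (posZ v).
  move=> Zv; rewrite /pos' Zv; case: eqP => [h|_]; first by move: Za; rewrite -h Zv.
  by case: eqP => // h; move: Zb; rewrite -h Zv.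
have pY v : Y v -> pos' v = PY (posY v).
  by rewrite /Y /pos' /= => /andP[/andP[/negbTE-> /negbTE->] /negbTE->].
have pSZ v : SZ v -> pos' v = PZ (posZ (sw v)).
  rewrite /SZ /= => /orP[/orP[Zv|/eqP->]|/eqP->].
  - by rewrite pZ // swZ.
  - by rewrite pa /PZ /sw eqxx; case: (fl); rewrite ?Za1 ?Zb1.
  - by rewrite pb /PZ /sw eqxx ba; case: (fl); rewrite ?Za1 ?Zb1 /= ?Ropp_involutive.
have pSY v : SY v -> pos' v = PY (posY v).
  rewrite /SY /= => /orP[/orP[Yv|/eqP->]|/eqP->]; first exact: pY.
    by rewrite pa Ya1 /PY /=; congr pair; ring.
  by rewrite pb Yb1 /PY /=; congr pair; ring.
have SZsw v : SZ v -> SZ (sw v).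
  rewrite /SZ /= => /orP[/orP[Zv|/eqP->]|/eqP->]; first by rewrite swZ // Zv.
    by case: swab => -[-> _]; rewrite eqxx ?orbT.
  by case: swab => -[_ ->]; rewrite eqxx ?orbT.
have edge i j l : i <> j -> (l < m' i j)%N ->
  [\/ isab i j /\ cls i j l = 2 + INR l,
      [/\ isab i j = false, Z i || Z j, cls i j l = 0, SZ i & SZ j] /\
        sw i <> sw j /\ (l < side_mult 'I_N m a b (sw i) (sw j))%N |
      [/\ isab i j = false, Z i || Z j = false, cls i j l = 1, SY i & SY j] /\
        (l < side_mult 'I_N m a b i j)%N].
  move=> ij hl; rewrite /cls; case hab : (isab i j); first by constructor 1.
  have sij : sw i <> sw j by move/(can_inj swK).
  case hz : (Z i || Z j); [constructor 2|constructor 3].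
    have key x y : Z x -> x <> y -> (l < m' x y)%N -> SZ y /\ (l < side_mult 'I_N m a b (sw x) (sw y))%N.
      move=> Zx xy hm.
      have nxa : (x == a) = false by apply/eqP => h; move: Za; rewrite -h Zx.
      have nxb : (x == b) = false by apply/eqP => h; move: Zb; rewrite -h Zx.
      rewrite /side_mult swZ // nxa nxb /=.
      case: (vcase y) => [ya|yb|Zy|Yy].
      - by subst y; rewrite /SZ /= eqxx orbT; split=> //; rewrite -(proj1 (mZab x Zx)).
      - by subst y; rewrite /SZ /= eqxx orbT; split=> //; rewrite -(proj2 (mZab x Zx)).
      - by rewrite /SZ /= Zy swZ // -mZ.
      - by rewrite mZY in hm.
    case/orP: (hz) => Zx.
      by have [k1 k2] := key i j Zx ij hl; split=> //; split=> //; rewrite /SZ /= Zx.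
    have [k1 k2] := key j i Zx (fun h => ij (esym h)) ltac:(by rewrite m'sym).
    split; first by split=> //; rewrite /SZ /= Zx.
    split=> //; move: k2; rewrite /side_mult msym.
    by rewrite orbC (andbC (sw j == b)) (andbC (sw j == a)).
  have [Zi Zj] : ~~ Z i /\ ~~ Z j by move/negbT: hz; rewrite negb_or => /andP[].
  have SYi v : ~~ Z v -> SY v.
    by move=> Zv; case: (vcase v) => [->|->|h|h]; rewrite /SY /= ?eqxx ?orbT ?h //; move: Zv; rewrite h.
  split; first by split=> //; apply: SYi.
  rewrite /side_mult -/(isab i j) hab.
  case: (vcase i) => [ia|ib|h|Yi]; [| |by move: Zi; rewrite h|by rewrite -mY].
  - case: (vcase j) => [ja|jb|h|Yj]; [by case: ij; rewrite ia ja| |by move: Zj; rewrite h|].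
      by move: hab; rewrite /isab ia jb !eqxx.
    by rewrite msym -mY // m'sym.
  - case: (vcase j) => [ja|jb|h|Yj]; [|by case: ij; rewrite ib jb|by move: Zj; rewrite h|].
      by move: hab; rewrite /isab ib ja !eqxx orbT.
    by rewrite msym -mY // m'sym.
have [_ [hZ [_ disjZ]]] := dZ; have [_ [hY [_ disjY]]] := dY.
have lensG i j l t : i <> j -> (l < m' i j)%N -> in01o t -> inlens (cls i j l) (G' i j l t).
  move=> ij hl to; rewrite /G'.
  case: (edge i j l ij hl) => [[e ->]|[[e1 e2 -> h1 h2] [h3 h4]]|[[e1 e2 -> h1 h2] h3]].
  - rewrite e; case: eqP => _; first exact: dl_lens.
    by apply: dl_lens; move: to; rewrite /in01o; lra.
  - by rewrite e1 e2; apply: lensPZ; apply: ZG => //; apply: SZsw.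
  - by rewrite e1 e2; apply: lensPY; apply: YG.
have posL v : [\/ v = a, v = b, (Z v /\ inlens 0 (pos' v)) | (Y v /\ inlens 1 (pos' v))].
  case: (vcase v) => h; [by constructor 1|by constructor 2|constructor 3|constructor 4].
    by rewrite pZ //; split=> //; apply: lensPZ; apply: ZL.
  by rewrite pY //; split=> //; apply: lensPY; apply: YL.
have [pinjZ _] := dZ; have [pinjY _] := dY.
have cdisj c c' p : inlens c p -> inlens c' p -> c' + 1 <= c -> False.
  by move=> h1 h2; have := inlens_disj _ _ _ h1 h2; move=> /Rabs_def2; lra.
have pinj : injective pos'.
  have sym u v : pos' u = pos' v -> (u = a \/ u = b) -> u = v.
    move=> h hu; case: (posL v) => [hv|hv|[hv L]|[hv L]].
    - by case: hu => hu; subst u v => //; move: h; rewrite pa pb => -[]; lra.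
    - by case: hu => hu; subst u v => //; move: h; rewrite pa pb => -[]; lra.
    - by exfalso; move: L; rewrite -h; case: hu => ->; rewrite ?pa ?pb; case: (inlens_end 0).
    - by exfalso; move: L; rewrite -h; case: hu => ->; rewrite ?pa ?pb; case: (inlens_end 1).
  move=> u v h; case: (posL u) => [hu|hu|[hu L]|[hu L]]; [by apply: sym => //; left|by apply: sym => //; right| |].
  - case: (posL v) => [hv|hv|[hv L']|[hv L']]; [by symmetry; apply: sym => //; left|by symmetry; apply: sym => //; right| |].
      have SZu : SZ u by rewrite /SZ /= hu.
      have SZv : SZ v by rewrite /SZ /= hv.
      by apply: pinjZ => //; apply: injPZ; rewrite -!pZ.
    by exfalso; rewrite h in L; apply: (cdisj _ _ _ L' L); lra.
  - case: (posL v) => [hv|hv|[hv L']|[hv L']]; [by symmetry; apply: sym => //; left|by symmetry; apply: sym => //; right| |].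
      by exfalso; rewrite h in L; apply: (cdisj _ _ _ L L'); lra.
    have SYu : SY u by rewrite /SY /= hu.
    have SYv : SY v by rewrite /SY /= hv.
    by apply: pinjY => //; apply: injPY; rewrite -!pY.
have arcs i j l : i <> j -> (l < m' i j)%N -> arc (G' i j l) /\ G' i j l 0 = pos' i /\ G' i j l 1 = pos' j.
  have d0 n : dl n 0 = (-1, 0) by rewrite /dl; congr pair; ring.
  have d1 n : dl n 1 = (1, 0) by rewrite /dl; congr pair; ring.
  move=> ij hl; rewrite /G'.
  case: (edge i j l ij hl) => [[e _]|[[e1 e2 _ h1 h2] [h3 h4]]|[[e1 e2 _ h1 h2] h3]].
  - rewrite e; case: eqP => ia.
      subst i; have -> : j = b by move: e; rewrite /isab eqxx (eq_sym a b) ba orbF /= => /eqP.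
      by rewrite pa pb; split; [exact: dl_arc|split].
    have [-> ->] : i = b /\ j = a.
      by move/orP: e => [/andP[/eqP]//|/andP[/eqP-> /eqP->]].
    rewrite pa pb; split; first exact: (rev_arc _ (dl_arc l)).
    by rewrite /rev Rminus_0_r Rminus_diag.
  - rewrite e1 e2; have [[cg ig] [g0 [g1 gv]]] := hZ (sw i) (sw j) l (SZsw _ h1) (SZsw _ h2) h3 h4.
    split; last by rewrite g0 g1 !pSZ.
    split; first exact: contpl_cont01.
    by move=> t t' t01 t'01 /injPZ; apply: ig.
  - rewrite e1 e2; have [[cg ig] [g0 [g1 gv]]] := hY i j l h1 h2 ij h3.
    split; last by rewrite g0 g1 !pSY.
    split; first exact: contpl_cont01.
    by move=> t t' t01 t'01 /injPY; apply: ig.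
have avoid i j l t v : i <> j -> (l < m' i j)%N -> in01o t -> G' i j l t <> pos' v.
  move=> ij hl to h; have L := lensG i j l t ij hl to; rewrite h in L.
  have INRl := pos_INR l.
  case: (posL v) => [hv|hv|[hv Lv]|[hv Lv]].
  - by move: L; rewrite hv pa; case: (inlens_end (cls i j l)).
  - by move: L; rewrite hv pb; case: (inlens_end (cls i j l)).
  - case: (edge i j l ij hl) => [[e c]|[[e1 e2 c h1 h2] [h3 h4]]|[[e1 e2 c h1 h2] h3]]; rewrite c in L.
    + by apply: (cdisj _ _ _ L Lv); lra.
    + have [_ [_ [_ gv]]] := hZ (sw i) (sw j) l (SZsw _ h1) (SZsw _ h2) h3 h4.
      apply: (gv t v to); first by rewrite /= hv.
      by apply: injPZ; rewrite -pZ // -h /G' e1 e2.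
    + by apply: (cdisj _ _ _ L Lv); lra.
  - case: (edge i j l ij hl) => [[e c]|[[e1 e2 c h1 h2] [h3 h4]]|[[e1 e2 c h1 h2] h3]]; rewrite c in L.
    + by apply: (cdisj _ _ _ L Lv); lra.
    + by apply: (cdisj _ _ _ Lv L); lra.
    + have [_ [_ [_ gv]]] := hY i j l h1 h2 ij h3.
      apply: (gv t v to); first by rewrite /= hv.
      by apply: injPY; rewrite -pY // -h /G' e1 e2.
exists pos', G'; split=> // i j l lt hl.
have ij : i <> j by move=> h; rewrite h ltnn in lt.
have [aG [G0 G1]] := arcs i j l ij hl; have [cG iG] := aG.
split; first exact/arc_continuousP.
do 3 (split=> //); split; first by move=> t to v; apply: avoid.
move=> i' j' l' lt' hl' ne t t' to t'o h; apply: ne.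
have ij' : i' <> j' by move=> h'; rewrite h' ltnn in lt'.
have fin (x y x' y' : 'I_N) : (x < y)%N -> (x' < y')%N -> (x = x' /\ y = y') \/ (x = y' /\ y = x') -> (x, y) = (x', y').
  by move=> q q' [[-> ->]//|[e1 e2]]; subst; have := ltn_trans q q'; rewrite ltnn.
have L := lensG i j l t ij hl to; have L' := lensG i' j' l' t' ij' hl' t'o; rewrite -h in L'.
have p1 := pos_INR l; have p2 := pos_INR l'.
case: (edge i j l ij hl) => [[e c]|[[e1 e2 c h1 h2] [h3 h4]]|[[e1 e2 c h1 h2] h3]];
case: (edge i' j' l' ij' hl') => [[e' c']|[[e1' e2' c' h1' h2'] [h3' h4']]|[[e1' e2' c' h1' h2'] h3']];
  rewrite c in L; rewrite c' in L'; try by exfalso; apply: (cdisj _ _ _ L L'); lra.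
all: try by exfalso; apply: (cdisj _ _ _ L' L); lra.
- have ll : l = l'.
    have := inlens_disj _ _ _ L L' => /Rabs_def2 [q1 q2].
    case: (ltngtP l l') => [q|q|//]; exfalso.
      by have := le_INR _ _ (elimT ssrnat.leP q); rewrite S_INR; lra.
    by have := le_INR _ _ (elimT ssrnat.leP q); rewrite S_INR; lra.
  subst l'; congr pair; apply: fin => //.
  by move/orP: e => [/andP[/eqP-> /eqP->]|/andP[/eqP-> /eqP->]];
     move/orP: e' => [/andP[/eqP-> /eqP->]|/andP[/eqP-> /eqP->]]; [left|right|right|left].
- move: h; rewrite /G' e1 e2 e1' e2' => /injPZ h.
  have [-> hs] := disjZ _ _ _ _ _ _ _ _ (SZsw _ h1) (SZsw _ h2) h3 h4 (SZsw _ h1') (SZsw _ h2') h3' h4' to t'o h.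
  congr pair; apply: fin => //.
  by case: hs => -[/(can_inj swK)-> /(can_inj swK)->]; [left|right].
- move: h; rewrite /G' e1 e2 e1' e2' => /injPY h.
  have [-> hs] := disjY _ _ _ _ _ _ _ _ h1 h2 ij h3 h1' h2' ij' h3' to t'o h.
  by congr pair; apply: fin.
Qed.

End GlueMain.
End Glue.

From mathcomp Require Import zify ring.
Local Open Scope ring_scope.

(** * Cuts and standard vectors *)

Section Dot.
Variable d : nat.
Implicit Types u v x : 'rV[int]_d.

Lemma dotC u v : dot u v = dot v u.
Proof. by apply: eq_bigr => i _; rewrite mulrC. Qed.
Lemma dotDl u v x : dot (u + v) x = dot u x + dot v x.
Proof. by rewrite /dot -big_split; apply: eq_bigr => i _; rewrite mxE mulrDl. Qed.
Lemma dotZl a u x : dot (a *: u) x = a * dot u x.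
Proof. by rewrite /dot mulr_sumr; apply: eq_bigr => i _; rewrite mxE mulrA. Qed.
Lemma dotNl u x : dot (- u) x = - dot u x.
Proof. by rewrite -scaleN1r dotZl mulN1r. Qed.
Lemma dot0l x : dot 0 x = 0.
Proof. by rewrite -(scale0r 0) dotZl mul0r. Qed.
Lemma dotDr u v x : dot x (u + v) = dot x u + dot x v.
Proof. by rewrite dotC dotDl !(dotC x). Qed.
Lemma dotZr a u x : dot x (a *: u) = a * dot x u.
Proof. by rewrite dotC dotZl (dotC x). Qed.
Lemma dotNr u x : dot x (- u) = - dot x u.
Proof. by rewrite dotC dotNl (dotC x). Qed.
Lemma dot0r x : dot x 0 = 0.
Proof. by rewrite dotC dot0l. Qed.
Lemma dot_suml (I : finType) (P : pred I) (F : I -> 'rV[int]_d) x :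
  dot (\sum_(i | P i) F i) x = \sum_(i | P i) dot (F i) x.
Proof. by apply: (big_morph (fun u => dot u x)) => [u v|]; rewrite ?dotDl ?dot0l. Qed.
Lemma dot_sumr (I : finType) (P : pred I) (F : I -> 'rV[int]_d) x :
  dot x (\sum_(i | P i) F i) = \sum_(i | P i) dot x (F i).
Proof. by rewrite dotC dot_suml; apply: eq_bigr => i _; rewrite dotC. Qed.
Lemma dot_eq0 u : dot u u = 0 -> u = 0.
Proof.
move=> h; apply/rowP => i; rewrite mxE.
have := h; rewrite /dot => /psumr_eq0P h'.
have /eqP := h' (fun j _ => ltac:(by rewrite -expr2 sqr_ge0)) i isT.
by rewrite mulf_eq0 orbb => /eqP.
Qed.
End Dot.

(** * The Gram form of a superbase as a graph Laplacian *)

Section GraphLattice.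
Variables (r n : nat) (B : 'I_n -> 'rV[int]_r).

Definition lincomb (f : 'I_n -> int) : 'rV[int]_r := \sum_i f i *: B i.
Definition weight (i j : 'I_n) : int := - dot (B i) (B j).
Definition indicator (R : {set 'I_n}) (i : 'I_n) : int := (i \in R)%:R.

Lemma lincombD f g : lincomb (fun i => f i + g i) = lincomb f + lincomb g.
Proof. by rewrite /lincomb -big_split; apply: eq_bigr => i _; rewrite scalerDl. Qed.
Lemma lincombZ a f : lincomb (fun i => a * f i) = a *: lincomb f.
Proof. by rewrite /lincomb scaler_sumr; apply: eq_bigr => i _; rewrite scalerA. Qed.
Lemma lincombN f : lincomb (fun i => - f i) = - lincomb f.
Proof. by rewrite -scaleN1r -lincombZ; apply: eq_bigr => i _; rewrite mulN1r. Qed.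
Lemma lincombB f g : lincomb (fun i => f i - g i) = lincomb f - lincomb g.
Proof. by rewrite lincombD lincombN. Qed.
Lemma eq_lincomb f g : f =1 g -> lincomb f = lincomb g.
Proof. by move=> h; apply: eq_bigr => i _; rewrite h. Qed.

Lemma weightC i j : weight i j = weight j i.
Proof. by rewrite /weight dotC. Qed.

Hypothesis B0 : \sum_i B i = 0.

Lemma lincomb_cst c : lincomb (fun=> c) = 0.
Proof. by rewrite /lincomb -scaler_sumr B0 scaler0. Qed.

(** Rows of the Gram matrix sum to zero because the superbase does. The factor 2 counts each edge in
    both orders, and the diagonal, where [weight] is not a number of edges, is multiplied by 0. *)
Lemma dot_lincomb f g : 2 * dot (lincomb f) (lincomb g) =
  \sum_i \sum_j weight i j * ((f i - f j) * (g i - g j)).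
Proof.
have row0 i : \sum_j weight i j = 0 by rewrite sumrN -dot_sumr B0 dot0r oppr0.
have e1 : dot (lincomb f) (lincomb g) = - \sum_i \sum_j weight i j * (f i * g j).
  rewrite /lincomb dot_suml -sumrN; apply: eq_bigr => i _.
  rewrite dot_sumr -sumrN; apply: eq_bigr => j _.
  by rewrite dotZl dotZr /weight; ring.
have e2 : \sum_i \sum_j weight i j * (f i * g i) = 0.
  by apply: big1 => i _; rewrite -mulr_suml row0 mul0r.
have e3 : \sum_i \sum_j weight i j * (f j * g j) = 0.
  rewrite exchange_big -[RHS]e2; apply: eq_bigr => i _; apply: eq_bigr => j _.
  by rewrite weightC.
have e4 : \sum_i \sum_j weight i j * (f j * g i) = \sum_i \sum_j weight i j * (f i * g j).
  rewrite exchange_big; apply: eq_bigr => i _; apply: eq_bigr => j _.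
  by rewrite weightC.
have -> : \sum_i \sum_j weight i j * ((f i - f j) * (g i - g j)) =
   \sum_i \sum_j weight i j * (f i * g i) + \sum_i \sum_j weight i j * (f j * g j)
   - \sum_i \sum_j weight i j * (f j * g i) - \sum_i \sum_j weight i j * (f i * g j).
  rewrite -big_split -!sumrB; apply: eq_bigr => i _.
  rewrite -big_split -!sumrB; apply: eq_bigr => j _ /=; ring.
by rewrite e2 e3 e4 e1; ring.
Qed.

Hypothesis obt : forall i j, i != j -> dot (B i) (B j) <= 0.

Lemma weight_ge0 i j : i != j -> 0 <= weight i j.
Proof. by move=> /obt; rewrite /weight oppr_ge0. Qed.

Lemma dot_lincomb_ge0 f g :
  (forall i j, 0 < weight i j -> 0 <= (f i - f j) * (g i - g j)) -> 0 <= dot (lincomb f) (lincomb g).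
Proof.
move=> h; suff : 0 <= 2 * dot (lincomb f) (lincomb g) by lia.
rewrite dot_lincomb; apply: sumr_ge0 => i _; apply: sumr_ge0 => j _.
have [->|ij] := eqVneq i j; first by rewrite subrr mul0r mulr0.
by have := weight_ge0 _ _ ij; rewrite le_eqVlt => /orP[/eqP<-|w0];
  rewrite ?mul0r // mulr_ge0 ?h // ltW.
Qed.

Lemma dot_lincomb_gt0 f g i j :
  (forall i j, 0 < weight i j -> 0 <= (f i - f j) * (g i - g j)) ->
  0 < weight i j -> 0 < (f i - f j) * (g i - g j) -> 0 < dot (lincomb f) (lincomb g).
Proof.
move=> h w0 p0; suff : 0 < 2 * dot (lincomb f) (lincomb g) by lia.
have nn i' j' : 0 <= weight i' j' * ((f i' - f j') * (g i' - g j')).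
  have [->|ij'] := eqVneq i' j'; first by rewrite subrr mul0r mulr0.
  by have := weight_ge0 _ _ ij'; rewrite le_eqVlt => /orP[/eqP<-|w0'];
    rewrite ?mul0r // mulr_ge0 ?h // ltW.
rewrite dot_lincomb (bigD1 i) //= (bigD1 j) //=.
have p1 : 0 < weight i j * ((f i - f j) * (g i - g j)) by apply: mulr_gt0.
rewrite ltr_wpDr ?ltr_wpDr // sumr_ge0 // => i' _.
exact: sumr_ge0.
Qed.

End GraphLattice.

(** * Irreducibility of standard vectors *)

Section Standard.
Variables (r : nat) (s : 'rV[int]_r).
Hypothesis spos : forall i, 0 < s 0 i.

Lemma orth_ge0 x : dot x s = 0 -> (forall i, 0 <= x 0 i) -> x = 0.
Proof.
move=> /psumr_eq0P h x0; apply/rowP => i; rewrite mxE.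
have h' := h (fun j _ => mulr_ge0 (x0 j) (ltW (spos j))) i isT.
by apply/eqP; move/eqP: h'; rewrite mulf_eq0 (gt_eqF (spos i)) orbF.
Qed.

Definition stdv (A : {set 'I_r}) (k : 'I_r) : 'rV[int]_r :=
  \row_i ((i \in A)%:R - (i == k)%:R).

Definition is_std (A : {set 'I_r}) (k : 'I_r) : Prop :=
  k \notin A /\ \sum_(i in A) s 0 i = s 0 k.

Lemma dot_stdv A k x : dot (stdv A k) x = \sum_(i in A) x 0 i - x 0 k.
Proof.
rewrite /dot; transitivity (\sum_i ((i \in A)%:R * x 0 i - (i == k)%:R * x 0 i)).
  by apply: eq_bigr => i _; rewrite mxE mulrBl.
rewrite sumrB; congr (_ - _).
  by rewrite [RHS]big_mkcond; apply: eq_bigr => i _; case: (i \in A); rewrite ?mul1r ?mul0r.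
rewrite (bigD1 k) //= eqxx mul1r big1 ?addr0 // => i /negbTE->; exact: mul0r.
Qed.

Lemma stdv_orth A k : is_std A k -> dot (stdv A k) s = 0.
Proof. by move=> [_ h]; rewrite dot_stdv h subrr. Qed.

(** The coordinates of [stdv A k] are -1, 0 or 1, so integers adding up to them have product at most
    0; a nonnegative pairing makes all products vanish. Whichever of [x], [y] is zero at [k] then
    has no negative coordinate, and [orth_ge0] kills it. *)
Lemma stdv_irr A k x y : is_std A k -> dot x s = 0 -> dot y s = 0 ->
  stdv A k = x + y -> 0 <= dot x y -> x = 0 \/ y = 0.
Proof.
move=> [kA _] xs ys e xy0.
have co i : ((i \in A)%:R - (i == k)%:R : int) = x 0 i + y 0 i.
  by have := congr1 (fun z : 'rV_r => z 0 i) e; rewrite !mxE.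
have np i : x 0 i * y 0 i <= 0.
  by have := co i; case: (i \in A); case: (i == k) => /= h; nia.
have z : dot x y = 0 by apply/eqP; rewrite eq_le xy0 andbT; apply: sumr_le0.
have z' i : x 0 i * y 0 i = 0.
  have /eqP : - dot x y = 0 by rewrite z oppr0.
  rewrite /dot -sumrN => /eqP/psumr_eq0P h; have := h _ i isT => h'.
  by apply/eqP; rewrite -oppr_eq0 h' // => j _; rewrite oppr_ge0.
have key u v : (forall i, ((i \in A)%:R - (i == k)%:R : int) = u 0 i + v 0 i) ->
    (forall i, u 0 i * v 0 i = 0) -> u 0 k = 0 -> forall i, 0 <= u 0 i.
  move=> hco huv uk i; have := hco i; have := huv i.
  have [->|ik] := eqVneq i k; first by rewrite uk.
  by case: (i \in A) => /= h1 h2; nia.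
have := z' k => /eqP; rewrite mulf_eq0 => /orP[/eqP h|/eqP h].
  by left; apply: orth_ge0 => //; exact: key h.
by right; apply: orth_ge0 => //; apply: key h => i; [rewrite co addrC|rewrite mulrC].
Qed.

End Standard.

Lemma mul_opposite (p q c : int) : p * c < 0 -> 0 < q * c -> p * q < 0.
Proof.
move=> pc qc; have : p * c * (q * c) < 0 by rewrite pmulr_llt0.
rewrite mulrACA => h; have : 0 <= c * c by rewrite -expr2 sqr_ge0.
by case: (ltP (p * q) 0) => // ? ?; move: h; rewrite ltNge mulr_ge0.
Qed.

Lemma rowD d (u v : 'rV[int]_d) i : (u + v) 0 i = u 0 i + v 0 i.
Proof. by rewrite mxE. Qed.
Lemma rowZ d a (v : 'rV[int]_d) i : (a *: v) 0 i = a * v 0 i.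
Proof. by rewrite mxE. Qed.

(** * Standard vectors as cuts, and the two colours *)

Section Cuts.
Variables (r n : nat) (s : 'rV[int]_r) (B : 'I_n -> 'rV[int]_r).
Hypothesis spos : forall i, 0 < s 0 i.
Hypothesis BL : forall i, dot (B i) s = 0.
Hypothesis Bspan : forall v, dot v s = 0 -> exists f, v = lincomb r n B f.
Hypothesis B0 : \sum_i B i = 0.
Hypothesis obt : forall i j, i != j -> dot (B i) (B j) <= 0.
Hypothesis Bker : forall f, lincomb r n B f = 0 -> forall i j, f i = f j.

Notation Phi := (lincomb r n B).
Notation ind := (indicator n).
Notation wt := (weight r n B).
Notation stdv := (stdv r).
Notation is_std := (is_std r s).

Lemma lincomb_orth f : dot (Phi f) s = 0.
Proof. by rewrite /lincomb dot_suml big1 // => i _; rewrite dotZl BL mulr0. Qed.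

Lemma ker_diff f g : Phi f = Phi g -> forall i j, f i - f j = g i - g j.
Proof.
move=> h i j; have := Bker (fun i => f i - g i).
by rewrite lincombB h subrr => /(_ erefl i j); lia.
Qed.

Lemma stdv_neq0 (A : {set 'I_r}) k : k \notin A -> stdv A k <> 0.
Proof.
by move=> kA /rowP/(_ k); rewrite !mxE (negbTE kA) eqxx.
Qed.

(** The top level set of a coefficient function is split off. The remainder has nonnegative pairing
    with it, so irreducibility leaves only one of the two, and it must be the indicator. *)
Lemma std_ind A k : is_std A k -> exists R, stdv A k = Phi (ind R).
Proof.
move=> st; have [f hf] := Bspan _ (stdv_orth _ _ _ _ st).
have [nz _] := st.
have [i0 _|no] := pickP (@predT 'I_n); last first.
  case: (stdv_neq0 _ _ nz); rewrite hf /lincomb big1 // => i; by have := no i.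
have [m _ hm] := Order.TotalTheory.arg_maxP f (isT : xpredT i0).
pose R := [set i | f i == f m]; exists R.
have Rin i : (i \in R) = (f i == f m) by rewrite inE.
have e : stdv A k = Phi (ind R) + Phi (fun i => f i - ind R i).
  by rewrite -lincombD hf; apply: eq_lincomb => i; rewrite /indicator; lia.
have h : 0 <= dot (Phi (ind R)) (Phi (fun i => f i - ind R i)).
  apply: dot_lincomb_ge0 => // i j _; rewrite /indicator !Rin.
  have := hm i isT; have := hm j isT.
  by case: eqP => h1; case: eqP => h2 /=; nia.
have [x0|y0] := stdv_irr _ _ spos _ _ _ _ st (lincomb_orth _) (lincomb_orth _) e h.
  case: (stdv_neq0 _ _ nz); rewrite hf (eq_lincomb _ _ _ f (fun=> f m)); first exact: lincomb_cst.
  move=> i; apply/eqP; rewrite -Rin; have := Bker _ x0 i m.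
  by rewrite /indicator (Rin m) eqxx; case: (i \in R).
by rewrite e y0 addr0.
Qed.

(* With [U, U'] spanned by [R :&: R', R :|: R'] and [D, D'] by [R :\: R', R' :\: R], two edges of
   opposite signs would make [U . U' > 0] and [D . D' < 0]; comparing coordinates of
   [stdv A k +- stdv A' l] shows that this is impossible. *)
Lemma sign_consistent A k R A' l R' i j i' j' :
  is_std A k -> is_std A' l -> k != l ->
  stdv A k = Phi (ind R) -> stdv A' l = Phi (ind R') ->
  0 < wt i j -> 0 < (ind R i - ind R j) * (ind R' i - ind R' j) ->
  0 < wt i' j' -> (ind R i' - ind R j') * (ind R' i' - ind R' j') < 0 -> False.
Proof.
move=> st st' kl eR eR' w1 h1 w2 h2.
have [kA sA] := st; have [lA' sA'] := st'.
pose U := Phi (ind (R :&: R')); pose U' := Phi (ind (R :|: R')).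
pose D := Phi (ind (R :\: R')); pose D' := Phi (ind (R' :\: R)).
have sumE : stdv A k + stdv A' l = U + U'.
  by rewrite eR eR' -!lincombD; apply: eq_lincomb => x; rewrite /indicator !inE; case: (x \in R); case: (x \in R').
have difE : stdv A k - stdv A' l = D - D'.
  by rewrite eR eR' -!lincombB; apply: eq_lincomb => x; rewrite /indicator !inE; case: (x \in R); case: (x \in R').
have posU : 0 < dot U U'.
  apply: (dot_lincomb_gt0 _ _ _ B0 obt _ _ i j _ w1) => [x y _|]; rewrite /indicator in h1 *;
    rewrite !inE.
    by case: (x \in R); case: (x \in R'); case: (y \in R); case: (y \in R').
  by move: h1; case: (i \in R); case: (i \in R'); case: (j \in R); case: (j \in R').
have negD : 0 < - dot D D'.
  rewrite -dotNr -lincombN.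
  apply: (dot_lincomb_gt0 _ _ _ B0 obt _ _ i' j' _ w2) => [x y _|]; rewrite /indicator in h2 *;
    rewrite !inE.
    by case: (x \in R); case: (x \in R'); case: (y \in R); case: (y \in R').
  by move: h2; case: (i' \in R); case: (i' \in R'); case: (j' \in R); case: (j' \in R').
have coS c : ((c \in A)%:R - (c == k)%:R + ((c \in A')%:R - (c == l)%:R) : int) = U 0 c + U' 0 c.
  by have := congr1 (fun z : 'rV_r => z 0 c) sumE; rewrite !mxE.
have coD c : ((c \in A)%:R - (c == k)%:R - ((c \in A')%:R - (c == l)%:R) : int) = D 0 c - D' 0 c.
  by have := congr1 (fun z : 'rV_r => z 0 c) difE; rewrite !mxE.
(* [p] and [q] are the coordinatewise maxima of [U U'] and [- D D'], given that [U + U'] and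
   [D - D'] have entries between -2 and 2. *)
pose p c : int := ((c \in A) && (c \in A'))%:R.
pose q c : int := ((c == k) && (k \in A'))%:R + ((c == l) && (l \in A))%:R.
have kl' : (k == l) = false by apply: negbTE.
have Up c : U 0 c * U' 0 c <= p c.
  have := coS c; rewrite /p.
  have [->|ck] := eqVneq c k.
    by rewrite (negbTE kA) kl' /=; case: (k \in A') => /=; nia.
  have [->|cl] := eqVneq c l.
    by rewrite (negbTE lA') /=; case: (l \in A) => /=; nia.
  by case: (c \in A); case: (c \in A') => /=; nia.
have Dq c : - (D 0 c * D' 0 c) <= q c.
  have := coD c; rewrite /q.
  have [->|ck] := eqVneq c k.
    by rewrite (negbTE kA) kl' /=; case: (k \in A') => /=; nia.
  have [->|cl] := eqVneq c l.
    by rewrite (negbTE lA') /=; case: (l \in A) => /=; nia.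
  by case: (c \in A); case: (c \in A') => /=; nia.
have qDD : \sum_c (q c + D 0 c * D' 0 c) = \sum_c q c + dot D D' by exact: big_split.
have tot : \sum_c (p c - U 0 c * U' 0 c) = \sum_c (q c + D 0 c * D' 0 c).
  have e1 : dot (stdv A k) (stdv A' l) = \sum_c p c - \sum_c q c.
    rewrite -sumrB; apply: eq_bigr => c _; rewrite !mxE /p /q.
    have [->|ck] := eqVneq c k.
      by rewrite (negbTE kA) kl' /=; case: (k \in A').
    have [->|cl] := eqVneq c l.
      by rewrite (negbTE lA') /=; case: (l \in A).
    by case: (c \in A); case: (c \in A').
  suff : dot (stdv A k) (stdv A' l) = dot U U' + dot D D'.
    rewrite e1 sumrB qDD -/(dot U U').
    by move: (\sum_c p c) (\sum_c q c) (dot U U') (dot D D') => x y z t; lia.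
  have e2 : stdv A k = U + D.
    by rewrite eR -lincombD; apply: eq_lincomb => x; rewrite /indicator !inE; case: (x \in R); case: (x \in R').
  have e3 : stdv A' l = U + D'.
    by rewrite eR' -lincombD; apply: eq_lincomb => x; rewrite /indicator !inE; case: (x \in R); case: (x \in R').
  have e4 : U' = U + D + D'.
    by rewrite -!lincombD; apply: eq_lincomb => x; rewrite /indicator !inE; case: (x \in R); case: (x \in R').
  by rewrite e2 e3 e4 !(dotDl, dotDr) (dotC _ D U); ring.
have sq : \sum_c q c = (k \in A')%:R + (l \in A)%:R.
  rewrite big_split /= (bigD1 k) //= eqxx big1 => [|c /negbTE->//].
  by rewrite (bigD1 l) //= eqxx big1 => [|c /negbTE->//]; rewrite !addr0.
have sDD : \sum_c (q c + D 0 c * D' 0 c) = (k \in A')%:R + (l \in A)%:R + dot D D'.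
  by rewrite qDD sq.
have sUU : \sum_c (p c - U 0 c * U' 0 c) = \sum_c p c - dot U U' by rewrite sumrB.
have spos' (C : {set 'I_r}) c : c \in C -> s 0 c <= \sum_(x in C) s 0 x.
  by move=> cC; rewrite (bigD1 c) //= lerDl sumr_ge0 // => x _; apply: ltW.
(* Both sums in [tot] have nonnegative terms. If both memberships hold, [A] reduces to [l] and [p]
   vanishes, against [posU]. If just one holds, [dot D D' = -1] and [U U' = p] in each coordinate,
   so [U] or [U'] is nonnegative and hence 0. If none holds, [dot D D'] is nonnegative. *)
case kA' : (k \in A'); case lA : (l \in A).
- have e0 : \sum_(x in A | x != l) s 0 x = 0.
    have a1 := spos' A l lA; have a2 := spos' A' k kA'.
    rewrite sA in a1; rewrite sA' in a2.
    have := sA; rewrite (bigD1 l lA) /=.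
    have : 0 <= \sum_(x in A | x != l) s 0 x by apply: sumr_ge0 => x _; apply: ltW.
    by move: (\sum_(x in A | x != l) _) => X; lia.
  have p0 c : p c = 0.
    rewrite /p; case cA : (c \in A) => //=; have [->|cl] := eqVneq c l; first by rewrite (negbTE lA').
    move/psumr_eq0P: e0 => h; have := h (fun x _ => ltW (spos x)) c; rewrite cA cl => /(_ isT).
    by have := spos c; lia.
  have : dot U U' <= 0 by apply: sumr_le0 => c _; rewrite -(p0 c); apply: Up.
  by lia.
- have UUp c : U 0 c * U' 0 c = p c.
    have z : \sum_c (p c - U 0 c * U' 0 c) = 0.
      have : 0 <= \sum_c (p c - U 0 c * U' 0 c) by apply: sumr_ge0 => x _; rewrite subr_ge0.
      by rewrite tot sDD kA' lA /=; lia.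
    move/psumr_eq0P: z => h; have := h (fun x _ => ltac:(by rewrite subr_ge0)) c isT; lia.
  have fin u v : (forall c, ((c \in A)%:R - (c == k)%:R + ((c \in A')%:R - (c == l)%:R) : int) = u 0 c + v 0 c) ->
      (forall c, u 0 c * v 0 c = p c) -> 0 <= u 0 l -> forall c, 0 <= u 0 c.
    move=> hc hu ul c; have := hc c; have := hu c; rewrite /p.
    have [->|cl] := eqVneq c l; first by [].
    have [->|ck] := eqVneq c k.
      by rewrite (negbTE kA) kA' /=; nia.
    by case: (c \in A); case: (c \in A') => /=; nia.
  case: (ltP (U 0 l) 0) => ul.
    have : U' = 0.
      apply: (orth_ge0 _ s) => //; first exact: lincomb_orth.
      apply: fin => [c|c|]; [by rewrite coS addrC|by rewrite mulrC|].
      by have := coS l; have := UUp l; rewrite /p eq_sym kl' eqxx lA (negbTE lA') /=; nia.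
    by move=> h; rewrite h dot0r in posU.
  have : U = 0 by apply: (orth_ge0 _ s) => //; [exact: lincomb_orth|exact: fin].
  by move=> h; rewrite h dot0l in posU.
- have UUp c : U 0 c * U' 0 c = p c.
    have z : \sum_c (p c - U 0 c * U' 0 c) = 0.
      have : 0 <= \sum_c (p c - U 0 c * U' 0 c) by apply: sumr_ge0 => x _; rewrite subr_ge0.
      by rewrite tot sDD kA' lA /=; lia.
    move/psumr_eq0P: z => h; have := h (fun x _ => ltac:(by rewrite subr_ge0)) c isT; lia.
  have fin u v : (forall c, ((c \in A)%:R - (c == k)%:R + ((c \in A')%:R - (c == l)%:R) : int) = u 0 c + v 0 c) ->
      (forall c, u 0 c * v 0 c = p c) -> 0 <= u 0 k -> forall c, 0 <= u 0 c.
    move=> hc hu uk c; have := hc c; have := hu c; rewrite /p.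
    have [->|ck] := eqVneq c k; first by [].
    have [->|cl] := eqVneq c l.
      by rewrite (negbTE lA') lA /=; nia.
    by case: (c \in A); case: (c \in A') => /=; nia.
  case: (ltP (U 0 k) 0) => uk.
    have : U' = 0.
      apply: (orth_ge0 _ s) => //; first exact: lincomb_orth.
      apply: fin => [c|c|]; [by rewrite coS addrC|by rewrite mulrC|].
      by have := coS k; have := UUp k; rewrite /p kl' eqxx kA' (negbTE kA) /=; nia.
    by move=> h; rewrite h dot0r in posU.
  have : U = 0 by apply: (orth_ge0 _ s) => //; [exact: lincomb_orth|exact: fin].
  by move=> h; rewrite h dot0l in posU.
- have : 0 <= \sum_c (p c - U 0 c * U' 0 c) by apply: sumr_ge0 => x _; rewrite subr_ge0.
  by rewrite tot sDD kA' lA /=; lia.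
Qed.

(** By [std_ind], the default [set0] is never taken for a standard pair. *)
Definition cutset (A : {set 'I_r}) (k : 'I_r) : {set 'I_n} :=
  odflt set0 [pick R | stdv A k == Phi (ind R)].
Definition chi A k : 'I_n -> int := ind (cutset A k).
Definition jump A k i j : int := chi A k i - chi A k j.

Lemma chiE A k : is_std A k -> stdv A k = Phi (chi A k).
Proof.
move=> /std_ind[R hR]; rewrite /chi /cutset; case: pickP => [R' /eqP //|/(_ R)].
by rewrite hR eqxx.
Qed.

Lemma chi01 A k i : chi A k i = 0 \/ chi A k i = 1.
Proof. by rewrite /chi /indicator; case: (i \in _); [right|left]. Qed.

Lemma jump_consistent A k A' l i j i' j' : is_std A k -> is_std A' l -> k != l ->
  0 < wt i j -> 0 < jump A k i j * jump A' l i j ->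
  0 < wt i' j' -> 0 <= jump A k i' j' * jump A' l i' j'.
Proof.
move=> st st' kl w h w'; rewrite leNgt; apply/negP => h'.
exact: (sign_consistent _ _ _ _ _ _ _ _ _ _ st st' kl (chiE _ _ st) (chiE _ _ st') w h w' h').
Qed.

Lemma jump_pos A k A' l : is_std A k -> is_std A' l ->
  0 < dot (stdv A k) (stdv A' l) ->
  exists i j, 0 < wt i j /\ 0 < jump A k i j * jump A' l i j.
Proof.
move=> st st' h.
have [/existsP[i /existsP[j /andP[w p]]]|/existsPn hn] :=
  boolP [exists i, exists j, (0 < wt i j) && (0 < jump A k i j * jump A' l i j)].
  by exists i, j.
have : 0 <= - dot (stdv A k) (stdv A' l); last by lia.
rewrite (chiE _ _ st) (chiE _ _ st') -dotNr -lincombN; apply: dot_lincomb_ge0 => // i j w.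
have /existsPn/(_ j) := hn i; rewrite w /= -leNgt /jump; lia.
Qed.

Lemma jump_neg A k A' l : is_std A k -> is_std A' l ->
  dot (stdv A k) (stdv A' l) < 0 ->
  exists i j, 0 < wt i j /\ jump A k i j * jump A' l i j < 0.
Proof.
move=> st st' h.
have [/existsP[i /existsP[j /andP[w p]]]|/existsPn hn] :=
  boolP [exists i, exists j, (0 < wt i j) && (jump A k i j * jump A' l i j < 0)].
  by exists i, j.
have : 0 <= dot (stdv A k) (stdv A' l); last by lia.
rewrite (chiE _ _ st) (chiE _ _ st'); apply: dot_lincomb_ge0 => // i j w.
by have /existsPn/(_ j) := hn i; rewrite w /= -leNgt /jump.
Qed.

(** By [jump_consistent] all products of jumps of two standard vectors have the same sign, so their
    weighted sum vanishes only termwise. *)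
Lemma jump_orth A k A' l i j : is_std A k -> is_std A' l -> k != l ->
  dot (stdv A k) (stdv A' l) = 0 -> 0 < wt i j -> jump A k i j * jump A' l i j = 0.
Proof.
move=> st st' kl z w.
case: (ltgtP (jump A k i j * jump A' l i j) 0) => // h; exfalso.
  have : 0 < dot (Phi (chi A k)) (Phi (fun x => - chi A' l x)).
    apply: (dot_lincomb_gt0 _ _ _ B0 obt _ _ i j _ w) => [x y wxy|]; last by move: h; rewrite /jump; lia.
    have [p|] := ltP 0 (jump A k x y * jump A' l x y); last by rewrite /jump; lia.
    by have := jump_consistent _ _ _ _ _ _ _ _ st st' kl wxy p w; lia.
  by rewrite lincombN dotNr -(chiE _ _ st) -(chiE _ _ st') z.
have : 0 < dot (Phi (chi A k)) (Phi (chi A' l)).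
  apply: (dot_lincomb_gt0 _ _ _ B0 obt _ _ i j _ w) => // x y wxy.
  exact: (jump_consistent _ _ _ _ _ _ _ _ st st' kl w h wxy).
by rewrite -(chiE _ _ st) -(chiE _ _ st') z.
Qed.

Variables o0 o1 o2 : 'I_r.
Hypotheses (o0E : o0 = 0%N :> nat) (o1E : o1 = 1%N :> nat) (o2E : o2 = 2%N :> nat).
Hypotheses (s0 : s 0 o0 = 1) (s1 : s 0 o1 = 1) (s2 : s 0 o2 = 1).

Let o01 : o0 != o1. Proof. by rewrite -val_eqE /= o0E o1E. Qed.
Let o02 : o0 != o2. Proof. by rewrite -val_eqE /= o0E o2E. Qed.
Let o12 : o1 != o2. Proof. by rewrite -val_eqE /= o1E o2E. Qed.

Notation fu i j := (stdv [set i] j).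

Lemma std_unit i j : s 0 i = 1 -> s 0 j = 1 -> i != j -> is_std [set i] j.
Proof. by move=> si sj ij; split; rewrite ?big_set1 ?si ?sj // inE eq_sym. Qed.

Lemma dot_fu i j x : dot (fu i j) x = x 0 i - x 0 j.
Proof. by rewrite dot_stdv big_set1. Qed.

Lemma jump_chasles i j k x y : s 0 i = 1 -> s 0 j = 1 -> s 0 k = 1 -> i != j -> j != k -> i != k ->
  jump [set i] k x y = jump [set i] j x y + jump [set j] k x y.
Proof.
move=> si sj sk ij jk ik.
have e : Phi (chi [set i] k) = Phi (fun v => chi [set i] j v + chi [set j] k v).
  rewrite lincombD -!chiE; try exact: std_unit.
  by apply/rowP => c; rewrite !mxE !inE; ring.
by have := ker_diff _ _ e x y; rewrite /jump; lia.
Qed.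

(** Some edge is crossed by both [stdv A k] and [e_i - e_p]. There [e_i - e_j] and [e_p - e_q] do
    not jump, being orthogonal to [stdv A k]; so [e_i - e_p] and [e_j - e_q] jump together although
    they are orthogonal. *)
Lemma unit_split A k i j p q : is_std A k -> 1 < s 0 k ->
  s 0 i = 1 -> s 0 j = 1 -> s 0 p = 1 -> s 0 q = 1 -> i != j -> p != q ->
  i \in A -> j \in A -> p \notin A -> q \notin A -> False.
Proof.
move=> st sk si sj sp sq ij pq iA jA pA qA.
have ip : i != p by apply: contraNneq pA => <-.
have iq : i != q by apply: contraNneq qA => <-.
have jp : j != p by apply: contraNneq pA => <-.
have jq : j != q by apply: contraNneq qA => <-.
have ku u : s 0 u = 1 -> k != u by move=> su; apply: contraTneq sk => ->; rewrite su.
have z u : (stdv A k) 0 u = (u \in A)%:R - (u == k)%:R by rewrite mxE.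
have nk u : s 0 u = 1 -> (u == k) = false by move/ku; rewrite eq_sym => /negbTE.
have st1 := std_unit i p si sp ip.
have dA u v : s 0 u = 1 -> s 0 v = 1 -> dot (stdv A k) (fu u v) = (u \in A)%:R - (v \in A)%:R.
  by move=> su sv; rewrite dotC dot_fu !z !nk // !subr0.
have [x [y [w h]]] := jump_pos A k [set i] p st st1 ltac:(by rewrite dA // iA (negbTE pA)).
have zz u v : s 0 u = 1 -> s 0 v = 1 -> u != v -> (u \in A) = (v \in A) -> jump [set u] v x y = 0.
  move=> su sv uv e; have := jump_orth A k [set u] v x y st (std_unit u v su sv uv) (ku v sv).
  rewrite dA // e subrr => /(_ erefl w) /eqP; rewrite mulf_eq0 => /orP[/eqP h0|/eqP //].
  by move: h; rewrite h0 mul0r.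
have nz : jump [set i] p x y != 0 by apply: contraTneq h => ->; rewrite mulr0.
have e1 := jump_chasles i j p x y si sj sp ij jp ip.
have e2 := jump_chasles j p q x y sj sp sq jp pq jq.
have e3 := zz i j si sj ij ltac:(by rewrite iA jA).
have e4 := zz p q sp sq pq ltac:(by rewrite (negbTE pA) (negbTE qA)).
have := jump_orth [set i] p [set j] q x y st1 (std_unit j q sj sq jq) pq.
rewrite dot_fu !mxE !inE (negbTE ij) (negbTE iq) (negbTE pq) (eq_sym p) (negbTE jp) !subr0.
rewrite e3 add0r in e1; rewrite e2 e4 addr0 -e1.
by move=> /(_ erefl w) /eqP; rewrite mulf_eq0 orbb (negbTE nz).
Qed.

Variable Ak : 'I_r -> {set 'I_r}.
Hypothesis Astd : forall k, 1 < s 0 k ->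
  [/\ is_std (Ak k) k, o1 \in Ak k, o0 \notin Ak k & forall i, i \in Ak k -> (i < k)%N].
Variable k0 : 'I_r.
Hypotheses (k0st : 1 < s 0 k0) (k0unit : forall i, i \in Ak k0 -> s 0 i = 1).

(** Since [Ak k] contains [o1] but not [o0], [unit_split] leaves two possibilities: all units except
    [o0], or [o1] alone. Membership of [o2] tells them apart. *)
Let typ (k : 'I_r) : bool := (1 < s 0 k) && (o2 \in Ak k).

Let unit_or k : s 0 k = 1 \/ 1 < s 0 k.
Proof. by have := spos k; case: (ltP 1 (s 0 k)); [right|left; lia]. Qed.

Let typ_units k u : typ k -> s 0 u = 1 -> u != o0 -> u \in Ak k.
Proof.
move=> /andP[sk o2k] su u0; have [st o1k o0k _] := Astd k sk.
by apply/negPn/negP => nu; exact: (unit_split (Ak k) k o1 o2 u o0).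
Qed.

Let ntyp_units k u : 1 < s 0 k -> ~~ typ k -> s 0 u = 1 -> u \in Ak k -> u = o1.
Proof.
move=> sk; rewrite /typ sk /= => o2k su uk; have [st o1k o0k _] := Astd k sk.
apply/eqP/negPn/negP => nu; apply: (unit_split (Ak k) k u o1 o2 o0) => //.
by rewrite eq_sym.
Qed.

Let typ_k0 : typ k0.
Proof.
rewrite /typ k0st /=; apply/negPn/negP => o2k; have [[_ sk] o1k _ _] := Astd k0 k0st.
have : \sum_(i in Ak k0) s 0 i = 1.
  rewrite (bigD1 o1) //= big1 ?addr0 // => i /andP[ik io1].
  have := ntyp_units k0 i k0st _ (k0unit i ik) ik; rewrite /typ k0st /= => /(_ o2k) h.
  by rewrite h eqxx in io1.
by rewrite sk; move: k0st; lia.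
Qed.

(** Unit indices get the vector [e_1 - e_k], so that every index above 1 carries a generator with
    vanishing first coordinate. *)
Let gA k : {set 'I_r} := if 1 < s 0 k then Ak k else [set o1].
Let gen k := stdv (gA k) k.
Let big_idx (k : 'I_r) := (1 < k)%N.

Let big_neq k : big_idx k -> k != o0 /\ k != o1.
Proof. by rewrite /big_idx -!val_eqE /= o0E o1E; lia. Qed.

Let gstd k : big_idx k -> is_std (gA k) k.
Proof.
move=> kb; rewrite /gA; case: ifP => sk; first by case: (Astd k sk).
apply: std_unit => //; last by rewrite eq_sym; case: (big_neq k kb).
by case: (unit_or k) => // h; rewrite h in sk.
Qed.

Let gen_o0 k : big_idx k -> gen k 0 o0 = 0.
Proof.
move=> kb; have [k0' k1'] := big_neq k kb; rewrite mxE (eq_sym o0) (negbTE k0') subr0.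
rewrite /gA; case: ifP => sk; first by case: (Astd k sk) => _ _ /negbTE->.
by rewrite inE (negbTE o01).
Qed.

Let typ_stable k : typ k -> 1 < s 0 k. Proof. by case/andP. Qed.

Let gen_typ k u : typ k -> s 0 u = 1 -> u != o0 -> gen k 0 u = 1.
Proof.
move=> tk su u0; have sk := typ_stable k tk; rewrite mxE /gA sk (typ_units k u) //.
have -> : (u == k) = false by apply/negbTE; apply: contraTneq sk => <-; rewrite su.
by rewrite subr0.
Qed.

Let gen_ntyp k : big_idx k -> ~~ typ k -> 1 < s 0 k ->
  forall u, s 0 u = 1 -> gen k 0 u = (u == o1)%:R.
Proof.
move=> kb tk sk u su; rewrite mxE /gA sk.
have -> : (u == k) = false by apply/negbTE; apply: contraTneq sk => <-; rewrite su.
rewrite subr0; have [->|uo] := eqVneq u o1; first by case: (Astd k sk) => _ ->.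
by case uk : (u \in Ak k) => //; move: uo; rewrite (ntyp_units k u sk tk su uk) eqxx.
Qed.

Let cut01 i j := jump [set o0] o1 i j.
Let cut12 i j := jump [set o1] o2 i j.

Let st01 : is_std [set o0] o1 := std_unit o0 o1 s0 s1 o01.
Let st12 : is_std [set o1] o2 := std_unit o1 o2 s1 s2 o12.

Lemma jumpC A k i j : jump A k j i = - jump A k i j.
Proof. by rewrite /jump opprB. Qed.

Lemma jump_cases A k i j : [\/ jump A k i j = 0, jump A k i j = 1 | jump A k i j = -1].
Proof.
rewrite /jump; case: (chi01 A k i) => ->; case: (chi01 A k j) => ->;
  [constructor 1|constructor 3|constructor 2|constructor 1]; lia.
Qed.

(** This is the norm 2 of [e_0 - e_1]; orienting each edge by the sign of its jump removes the
    double counting. *)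
Let cut01_weight : \sum_(x : 'I_n * 'I_n | cut01 x.1 x.2 == 1) wt x.1 x.2 = 2.
Proof.
have e : 2 * dot (fu o0 o1) (fu o0 o1) = \sum_i \sum_j wt i j * (cut01 i j * cut01 i j).
  by rewrite (chiE _ _ st01) dot_lincomb.
rewrite dot_fu !mxE !inE eqxx (negbTE o01) (eq_sym o1) (negbTE o01) eqxx pair_bigA /= in e.
have sw : \sum_(x : 'I_n * 'I_n | cut01 x.1 x.2 == -1) wt x.1 x.2 =
          \sum_(x : 'I_n * 'I_n | cut01 x.1 x.2 == 1) wt x.1 x.2.
  rewrite (reindex_inj (h := fun x : 'I_n * 'I_n => (x.2, x.1))) /=; last by move=> [? ?] [? ?] [-> ->].
  apply: eq_big => [x|x _]; last exact: weightC.
  by rewrite /cut01 jumpC; lia.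
have : \sum_(x : 'I_n * 'I_n) wt x.1 x.2 * (cut01 x.1 x.2 * cut01 x.1 x.2) =
   \sum_(x : 'I_n * 'I_n | cut01 x.1 x.2 == 1) wt x.1 x.2 +
   \sum_(x : 'I_n * 'I_n | cut01 x.1 x.2 == -1) wt x.1 x.2.
  rewrite [X in X + _]big_mkcond [X in _ + X]big_mkcond -big_split /=; apply: eq_bigr => x _.
  by case: (jump_cases [set o0] o1 x.1 x.2); rewrite /cut01 => ->; rewrite /= ?mulr0 ?mulr1 ?mulrN1 ?opprK ?addr0 ?add0r.
rewrite -e sw; move: (\sum_(x : 'I_n * 'I_n | _) _) => X; lia.
Qed.

Let wt_jump A k i j : jump A k i j != 0 -> 0 <= wt i j.
Proof.
move=> h; apply: weight_ge0 => //; apply: contraNneq h => ->; by rewrite /jump subrr.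
Qed.

Let three_edges x y z : cut01 x.1 x.2 = 1 -> cut01 y.1 y.2 = 1 -> cut01 z.1 z.2 = 1 ->
  0 < wt x.1 x.2 -> 0 < wt y.1 y.2 -> 0 < wt z.1 z.2 -> x != y -> y != z -> x != z -> False.
Proof.
move=> cx cy cz wx wy wz xy yz xz.
have := cut01_weight; rewrite (bigD1 x) ?cx //= (bigD1 y) /=; last by rewrite cy eqxx eq_sym.
rewrite (bigD1 z) /=; last by rewrite cz eqxx (eq_sym z x) (eq_sym z y) xz yz.
set R := \sum_(i | _) _; have : 0 <= R.
  apply: sumr_ge0 => i /andP[/andP[/andP[/eqP h _] _] _].
  by apply: (wt_jump [set o0] o1); rewrite -/(cut01 _ _) h.
by lia.
Qed.

Let edge_a2 : exists x : 'I_n * 'I_n, 0 < wt x.1 x.2 /\ cut01 x.1 x.2 = 1 /\ cut12 x.1 x.2 != 0.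
Proof.
have [|i [j [w h]]] := jump_neg [set o0] o1 [set o1] o2 st01 st12.
  by rewrite dot_fu !mxE !inE eqxx (negbTE o01) (negbTE o02) (negbTE o12).
have n1 : cut01 i j != 0 by rewrite /cut01; apply: contraTneq h => ->; rewrite mul0r.
have n2 : cut12 i j != 0 by rewrite /cut12; apply: contraTneq h => ->; rewrite mulr0.
case: (jump_cases [set o0] o1 i j) => hc; first by rewrite /cut01 hc in n1.
  by exists (i, j).
by exists (j, i); rewrite /= weightC /cut01 /cut12 !(jumpC _ _ i j) hc oppr_eq0.
Qed.

(** [gen k0] pairs negatively with [e_0 - e_1] and is orthogonal to [e_1 - e_2], so an edge that it
    shares with the first is not cut by the second. Together with [edge_a2] this exhausts the cut of
    [e_0 - e_1]. *)
Let edge_a1 : exists x : 'I_n * 'I_n, 0 < wt x.1 x.2 /\ cut01 x.1 x.2 = 1 /\ cut12 x.1 x.2 = 0 /\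
  jump (gA k0) k0 x.1 x.2 != 0.
Proof.
have gk : gA k0 = Ak k0 by rewrite /gA k0st.
have [st _ _ _] := Astd k0 k0st.
have k0o u : s 0 u = 1 -> k0 != u by move=> su; apply: contraTneq k0st => ->; rewrite su.
have g0 : gen k0 0 o0 = 0.
  apply: gen_o0; rewrite /big_idx; have := k0o o0 s0; have := k0o o1 s1.
  by rewrite -!val_eqE /= o0E o1E; lia.
have g1 := gen_typ k0 o1 typ_k0 s1 ltac:(by rewrite eq_sym).
have g2 := gen_typ k0 o2 typ_k0 s2 ltac:(by rewrite eq_sym).
rewrite -gk in st.
have [|i [j [w h]]] := jump_neg [set o0] o1 (gA k0) k0 st01 st.
  by rewrite dot_fu -/(gen k0) g0 g1.
have := jump_orth [set o1] o2 (gA k0) k0 i j st12 st ltac:(by rewrite eq_sym; apply: k0o).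
rewrite dot_fu -/(gen k0) g1 g2 subrr => /(_ erefl w) /eqP; rewrite mulf_eq0 => hh.
have n1 : cut01 i j != 0 by rewrite /cut01; apply: contraTneq h => ->; rewrite mul0r.
have n2 : jump (gA k0) k0 i j != 0 by apply: contraTneq h => ->; rewrite mulr0.
rewrite (negbTE n2) orbF in hh; move/eqP: hh => hh.
case: (jump_cases [set o0] o1 i j) => hc; first by rewrite /cut01 hc in n1.
  by exists (i, j).
by exists (j, i); rewrite /= weightC /cut01 /cut12 !(jumpC _ _ i j) hc hh oppr0 oppr_eq0.
Qed.

Let cut01_edges x y z : 0 < wt x.1 x.2 -> cut01 x.1 x.2 = 1 -> cut12 x.1 x.2 = 0 ->
  0 < wt y.1 y.2 -> cut01 y.1 y.2 = 1 -> cut12 y.1 y.2 != 0 ->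
  0 < wt z.1 z.2 -> cut01 z.1 z.2 = 1 -> z = x \/ z = y.
Proof.
move=> wx cx dx wy cy dy wz cz.
have xy : x != y by apply: contraNneq dy => <-; rewrite dx.
case: (eqVneq z x) => [|zx]; first by left.
case: (eqVneq z y) => [|zy]; first by right.
exfalso; apply: (three_edges x y z) => //; by rewrite eq_sym.
Qed.

(* [gen l + (e_0 - e_1)] is again a standard vector [stdv A' l], and the cuts of [gen k] and of
   [stdv A' l] both contain the only edge that [e_0 - e_1] crosses and [e_1 - e_2] does not, with
   opposite signs. By sign consistency their product is negative, hence [gen k . gen l <= 0]. *)
Let typ_ntyp_orth k l : big_idx k -> big_idx l -> typ k -> ~~ typ l -> dot (gen k) (gen l) = 0.
Proof.
move=> kb lb tk tl; have sk := typ_stable k tk.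
have [kn0 kn1] := big_neq k kb; have [ln0 ln1] := big_neq l lb.
case: (unit_or l) => sl.
  by rewrite {2}/gen /gA sl ltxx dotC dot_fu (gen_typ k o1) ?(gen_typ k l) ?subrr // eq_sym.
have kl : k != l by apply: contraNneq tl => <-.
have [stl o1l o0l ltl] := Astd l sl.
pose A' := o0 |: (Ak l :\ o1).
have sumA' : \sum_(i in A') s 0 i = s 0 l.
  rewrite big_setU1 /=; last by rewrite !inE (negbTE o0l) andbF.
  rewrite s0; have [_ <-] := stl; rewrite [RHS](big_setD1 o1) //= s1.
  by [].
have st' : is_std A' l.
  split=> //; rewrite !inE negb_or ln0 /= negb_and ln1 /=.
  by case: stl.
have e' : stdv A' l = gen l + fu o0 o1.
  apply/rowP => c; rewrite !mxE /gA sl !inE.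
  have [->|c0] := eqVneq c o0; first by rewrite (negbTE o01) (negbTE o0l) /=; ring.
  by have [->|c1] := eqVneq c o1; rewrite ?o1l /=; ring.
have stk := gstd k kb.
have gl := gen_ntyp l lb tl sl.
have [x [wx [cx [dx jx]]]] := edge_a1; have [y [wy [cy dy]]] := edge_a2.
have only i j : 0 < wt i j -> cut01 i j != 0 -> cut12 i j = 0 -> (i, j) = x \/ (j, i) = x.
  move=> w c d; have [h0|h1|hm] := jump_cases [set o0] o1 i j.
  - by move: c; rewrite /cut01 h0 eqxx.
  - left; have [//|hy] := cut01_edges x y (i, j) wx cx dx wy cy dy w h1.
    by move: dy; rewrite -hy /= d eqxx.
  right; have w' : 0 < wt j i by rewrite weightC.
  have c' : cut01 j i = 1 by rewrite /cut01 jumpC hm opprK.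
  have [//|hy] := cut01_edges x y (j, i) wx cx dx wy cy dy w' c'.
  by move: dy; rewrite -hy /= /cut12 jumpC -/(cut12 i j) d oppr0 eqxx.
have d1 : dot (gen k) (fu o0 o1) = -1.
  by rewrite dotC dot_fu gen_o0 // gen_typ // eq_sym.
have d2 : dot (gen k) (fu o1 o2) = 0.
  by rewrite dotC dot_fu !gen_typ // eq_sym.
have o1k : o1 != k by rewrite eq_sym.
have o2k : o2 != k by apply: contraTneq sk => <-; rewrite s2.
have [i [j [w h]]] := jump_neg _ _ _ _ stk st01 ltac:(by rewrite d1).
have c1 : cut01 i j != 0 by rewrite /cut01; apply: contraTneq h => ->; rewrite mulr0.
have c2 : cut12 i j = 0.
  have := jump_orth _ _ _ _ i j stk st12 ltac:(by rewrite eq_sym) d2 w => /eqP; rewrite mulf_eq0.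
  by case/orP => /eqP // h0; move: h; rewrite h0 mul0r.
have ex := only i j w c1 c2.
have dl1 : dot (stdv A' l) (fu o0 o1) = 1.
  by rewrite e' dotDl (dotC _ (gen l)) !dot_fu gen_o0 // gl // !mxE !inE !eqxx (eq_sym o1) (negbTE o01).
have dl2 : dot (stdv A' l) (fu o1 o2) = 0.
  rewrite e' dotDl (dotC _ (gen l)) !dot_fu !gl // eqxx eq_sym (negbTE o12) !mxE !inE.
  by rewrite (negbTE o01) eqxx (negbTE o12) (negbTE o02).
have [i' [j' [w' h']]] := jump_pos _ _ _ _ st' st01 ltac:(by rewrite dl1).
have c1' : cut01 i' j' != 0 by rewrite /cut01; apply: contraTneq h' => ->; rewrite mulr0.
have lo2 : l != o2 by apply: contraTneq sl => ->; rewrite s2.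
have c2' : cut12 i' j' = 0.
  have := jump_orth _ _ _ _ i' j' st' st12 lo2 dl2 w' => /eqP; rewrite mulf_eq0.
  by case/orP => /eqP // h0; move: h'; rewrite h0 mul0r.
have ex' := only i' j' w' c1' c2'.
have hneg : jump (gA k) k i j * jump A' l i j < 0.
  have h'' : 0 < jump A' l i j * cut01 i j.
    have [ii|ii] : (i', j') = (i, j) \/ (i', j') = (j, i).
      by case: ex => e1; case: ex' => e2; have := etrans e2 (esym e1) => -[-> ->];
        [left|right|right|left].
      by case: ii h' => -> ->.
    by case: ii h' => -> ->; rewrite /cut01 !(jumpC _ _ i j) mulrNN.
  exact: mul_opposite h h''.
have dneg : dot (gen k) (stdv A' l) < 0.
  rewrite ltNge; apply/negP; rewrite le_eqVlt => /orP[/eqP z|p].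
    by have := jump_orth _ _ _ _ i j stk st' kl (esym z) w => z'; rewrite z' in hneg.
  have [i2 [j2 [w2 p2]]] := jump_pos _ _ _ _ stk st' p.
  by have := jump_consistent _ _ _ _ _ _ _ _ stk st' kl w2 p2 w; rewrite leNgt hneg.
(* The common index [o1] contributes 1. Negative contributions come only from [l] in [Ak k] or [k]
   in [Ak l], and these exclude each other because [Ak k] lies below [k]. *)
have dge : 0 <= dot (gen k) (gen l).
  have gl0 c : gen l 0 c = (c \in Ak l)%:R - (c == l)%:R by rewrite mxE /gA sl.
  have [_ o1k' _ ltk] := Astd k sk.
  have ll : (l \in Ak l) = false by case: stl => /negbTE.
  rewrite {1}/gen dot_stdv {1}/gA sk (bigD1 o1) //= !gl0 o1l (eq_sym o1) (negbTE ln1) subr0.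
  rewrite (negbTE kl) subr0.
  case lk : (l \in Ak k).
    have -> : (k \in Ak l) = false.
      by apply/negP => /ltl klt; have := ltn_trans klt (ltk l lk); rewrite ltnn.
    rewrite (bigD1 l) /=; last by rewrite lk ln1.
    rewrite gl0 ll eqxx !(addr0, subr0) sub0r addrA subrr add0r; apply: sumr_ge0 => c /andP[_ cl].
    by rewrite gl0 (negbTE cl) subr0; case: (c \in _).
  have S0 : 0 <= \sum_(i in Ak k | i != o1) gen l 0 i.
    apply: sumr_ge0 => c /andP[ck _]; rewrite gl0.
    have -> : (c == l) = false by apply: contraFF lk => /eqP<-.
    by rewrite subr0; case: (c \in _).
  by move: (\sum_(i in Ak k | i != o1) _) S0 => S; clear; case: (k \in _) => /=; lia.
have dd : dot (gen k) (stdv A' l) = dot (gen k) (gen l) - 1 by rewrite e' dotDr d1.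
move: dneg dge; rewrite dd; clear; lia.
Qed.

Let gA_lt k i : big_idx k -> i \in gA k -> (i < k)%N.
Proof.
rewrite /gA; case: ifP => sk kb; first by case: (Astd k sk) => _ _ _ h /h.
by rewrite inE => /eqP->; rewrite o1E.
Qed.

Let gen_orth k : big_idx k -> dot (gen k) s = 0.
Proof. by move=> kb; apply: stdv_orth; exact: gstd. Qed.

(** Triangular elimination: [gen k] has entry -1 at [k] and is supported below it otherwise. When
    only the coordinates at [o0] and [o1] are left, orthogonality to [s] forces 0. *)
Let span_gen x : dot x s = 0 -> x 0 o0 = 0 ->
  exists c, x = \sum_(k | big_idx k) c k *: gen k.
Proof.
suff h m : forall x, dot x s = 0 -> x 0 o0 = 0 -> (forall k : 'I_r, (m <= k)%N -> x 0 k = 0) ->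
    exists c, x = \sum_(k | big_idx k) c k *: gen k.
  by move=> xs x0; apply: (h r) => // k; rewrite leqNgt ltn_ord.
elim: m => [|m IH] {}x xs x0 hx.
  exists (fun=> 0); rewrite big1 => [|k _]; last exact: scale0r.
  by apply/rowP => k; rewrite hx // mxE.
have [mr|rm] := ltnP m r; last first.
  by apply: IH => // k mk; have := ltn_ord k; rewrite ltnNge (leq_trans rm mk).
have [m1|m1] := leqP m 1.
  have xe k : k != o0 -> k != o1 -> x 0 k = 0.
    rewrite -!val_eqE /= o0E o1E => h0 h1; apply: hx; move: h0 h1 m1; clear; lia.
  have : x 0 o1 = 0.
    move: xs; rewrite /dot (bigD1 o0) //= (bigD1 o1) /=; last by rewrite eq_sym.
    rewrite x0 s1 mul0r mulr1 add0r big1 ?addr0 // => k /andP[k0' k1'].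
    by rewrite xe // mul0r.
  move=> x1; exists (fun=> 0); rewrite big1 => [|k _]; last exact: scale0r.
  apply/rowP => k; rewrite mxE.
  have [->//|k0'] := eqVneq k o0; have [->//|k1'] := eqVneq k o1; exact: xe.
pose k := Ordinal mr; have kb : big_idx k by [].
have [kA _] := gstd k kb.
have [||j mj|c hc] := IH (x + x 0 k *: gen k).
- by rewrite dotDl dotZl gen_orth // mulr0 xs.
- by rewrite rowD rowZ x0 gen_o0 // mulr0 addr0.
- rewrite rowD rowZ mxE; have [->|jk] := eqVneq j k; first by rewrite (negbTE kA) sub0r mulrN1 subrr.
  have kj : (k < j)%N by rewrite ltn_neqAle mj andbT eq_sym; exact: jk.
  rewrite hx // add0r; case jA : (j \in gA k); last by rewrite subr0 mulr0.
  by have := gA_lt k j kb jA; rewrite ltnNge ltnW.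
exists (fun j => c j - (j == k)%:R * x 0 k).
rewrite (eq_bigr (fun j => c j *: gen j - ((j == k)%:R * x 0 k) *: gen j)); last first.
  by move=> j _; rewrite scalerBl.
rewrite sumrB -hc [X in _ - X](bigD1 k) //= eqxx mul1r big1 ?addr0 ?addrK //.
by move=> j /andP[_ /negbTE->]; rewrite mul0r scale0r.
Qed.

(** The summands are spanned by the generators of either type; [k0] and [o2] show that both are
    nonzero. *)
Lemma ker_coord_decomposable : decomposable (fun x => dot x s = 0 /\ x 0 o0 = 0).
Proof.
pose M (P : pred 'I_r) x := exists c, x = \sum_(k | big_idx k && P k) c k *: gen k.
have Msub P : sublattice (fun x => dot x s = 0 /\ x 0 o0 = 0) (M P).
  split; first by exists (fun=> 0); rewrite big1 // => k _; rewrite scale0r.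
  split=> [x y [c ->] [c' ->]|x [c ->]].
    by exists (fun k => c k - c' k); rewrite -sumrB; apply: eq_bigr => k _; rewrite scalerBl.
  split; first by rewrite dot_suml big1 // => k /andP[kb _]; rewrite dotZl gen_orth // mulr0.
  by rewrite summxE big1 // => k /andP[kb _]; rewrite rowZ gen_o0 // mulr0.
have Mgen (P : pred 'I_r) k : big_idx k -> P k -> M P (gen k).
  move=> kb Pk; exists (fun j => (j == k)%:R).
  rewrite (bigD1 k) ?kb //= eqxx scale1r big1 ?addr0 // => j /andP[_ /negbTE->].
  exact: scale0r.
have gen0 k : big_idx k -> gen k <> 0.
  move=> kb; have [kA _] := gstd k kb; move/rowP/(_ k).
  by rewrite !mxE (negbTE kA) eqxx.
have k0b : big_idx k0.
  have k0o u : s 0 u = 1 -> k0 != u by move=> su; apply: contraTneq k0st => ->; rewrite su.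
  rewrite /big_idx; have := k0o o0 s0; have := k0o o1 s1.
  by rewrite -!val_eqE /= o0E o1E; clear; lia.
have o2b : big_idx o2 by rewrite /big_idx o2E.
have o2n : ~~ typ o2 by rewrite /typ s2.
have orth x y : M typ x -> M (predC typ) y -> dot x y = 0.
  move=> [c ->] [c' ->]; rewrite dot_suml big1 // => k /andP[kb tk].
  rewrite dot_sumr big1 // => l /andP[lb tl].
  by rewrite dotZl dotZr typ_ntyp_orth // !mulr0.
exists (M typ), (M (predC typ)); split=> //; split=> //; split.
  by exists (gen k0); split; [apply: Mgen|apply: gen0].
split; first by exists (gen o2); split; [apply: Mgen|apply: gen0].
split=> //; split=> [x xM xM'|x [xs x0]]; first by apply: dot_eq0; apply: orth.
have [c ->] := span_gen x xs x0.
exists (\sum_(k | big_idx k && typ k) c k *: gen k), (\sum_(k | big_idx k && ~~ typ k) c k *: gen k).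
by split; [exists c|split; [exists c|rewrite (bigID typ)]].
Qed.

Let E i j := [exists k, [&& big_idx k, typ k & jump (gA k) k i j != 0]].

Let split_ker f : (Phi f) 0 o0 = 0 -> exists f1 f2 : 'I_n -> int, [/\ forall i, f i = f1 i + f2 i,
  forall i j, 0 < wt i j -> E i j -> f2 i = f2 j,
  forall i j, 0 < wt i j -> ~~ E i j -> f1 i = f1 j,
  (Phi f1) 0 o0 = 0 & (Phi f1) 0 o1 = (Phi f1) 0 o2].
Proof.
move=> f0; have [c hc] := span_gen _ (lincomb_orth f) f0.
pose F P i := \sum_(k | big_idx k && P k) c k * chi (gA k) k i.
have PF P : Phi (F P) = \sum_(k | big_idx k && P k) c k *: gen k.
  rewrite /F /lincomb; under eq_bigr do rewrite scaler_suml.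
  rewrite exchange_big /=; apply: eq_bigr => k /andP[kb _].
  rewrite /gen chiE; last exact: gstd.
  by rewrite /lincomb scaler_sumr; apply: eq_bigr => i _; rewrite scalerA.
have fE : Phi f = Phi (fun i => F typ i + F (predC typ) i).
  by rewrite lincombD !PF hc (bigID typ).
have df P i j : F P i - F P j = \sum_(k | big_idx k && P k) c k * jump (gA k) k i j.
  by rewrite -sumrB; apply: eq_bigr => k _; rewrite /jump mulrBr.
(* [f - F typ] agrees with [F (predC typ)] up to a constant only, hence this choice of the second
   function. *)
exists (F typ), (fun i => f i - F typ i); split=> [i|i j w e|i j w ne||].
- by rewrite addrC subrK.
- have := ker_diff _ _ fE i j => h.
  have : F (predC typ) i - F (predC typ) j = 0.
    rewrite df big1 // => l /andP[lb tl].
    have /existsP[k /and3P[kb tk /eqP nz]] := e.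
    have kl : k != l by apply: contraNneq tl => <-.
    have := jump_orth _ _ _ _ i j (gstd k kb) (gstd l lb) kl (typ_ntyp_orth k l kb lb tk tl) w.
    by move=> /eqP; rewrite mulf_eq0 => /orP[/eqP //|/eqP->]; rewrite mulr0.
  by move: h; clear; lia.
- have : F typ i - F typ j = 0.
    rewrite df big1 // => k /andP[kb tk]; move/existsPn/(_ k): ne.
    by rewrite kb tk /= negbK => /eqP->; rewrite mulr0.
  by clear; lia.
- by rewrite PF summxE big1 // => k /andP[kb _]; rewrite rowZ gen_o0 // mulr0.
- rewrite PF !summxE; apply: eq_bigr => k /andP[kb tk].
  by rewrite !rowZ !gen_typ // eq_sym.
Qed.

Let Wt (Q : rel 'I_n) := \sum_(x : 'I_n * 'I_n | (cut01 x.1 x.2 == 1) && Q x.1 x.2) wt x.1 x.2.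

(** Such a [g] jumps by [t] exactly on the edges in [Q] cut by [e_0 - e_1], so its norm and its
    pairing with [e_0 - e_1] only count these edges. *)
Let cut_norm (Q : rel 'I_n) t g : symmetric Q ->
  (forall i j, 0 < wt i j -> g i - g j = (Q i j)%:R * (t * cut01 i j)) ->
  dot (Phi g) (Phi g) = t * t * Wt Q /\ dot (Phi g) (fu o0 o1) = t * Wt Q.
Proof.
move=> Qs hg.
have tot (h : 'I_n -> int) a : (forall i j, 0 < wt i j -> (g i - g j) * (h i - h j) =
     a * ((Q i j)%:R * (cut01 i j * cut01 i j))) -> dot (Phi g) (Phi h) = a * Wt Q.
  move=> ha.
  have e : 2 * dot (Phi g) (Phi h) = a * (2 * Wt Q).
    rewrite dot_lincomb // pair_bigA /=.
    have sw : \sum_(x : 'I_n * 'I_n | (cut01 x.1 x.2 == -1) && Q x.1 x.2) wt x.1 x.2 = Wt Q.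
      rewrite (reindex_inj (h := fun x : 'I_n * 'I_n => (x.2, x.1))) /=; last by move=> [? ?] [? ?] [-> ->].
      apply: eq_big => [x|x _]; last exact: weightC.
      by rewrite /cut01 jumpC Qs eqr_opp.
    have -> : 2 * Wt Q = Wt Q + \sum_(x : 'I_n * 'I_n | (cut01 x.1 x.2 == -1) && Q x.1 x.2) wt x.1 x.2.
      by rewrite sw; clear; lia.
    rewrite /Wt [X in X + _]big_mkcond [X in _ + X]big_mkcond -big_split /= mulr_sumr.
    apply: eq_bigr => -[i j] _ /=.
    have [->|ij] := eqVneq i j.
      by rewrite !subrr !mulr0 /cut01 /jump subrr /= addr0 mulr0.
    have := weight_ge0 _ _ _ obt i j ij; rewrite le_eqVlt => /orP[/eqP<-|w].
      by rewrite mul0r; case: ifP; case: ifP; rewrite addr0 mulr0.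
    rewrite ha //; case: (jump_cases [set o0] o1 i j); rewrite /cut01 => ->; case: (Q i j) => /=; clear; lia.
  by move: e; clear; move: (dot _ _) (Wt Q) => x y; lia.
split; first apply: tot => i j w.
  by rewrite hg //; case: (Q i j); rewrite ?mul1r ?mul0r ?mulr0 // mulrACA.
rewrite chiE //; apply: tot => i j w.
by rewrite hg // -/(jump _ _ _ _) -/(cut01 i j); case: (Q i j); rewrite ?mul1r ?mul0r ?mulr0 // mulrA.
Qed.

Let E_sym : symmetric E.
Proof. by move=> i j; apply: eq_existsb => k; rewrite jumpC oppr_eq0. Qed.

(** The edge of [edge_a1] is cut by [gen k0] and so lies in [E]. That of [edge_a2] is cut by
    [e_1 - e_2], which is orthogonal to all generators of type [typ]. The total is 2. *)
Let Wt_E : Wt E = 1 /\ Wt (fun i j => ~~ E i j) = 1.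
Proof.
have [x [wx [cx [dx jx]]]] := edge_a1; have [y [wy [cy dy]]] := edge_a2.
have pos (Q : rel 'I_n) z : 0 < wt z.1 z.2 -> cut01 z.1 z.2 = 1 -> Q z.1 z.2 -> 0 < Wt Q.
  move=> wz cz Qz; rewrite /Wt (bigD1 z) /=; last by rewrite cz Qz.
  apply: ltr_pwDl => //; apply: sumr_ge0 => i /andP[/andP[/eqP h _] _].
  by apply: (wt_jump [set o0] o1); rewrite -/(cut01 _ _) h.
have e : Wt E + Wt (fun i j => ~~ E i j) = 2 by rewrite -cut01_weight [RHS](bigID (fun x => E x.1 x.2)).
have p1 : 0 < Wt E.
  apply: (pos E x wx cx); apply/existsP; exists k0; rewrite typ_k0 jx !andbT.
  have k0o u : s 0 u = 1 -> k0 != u by move=> su; apply: contraTneq k0st => ->; rewrite su.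
  rewrite /big_idx; have := k0o o0 s0; have := k0o o1 s1.
  by rewrite -!val_eqE /= o0E o1E; clear; lia.
have p2 : 0 < Wt (fun i j => ~~ E i j).
  apply: (pos (fun i j => ~~ E i j) y wy cy); apply/existsPn => k.
  case kb : (big_idx k) => //=; case tk : (typ k) => //=.
  have ko2 : k != o2 by apply: contraTneq tk => ->; rewrite /typ s2.
  have := jump_orth _ _ _ _ y.1 y.2 (gstd k kb) st12 ko2.
  rewrite dotC dot_fu -/(gen k) !gen_typ //; last by rewrite eq_sym.
    rewrite subrr => /(_ erefl wy) /eqP; rewrite mulf_eq0 => /orP[->//|].
    by rewrite -/(cut12 _ _) (negbTE dy).
  by rewrite eq_sym.
by move: e p1 p2; clear; lia.
Qed.

Let ortho_sq g i j : i != j -> (Phi g) 0 i * (Phi g) 0 i + (Phi g) 0 j * (Phi g) 0 j <= dot (Phi g) (Phi g).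
Proof.
move=> ij; rewrite [in X in _ <= X]/dot (bigD1 i) //= (bigD1 j) /=; last by rewrite eq_sym.
by rewrite addrA lerDl sumr_ge0 // => c _; rewrite -expr2 sqr_ge0.
Qed.

Let fu01_o0 : Phi (chi [set o0] o1) 0 o0 = 1 /\ Phi (chi [set o0] o1) 0 o1 = -1 /\
  Phi (chi [set o0] o1) 0 o2 = 0.
Proof.
rewrite -chiE // !mxE !inE !eqxx (negbTE o01) (eq_sym o1 o0) (eq_sym o2 o0) (eq_sym o2 o1).
by rewrite (negbTE o01) (negbTE o02) (negbTE o12).
Qed.

(* [E] consists of the edges cut by the generators whose support contains all the units but [e_0].
   A function constant along [E] (or along its complement) represents
   [t (e_0 - e_1)] modulo the vectors with vanishing [o0]-coordinate; subtracting the part spanned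
   by the other colour leaves a single cut edge, so the norm is [t^2], which forces [t = 0]. *)
Lemma two_colouring : exists E : rel 'I_n,
  [/\ forall f, (forall i j, 0 < wt i j -> E i j -> f i = f j) -> (Phi f) 0 o0 = 0,
      forall f, (forall i j, 0 < wt i j -> ~~ E i j -> f i = f j) -> (Phi f) 0 o0 = 0,
      forall f, (Phi f) 0 o0 = 0 -> exists f1 f2 : 'I_n -> int, [/\ forall i, f i = f1 i + f2 i,
        forall i j, 0 < wt i j -> E i j -> f2 i = f2 j &
        forall i j, 0 < wt i j -> ~~ E i j -> f1 i = f1 j] &
      exists f, (Phi f) 0 o0 = 1].
Proof.
have [c0 [c1 c2]] := fu01_o0; have [W1 W2] := Wt_E.
have shift f : exists f1 f2 : 'I_n -> int, [/\ forall i, f i - (Phi f) 0 o0 * chi [set o0] o1 i = f1 i + f2 i,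
  forall i j, 0 < wt i j -> E i j -> f2 i = f2 j,
  forall i j, 0 < wt i j -> ~~ E i j -> f1 i = f1 j,
  (Phi f1) 0 o0 = 0 & (Phi f1) 0 o1 = (Phi f1) 0 o2].
  by apply: split_ker; rewrite lincombB lincombZ rowD -scaleNr rowZ c0 mulr1 subrr.
exists E; split=> [f hf|f hf|f /split_ker[f1 [f2 [h1 h2 h3 _ _]]]|].
- have [f1 [f2 [h1 h2 h3 h4 h5]]] := shift f; move: h1; set t := (Phi f) 0 o0 => h1.
  pose g i := f1 i + t * chi [set o0] o1 i.
  have [|n1 n2] := cut_norm (fun i j => ~~ E i j) t g (fun i j => congr1 negb (E_sym i j)).
    move=> i j w; have ci : cut01 i j = chi [set o0] o1 i - chi [set o0] o1 j by [].
    rewrite ci /g; have a1 := h1 i; have a2 := h1 j; case e : (E i j) => /=.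
      have a3 := hf i j w e; have a4 := h2 i j w e; move: a1 a2 a3 a4; clear.
      by move: (t * chi _ _ i) (t * chi _ _ j) => x y; lia.
    have a3 := h3 i j w (negbT e); rewrite a3; clear; ring.
  rewrite W2 mulr1 in n1; rewrite W2 mulr1 dotC dot_fu lincombD lincombZ !rowD !rowZ c0 c1 h4 in n2.
  have := ortho_sq g o0 o2 o02; rewrite n1 lincombD lincombZ !rowD !rowZ c0 c2 h4 -h5.
  (* Pairing with [e_0 - e_1] gives the [o1]-coordinate [t] for [f1]. Then [g] has coordinate [t] at
     both [o0] and [o2], and [2 t^2 <= t^2]. *)
  move: n2; move: ((Phi f1) 0 o1) => c; clear; move=> e.
  have -> : c = t by lia.
  nia.
- have [f1 [f2 [h1 h2 h3 h4 h5]]] := shift f; move: h1; set t := (Phi f) 0 o0 => h1.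
  pose g i := f2 i + t * chi [set o0] o1 i.
  have [|n1 n2] := cut_norm E t g E_sym.
    move=> i j w; have ci : cut01 i j = chi [set o0] o1 i - chi [set o0] o1 j by [].
    rewrite ci /g; have a1 := h1 i; have a2 := h1 j; case e : (E i j) => /=.
      have a3 := h2 i j w e; rewrite a3; clear; ring.
    have a3 := hf i j w (negbT e); have a4 := h3 i j w (negbT e); move: a1 a2 a3 a4; clear.
    by move: (t * chi _ _ i) (t * chi _ _ j) => x y; lia.
  rewrite W1 mulr1 in n1; rewrite W1 mulr1 dotC dot_fu in n2.
  have g0 : (Phi g) 0 o0 = t.
    have e : Phi f = Phi (fun i => f1 i + g i).
      by apply: eq_lincomb => i; rewrite /g addrA -h1 subrK.
    by rewrite /t e lincombD rowD h4 add0r.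
  (* The [o0]-coordinate exhausts the norm [t^2], so [Phi g] is a multiple of [e_0], which is
     orthogonal to [s] only for [t = 0]. *)
  have gi i : i != o0 -> (Phi g) 0 i = 0.
    rewrite eq_sym => i0; have := ortho_sq g o0 i i0; rewrite n1 g0; clear; nia.
  have := lincomb_orth g; rewrite /dot (bigD1 o0) //= g0 s0 mulr1 big1 ?addr0 // => i i0.
  by rewrite gi // mul0r.
- by exists f1, f2.
- by exists (chi [set o0] o1).
Qed.

End Cuts.

(** * Two-vertex separations and twists *)

Section Separation.
Variables (r n : nat) (B : 'I_n -> 'rV[int]_r) (o0 : 'I_r) (E : rel 'I_n).
Notation Phi := (lincomb r n B).
Notation wt := (weight r n B).
Notation x v := (B v 0 o0).
Hypothesis obt : forall i j, i != j -> dot (B i) (B j) <= 0.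
Hypothesis cstE : forall f, (forall i j, 0 < wt i j -> E i j -> f i = f j) -> (Phi f) 0 o0 = 0.
Hypothesis cstE' : forall f, (forall i j, 0 < wt i j -> ~~ E i j -> f i = f j) -> (Phi f) 0 o0 = 0.
Hypothesis splitE : forall f, (Phi f) 0 o0 = 0 -> exists f1 f2 : 'I_n -> int, [/\ forall i, f i = f1 i + f2 i,
        forall i j, 0 < wt i j -> E i j -> f2 i = f2 j &
        forall i j, 0 < wt i j -> ~~ E i j -> f1 i = f1 j].

Notation m := (fun i j => `|dot (B i) (B j)|%N).

Let lincombE f : (Phi f) 0 o0 = \sum_i f i * x i.
Proof. by rewrite /lincomb summxE; apply: eq_bigr => i _; rewrite mxE. Qed.

Let lincomb_ind (C : {set 'I_n}) : (Phi (indicator n C)) 0 o0 = \sum_(i in C) x i.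
Proof.
rewrite lincombE [RHS]big_mkcond; apply: eq_bigr => i _; rewrite /indicator.
by case: (i \in C); rewrite ?mul1r ?mul0r.
Qed.

Let ind_eq (C : {set 'I_n}) i j : (i \in C -> j \notin C -> False) -> (j \in C -> i \notin C -> False) ->
  indicator n C i = indicator n C j.
Proof.
rewrite /indicator; case: (i \in C); case: (j \in C) => // h1 h2; first by case: h1.
by case: h2.
Qed.

(** If [b] is not reached, let [C] be the component of [a]. Edges leaving [C] start at [a] and avoid
    [K2], and edges leaving [C] without [a] end at [a] and avoid [K1]. So [x] sums to 0 over both
    sets, and [x a = 0]. *)
Let side_connect (K1 K2 : rel 'I_n) (a b : 'I_n) (S : {set 'I_n}) :
  (forall f, (forall i j, 0 < wt i j -> K1 i j -> f i = f j) -> (Phi f) 0 o0 = 0) ->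
  (forall f, (forall i j, 0 < wt i j -> K2 i j -> f i = f j) -> (Phi f) 0 o0 = 0) ->
  a != b -> a \notin S -> b \notin S -> x a != 0 ->
  (forall z y, z \in S -> y \notin S -> y != a -> y != b -> wt z y = 0) ->
  (forall y, y \notin S -> y != a -> y != b -> 0 < wt a y -> ~~ K2 a y /\ ~~ K2 y a) ->
  (forall z, z \in S -> 0 < wt a z -> ~~ K1 a z /\ ~~ K1 z a) ->
  connect [rel u v | [&& (0 < m u v)%N, ~~ [&& u \notin S, u != a & u != b] &
                         ~~ [&& v \notin S, v != a & v != b]]] a b.
Proof.
move=> c1 c2 ab aS bS xa noe aT aS'; apply/negPn/negP => nc.
set e := [rel u v | _] in nc; pose C := [set v | connect e a v].
have aC : a \in C by rewrite inE connect0.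
have bC : b \notin C by rewrite inE.
have CS u : u \in C -> u != a -> u \in S.
  rewrite inE => /connectP[p]; case/lastP: p => [_ ->|p y]; first by rewrite eqxx.
  rewrite last_rcons => pp uy ua; rewrite {}uy in ua *.
  have := pp; rewrite rcons_path /= ua /= => /andP[_ /and3P[_ _]].
  rewrite negb_and !negbK => /orP[//|/eqP yb].
  move: bC; rewrite inE -yb => /negP; case; apply/connectP; exists (rcons p y) => //.
  by rewrite last_rcons.
have leave u v : u \in C -> v \notin C -> 0 < wt u v -> u = a /\ [&& v \notin S, v != a & v != b].
  move=> uC vC w; have va : v != a by apply: contraNneq vC => ->.
  have nu : ~~ [&& u \notin S, u != a & u != b].
    by have [->|ua] := eqVneq u a; rewrite ?andbF //= CS.
  have mv : (0 < m u v)%N by move: w; rewrite /weight absz_gt0; apply: contraTneq => ->; rewrite oppr0.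
  have nv : [&& v \notin S, v != a & v != b].
    apply: contraNT vC => nv; rewrite inE; move: uC; rewrite inE => uC.
    by apply: (connect_trans uC); apply: connect1; rewrite /= mv nu nv.
  split=> //; apply/eqP/negPn/negP => ua; have /and3P[vS _ vb] := nv.
  by move: w; rewrite (noe u v) // CS.
have s1 : \sum_(i in C) x i = 0.
  rewrite -lincomb_ind; apply: c2 => i j w k; apply: ind_eq => iC jC.
    have [ia /and3P[jS ja jb]] := leave i j iC jC w; rewrite ia in w k.
    by have [/negP] := aT j jS ja jb w.
  rewrite weightC in w; have [ia /and3P[jS ja jb]] := leave _ _ iC jC w; rewrite ia in w k.
  by have [_ /negP] := aT i jS ja jb w.
have s2 : \sum_(i in C :\ a) x i = 0.
  have aux u v : 0 < wt u v -> u \in C :\ a -> v \notin C :\ a -> ~~ K1 u v /\ ~~ K1 v u.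
    rewrite !in_setD1 negb_and negbK => w /andP[ua uC] /orP[/eqP va|vC].
      by rewrite va; rewrite va weightC in w; have [] := aS' u (CS u uC ua) w.
    by have [ua' _] := leave u v uC vC w; rewrite ua' eqxx in ua.
  rewrite -lincomb_ind; apply: c1 => i j w k; apply: ind_eq => iC jC.
    by have [/negP] := aux i j w iC jC.
  by rewrite weightC in w; have [_ /negP] := aux j i w iC jC.
by move: s1; rewrite (big_setD1 a) //= s2 addr0 => h; rewrite h eqxx in xa.
Qed.

Let E_or i j : E i j \/ ~~ E i j. Proof. by case: (E i j); [left|right]. Qed.

(* Splitting a combination of [1_a] and [1_b] that lies in the kernel as [f1 + f2] gives a function
   [f2 = - f1] off [a, b]: it is constant along all the edges away from [a, b], and comparing its
   level sets with those of [f1] forces [x a = x b] or [x a = - x b]. *)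
Lemma separation a b : a != b -> x a != 0 -> x b != 0 -> exists Z : {set 'I_n},
  [/\ a \notin Z, b \notin Z, forall z y, z \in Z -> y \notin Z -> y != a -> y != b -> wt z y = 0 &
   [/\ connect [rel u v | [&& (0 < m u v)%N, u \notin Z & v \notin Z]] a b,
   connect [rel u v | [&& (0 < m u v)%N, ~~ [&& u \notin Z, u != a & u != b] &
                         ~~ [&& v \notin Z, v != a & v != b]]] a b &
   x a = - x b \/ [/\ x a = x b, wt a b = 0 & \sum_(z in Z) x z = - x a]]].
Proof.
move=> ab xa xb; have ba : b != a by rewrite eq_sym.
have two u v (h : 'I_n -> int) : (forall i, i != a -> i != b -> h i = 0) -> h a = u -> h b = v ->
    (Phi h) 0 o0 = u * x a + v * x b.
  move=> h0 <- <-; rewrite lincombE (bigD1 a) //= (bigD1 b) //= big1 ?addr0 // => i /andP[ia ib].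
  by rewrite h0 // mul0r.
(* Composites of [h] with [f2] and with [- f1] are constant along one colour each, hence have first
   coordinate 0; off [a] and [b] they agree. *)
have level f1 f2 u v :
    (forall i, u * (i == a)%:R + v * (i == b)%:R = f1 i + f2 i) ->
    (forall i j, 0 < wt i j -> E i j -> f2 i = f2 j) ->
    (forall i j, 0 < wt i j -> ~~ E i j -> f1 i = f1 j) ->
    forall h : int -> int, h (f2 a) * x a + h (f2 b) * x b = h (f2 a - u) * x a + h (f2 b - v) * x b.
  move=> hf hE hE' h.
  have z1 : (Phi (fun i => h (f2 i))) 0 o0 = 0 by apply: cstE => i j w e; rewrite (hE i j w e).
  have z2 : (Phi (fun i => h (- f1 i))) 0 o0 = 0 by apply: cstE' => i j w e; rewrite (hE' i j w e).
  have e : (Phi (fun i => h (f2 i) - h (- f1 i))) 0 o0 = 0 by rewrite lincombB !mxE z1 z2 subrr.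
  rewrite (two (h (f2 a) - h (f2 a - u)) (h (f2 b) - h (f2 b - v))) in e.
  - move: e; rewrite !mulrBl; move: (_ * _) (_ * _) (_ * _) (_ * _); clear; lia.
  - move=> i ia ib; have := hf i; rewrite (negbTE ia) (negbTE ib) !mulr0 addr0 => e1.
    suff -> : f2 i = - f1 i by rewrite subrr.
    by move: e1; clear; lia.
  - have := hf a; rewrite eqxx (negbTE ab) mulr0 mulr1 addr0 => e1.
    by congr (_ - h _); move: e1; clear; lia.
  - have := hf b; rewrite eqxx (negbTE ba) mulr0 mulr1 add0r => e1.
    by congr (_ - h _); move: e1; clear; lia.
have ker u v : u * x a + v * x b = 0 -> exists f1 f2 : 'I_n -> int,
    [/\ (forall i, u * (i == a)%:R + v * (i == b)%:R = f1 i + f2 i),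
    (forall i j, 0 < wt i j -> E i j -> f2 i = f2 j) &
    (forall i j, 0 < wt i j -> ~~ E i j -> f1 i = f1 j)].
  move=> h; apply: (splitE (fun i => u * (i == a)%:R + v * (i == b)%:R)).
  rewrite (two u v) //.
  - by move=> i /negbTE-> /negbTE->; rewrite !mulr0 addr0.
  - by rewrite eqxx (negbTE ab) mulr1 mulr0 addr0.
  - by rewrite eqxx (negbTE ba) mulr1 mulr0 add0r.
(* Splitting [x b 1_a - x a 1_b] and testing with the indicator of the value [f2 a] leaves only
   [x a = x b] and [x a = - x b]. *)
have [e [e1 xab]] : exists e : int, (e = 1 \/ e = -1) /\ x a = e * x b.
  have [|f1 [f2 [h1 h2 h3]]] := ker (x b) (- x a); first by clear; ring.
  have := level _ _ _ _ h1 h2 h3 (fun c => (c == f2 a)%:R); rewrite eqxx.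
  have -> : (f2 a - x b == f2 a) = false by move: xb; clear; lia.
  have [e|ne] := eqVneq (f2 b) (f2 a).
    have -> : (f2 b - - x a == f2 a) = false by move: xa e; clear; lia.
    by move=> h; exists (-1); split; [right|move: h; clear; lia].
  case: eqP => [h|_] /= h'; last by exists 0; move: h' xa; clear; lia.
  by exists 1; split; [left|move: h'; clear; lia].
have [|f1 [f2 [h1 h2 h3]]] := ker 1 (- e); first by rewrite xab; ring.
have f1a : f1 a = 1 - f2 a.
  by have := h1 a; rewrite eqxx (negbTE ab) mulr0 mulr1 addr0; clear; lia.
have f1b : f1 b = - e - f2 b.
  by have := h1 b; rewrite eqxx (negbTE ba) mulr0 mulr1 add0r; clear; lia.
have f1i i : i != a -> i != b -> f1 i = - f2 i.
  by move=> ia ib; have := h1 i; rewrite (negbTE ia) (negbTE ib) !mulr0 addr0; clear; lia.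
(* [f2] is constant along edges away from [a] and [b], so its sublevel set is a union of sides. The
   edges at [a] are coloured [E] towards the other side and not [E] towards [Z]. *)
pose Z := [set v | [&& v != a, v != b & f2 v < f2 a]].
have aZ : a \notin Z by rewrite inE eqxx.
have bZ : b \notin Z by rewrite inE eqxx andbF.
have noe z y : z \in Z -> y \notin Z -> y != a -> y != b -> wt z y = 0.
  rewrite !inE => /and3P[za zb hz] hy ya yb; rewrite ya yb /= -leNgt in hy.
  have zy : z != y by apply: contraTneq hz => ->; rewrite -leNgt.
  have := weight_ge0 _ _ _ obt _ _ zy; rewrite le_eqVlt => /orP[/eqP//|w].
  have : f2 z = f2 y.
    case: (E_or z y) => ee; first exact: h2.
    by have := h3 _ _ w ee; rewrite !f1i //; clear; lia.
  by move: hz hy; clear; lia.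
have aT y : y \notin Z -> y != a -> y != b -> 0 < wt a y -> E a y /\ E y a.
  rewrite inE => hy ya yb w; rewrite ya yb /= -leNgt in hy.
  have w' : 0 < wt y a by rewrite weightC.
  by split; apply/negPn/negP => ne; [have := h3 _ _ w ne|have := h3 _ _ w' ne];
    rewrite f1a f1i //; move: hy; clear; lia.
have aS z : z \in Z -> 0 < wt a z -> ~~ E a z /\ ~~ E z a.
  rewrite inE => /and3P[za zb hz] w; have w' : 0 < wt z a by rewrite weightC.
  by split; apply/negP => ne; [have := h2 _ _ w ne|have := h2 _ _ w' ne];
    move: hz; clear; lia.
exists Z; split=> //; split.
- pose Y := [set v | [&& v != a, v != b & v \notin Z]].
  have aY : a \notin Y by rewrite inE eqxx.
  have bY : b \notin Y by rewrite inE eqxx andbF.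
  have YZ v : v \notin Y -> v != a -> v != b -> v \in Z.
    by rewrite inE => h va vb; move: h; rewrite va vb /= negbK.
  have nY v : ~~ [&& v \notin Y, v != a & v != b] = (v \notin Z).
    by rewrite !inE; case: (v == a); case: (v == b); case: (f2 v < f2 a).
  rewrite -(eq_connect (e := [rel u v | [&& (0 < m u v)%N, ~~ [&& u \notin Y, u != a & u != b] &
                         ~~ [&& v \notin Y, v != a & v != b]]])); last first.
    by move=> u v; rewrite /= !nY.
  apply: (side_connect (fun i j => ~~ E i j) E a b Y cstE' cstE ab aY bY xa).
  + move=> z y; rewrite inE => /and3P[za zb zZ] yY ya yb; rewrite weightC.
    by apply: noe => //; apply: YZ.
  + by move=> y hy ya yb; apply: aS; apply: YZ.
  + by move=> z; rewrite inE => /and3P[za zb zZ] w; have [-> ->] := aT z zZ za zb w.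
- apply: (side_connect E (fun i j => ~~ E i j)) => // y hy ya yb w.
  by have [-> ->] := aT y hy ya yb w.
have := level _ _ _ _ h1 h2 h3 (fun c => (c == f2 a)%:R); rewrite eqxx.
have -> : (f2 a - 1 == f2 a) = false by clear; lia.
case: e1 xab f1b {h1} => -> xab f1b; last by left; move: xab; clear; lia.
have [eq|ne] := eqVneq (f2 b) (f2 a).
  by have -> : (f2 b - -1 == f2 a) = false; move: xa xab eq; clear; lia.
case: eqP => [b1 _|_ /= h]; last by move: xa xab h; clear; lia.
right; rewrite xab; split; first by rewrite mul1r.
  have := weight_ge0 _ _ _ obt _ _ ab; rewrite le_eqVlt => /orP[/eqP//|w].
  case: (E_or a b) => ee; first by have := h2 _ _ w ee; move: b1; clear; lia.
  by have := h3 _ _ w ee; rewrite f1a f1b; move: b1; clear; lia.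
(* Here [f2 b = f2 a - 1], so [b] with [Z] is the full sublevel set of [f2], whose indicator is
   constant along [E]. *)
have : (Phi (indicator n (b |: Z))) 0 o0 = 0.
  have bZE i : indicator n (b |: Z) i = (f2 i < f2 a)%R%:R.
    rewrite /indicator !inE; have [->|ib] := eqVneq i b.
      by have -> : f2 b < f2 a by move: b1; clear; lia.
    by have [->|//] := eqVneq i a; rewrite ltxx.
  by apply: cstE => i j w ee; rewrite !bZE (h2 i j w ee).
by rewrite lincomb_ind big_setU1 //= => h; move: h; move: (\sum_(z in Z) _) => X; clear; lia.
Qed.

End Separation.

(* An obtuse superbase of the orthogonal complement of [s], the rank condition being replaced by
   its consequence that all the relations between the [B i] are multiples of [\sum_i B i = 0]. *)
Definition sbase (r n : nat) (s : 'rV[int]_r) (B : 'I_n -> 'rV[int]_r) : Prop :=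
  [/\ forall i, dot (B i) s = 0, forall v, dot v s = 0 -> exists f, v = lincomb r n B f,
      \sum_i B i = 0, forall i j, i != j -> dot (B i) (B j) <= 0 &
      forall f, lincomb r n B f = 0 -> forall i j, f i = f j].

Definition gram (r n : nat) (B : 'I_n -> 'rV[int]_r) (i j : 'I_n) : nat := `|dot (B i) (B j)|%N.

(** A connection from [a] to [b] through each side is part of the definition: it supplies the free
    arc along which the drawing of the opposite side is opened. *)
Definition separates (r n : nat) (B : 'I_n -> 'rV[int]_r) (a b : 'I_n) (Z : {set 'I_n}) : Prop :=
  [/\ a \notin Z, b \notin Z, forall z y, z \in Z -> y \notin Z -> y != a -> y != b -> dot (B z) (B y) = 0,
   connect [rel u v | [&& (0 < gram r n B u v)%N, u \notin Z & v \notin Z]] a b &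
   connect [rel u v | [&& (0 < gram r n B u v)%N, ~~ [&& u \notin Z, u != a & u != b] &
                         ~~ [&& v \notin Z, v != a & v != b]]] a b].

Lemma gram_glue r r' n (B : 'I_n -> 'rV[int]_r) (B' : 'I_n -> 'rV[int]_r') a b Z (fl : bool) :
  separates r n B a b Z -> a != b ->
  (forall z z', z \in Z -> z' \in Z -> dot (B' z) (B' z') = dot (B z) (B z')) ->
  (forall y y', y \notin Z -> y != a -> y != b -> y' \notin Z -> dot (B' y) (B' y') = dot (B y) (B y')) ->
  (forall z, z \in Z -> dot (B' z) (B' a) = dot (B z) (B (if fl then b else a)) /\
                        dot (B' z) (B' b) = dot (B z) (B (if fl then a else b))) ->
  (forall z y, z \in Z -> y \notin Z -> y != a -> y != b -> dot (B' z) (B' y) = 0) ->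
  planar_multigraph (gram r n B) -> planar_multigraph (gram r' n B').
Proof.
move=> [aZ bZ _ c1 c2] ab hZ hY hab hZY.
have ba : (b == a) = false by rewrite eq_sym (negbTE ab).
apply: (planar_glue n (gram r n B) (gram r' n B') a b (fun v => v \in Z) fl) => //.
- by move=> i j; rewrite /gram dotC.
- by move=> i j; rewrite /gram dotC.
- exact/eqP.
- by rewrite (eq_connect (e' := [rel u v | [&& (0 < gram r n B u v)%N, u \notin Z & v \notin Z]])) // => u v;
  rewrite /= andbA.
- rewrite (eq_connect (e' := [rel u v | [&& (0 < gram r n B u v)%N, ~~ [&& u \notin Z, u != a & u != b] &
                         ~~ [&& v \notin Z, v != a & v != b]]])) // => u v; by rewrite /= -!andbA.
- by move=> z z' zZ zZ'; rewrite /gram hZ.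
- by move=> y y' /andP[/andP[yZ ya] yb] y'Z; rewrite /gram hY.
- move=> z zZ; have [e1 e2] := hab z zZ; rewrite /gram e1 e2 !eqxx ba.
  by case: (fl).
- by move=> z y zZ /andP[/andP[yZ ya] yb]; rewrite /gram hZY.
Qed.

(** * Twisting a superbase along a separating pair *)

Section Flip.
Variables (r n : nat) (s : 'rV[int]_r) (B : 'I_n -> 'rV[int]_r) (a b : 'I_n) (Z : {set 'I_n}).
Hypotheses (ab : a != b) (aZ : a \notin Z) (bZ : b \notin Z).
Hypothesis noe : forall z y, z \in Z -> y \notin Z -> y != a -> y != b -> dot (B z) (B y) = 0.
Hypothesis wab : dot (B a) (B b) = 0.
Hypothesis B0 : \sum_i B i = 0.

(* The Whitney twist along [a, b] of the side [Z]. *)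
Definition flip (v : 'I_n) : 'rV[int]_r :=
  if v \in Z then - B v else B v + ((v == a) || (v == b))%:R *: \sum_(z in Z) B z.

(** The twist seen on coefficients: a reflection on [Z] fixing the values at [a] and [b]. It is an
    involution, so the twisted vectors still span. *)
Definition flip_fun (f : 'I_n -> int) (v : 'I_n) : int :=
  if v \in Z then f a + f b - f v else f v.

Lemma lincomb_flip f : lincomb r n flip f = lincomb r n B (flip_fun f).
Proof.
have e v : f v *: flip v = (if v \in Z then - f v else f v) *: B v +
    (f v * ((v == a) || (v == b))%:R) *: \sum_(z in Z) B z.
  rewrite /flip; case vZ : (v \in Z); last by rewrite scalerDr scalerA.
  have -> : (v == a) = false by apply: contraTF vZ => /eqP->.
  have -> : (v == b) = false by apply: contraTF vZ => /eqP->.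
  by rewrite mulr0 scale0r addr0 scalerN scaleNr.
have e' v : flip_fun f v *: B v = (if v \in Z then - f v else f v) *: B v +
    (if v \in Z then (f a + f b) *: B v else 0).
  by rewrite /flip_fun; case: (v \in Z); rewrite ?addr0 // -scalerDl addrC.
rewrite /lincomb (eq_bigr _ (fun v _ => e v)) (eq_bigr _ (fun v _ => e' v)) !big_split /=; congr (_ + _).
rewrite -big_mkcond -scaler_sumr -scaler_suml; congr (_ *: _).
rewrite (bigD1 a) //= (bigD1 b) /=; last by rewrite eq_sym.
rewrite eqxx (eqxx b) orbT !mulr1 big1 ?addr0 // => i /andP[/negbTE-> /negbTE->].
by rewrite mulr0.
Qed.

Let row0 u : \sum_v dot (B u) (B v) = 0.
Proof. by rewrite -dot_sumr B0 dot0r. Qed.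

Let S := \sum_(z in Z) B z.

(** Rows of the Gram matrix sum to 0 and [z] is adjacent only to [Z], [a] and [b]. This identity is
    what exchanges [a] and [b] in [flip_Zab]. *)
Let zS z : z \in Z -> dot (B z) S = - dot (B z) (B a) - dot (B z) (B b).
Proof.
move=> zZ; rewrite dot_sumr; have := row0 z; rewrite (bigID (fun v => v \in Z)) /=.
rewrite [X in _ + X](bigD1 a) //= [X in _ + (_ + X)](bigD1 b) /=; last by rewrite bZ eq_sym.
rewrite (big1 _ (fun v => _ && _)) => [|v /andP[/andP[vZ va] vb]]; last exact: noe.
by move: (\sum_(v in Z) _) => X; clear; lia.
Qed.

Let yS y : y \notin Z -> y != a -> y != b -> dot (B y) S = 0.
Proof. by move=> yZ ya yb; rewrite dot_sumr big1 // => z zZ; rewrite dotC; exact: noe. Qed.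

Let flipa : flip a = B a + S. Proof. by rewrite /flip (negbTE aZ) eqxx scale1r. Qed.
Let flipb : flip b = B b + S. Proof. by rewrite /flip (negbTE bZ) eqxx orbT scale1r. Qed.
Let flipz z : z \in Z -> flip z = - B z. Proof. by rewrite /flip => ->. Qed.
Let flipy y : y \notin Z -> y != a -> y != b -> flip y = B y.
Proof. by rewrite /flip => /negbTE-> /negbTE-> /negbTE->; rewrite scale0r addr0. Qed.

Lemma flip_ZZ z z' : z \in Z -> z' \in Z -> dot (flip z) (flip z') = dot (B z) (B z').
Proof. by move=> zZ zZ'; rewrite !flipz // dotNl dotNr opprK. Qed.

Lemma flip_Y y y' : y \notin Z -> y != a -> y != b -> y' \notin Z ->
  dot (flip y) (flip y') = dot (B y) (B y').
Proof.
move=> yZ ya yb y'Z; rewrite (flipy y) //.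
have [->|y'a] := eqVneq y' a; first by rewrite flipa dotDr yS // addr0.
have [->|y'b] := eqVneq y' b; first by rewrite flipb dotDr yS // addr0.
by rewrite flipy.
Qed.

Lemma flip_Zab z : z \in Z ->
  dot (flip z) (flip a) = dot (B z) (B b) /\ dot (flip z) (flip b) = dot (B z) (B a).
Proof.
by move=> zZ; rewrite flipz // flipa flipb !dotNl !dotDr zS //; split; ring.
Qed.

Lemma flip_ZY z y : z \in Z -> y \notin Z -> y != a -> y != b -> dot (flip z) (flip y) = 0.
Proof. by move=> zZ yZ ya yb; rewrite flipz // flipy // dotNl noe // oppr0. Qed.

Lemma flip_ab : dot (flip a) (flip b) = 0.
Proof.
have SS : dot S S = - dot S (B a) - dot S (B b).
  rewrite {1}/S dot_suml (eq_bigr _ zS) sumrB sumrN.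
  by rewrite (dot_suml _ _ _ _ (B a)) (dot_suml _ _ _ _ (B b)).
by rewrite flipa flipb !(dotDl, dotDr) wab SS (dotC _ (B a) S); ring.
Qed.

Lemma flip_sbase : sbase r n s B -> sbase r n s flip.
Proof.
move=> [BL Bspan _ obt Bker].
have Sorth : dot S s = 0 by rewrite dot_suml big1.
split.
- move=> v; rewrite /flip; case: (v \in Z); first by rewrite dotNl BL oppr0.
  by rewrite dotDl dotZl -/S Sorth BL mulr0.
- move=> v /Bspan[f ->]; exists (flip_fun f); rewrite lincomb_flip.
  apply: eq_lincomb => i; rewrite /flip_fun (negbTE aZ) (negbTE bZ).
  by case: (i \in Z) => //; ring.
- have : lincomb r n flip (fun=> 1) = 0.
    rewrite lincomb_flip -(lincomb_cst r n B B0 1); apply: eq_lincomb => i.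
    by rewrite /flip_fun; case: (i \in Z).
  by rewrite /lincomb; under eq_bigr do rewrite scale1r.
- suff h i j : i != j -> (i \in Z -> j \notin Z -> dot (flip i) (flip j) <= 0) /\
      (i \in Z = (j \in Z) -> dot (flip i) (flip j) <= 0).
    move=> i j ij; have ji : j != i by rewrite eq_sym.
    have [h1 h2] := h i j ij; have [h3 _] := h j i ji.
    case iZ : (i \in Z); case jZ : (j \in Z).
    + by apply: h2; rewrite iZ jZ.
    + by apply: h1; rewrite ?jZ.
    + by rewrite dotC; apply: h3; rewrite ?iZ.
    + by apply: h2; rewrite iZ jZ.
  move=> ij; split=> [iZ jZ|e].
    have [ia ib] : i != a /\ i != b by split; apply: contraTneq iZ => ->.
    have [e1 e2] := flip_Zab i iZ.
    have [->|ja] := eqVneq j a; first by rewrite e1 obt.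
    have [->|jb] := eqVneq j b; first by rewrite e2 obt.
    by rewrite flip_ZY.
  case iZ : (i \in Z) e => jZ; first by rewrite flip_ZZ // obt.
  have iZ' := negbT iZ; have jZ' := negbT (esym jZ).
  case: (boolP ((i != a) && (i != b))) => [/andP[ia ib]|]; first by rewrite flip_Y // obt.
  case: (boolP ((j != a) && (j != b))) => [/andP[ja jb] _|]; first by rewrite dotC flip_Y // obt // eq_sym.
  rewrite !negb_and !negbK => /orP[/eqP jE|/eqP jE] /orP[/eqP iE|/eqP iE]; move: ij; rewrite iE jE ?eqxx //.
    by rewrite dotC flip_ab.
  by rewrite flip_ab.
- move=> f; rewrite lincomb_flip => /Bker h.
  have h' v : flip_fun f v = f a by rewrite (h v a) /flip_fun (negbTE aZ).
  have fba : f b = f a by rewrite -(h' b) /flip_fun (negbTE bZ).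
  suff g i : f i = f a by move=> i j; rewrite !g.
  have := h' i; rewrite /flip_fun fba; case: (i \in Z) => //; clear; lia.
Qed.

End Flip.

(** * Concentrating the first coordinate on two vertices *)

Section Reduce.
Variables (r n : nat) (s : 'rV[int]_r) (o0 : 'I_r).
Hypothesis col : forall B : 'I_n -> 'rV[int]_r, sbase r n s B -> exists E : rel 'I_n,
  [/\ forall f, (forall i j, 0 < weight r n B i j -> E i j -> f i = f j) -> (lincomb r n B f) 0 o0 = 0,
      forall f, (forall i j, 0 < weight r n B i j -> ~~ E i j -> f i = f j) -> (lincomb r n B f) 0 o0 = 0,
      forall f, (lincomb r n B f) 0 o0 = 0 -> exists f1 f2 : 'I_n -> int, [/\ forall i, f i = f1 i + f2 i,
        forall i j, 0 < weight r n B i j -> E i j -> f2 i = f2 j &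
        forall i j, 0 < weight r n B i j -> ~~ E i j -> f1 i = f1 j] &
      exists f, (lincomb r n B f) 0 o0 = 1].

Let wt_dot (B : 'I_n -> 'rV[int]_r) i j : weight r n B i j = 0 -> dot (B i) (B j) = 0.
Proof. by rewrite /weight => /eqP; rewrite oppr_eq0 => /eqP. Qed.

Lemma pair_step B a b : sbase r n s B -> a != b -> B a 0 o0 != 0 -> B b 0 o0 != 0 ->
  exists2 Z, separates r n B a b Z & B a 0 o0 = - B b 0 o0 \/
  [/\ B a 0 o0 = B b 0 o0, dot (B a) (B b) = 0 & \sum_(z in Z) B z 0 o0 = - B a 0 o0].
Proof.
move=> sb ab xa xb; have [E [c1 c2 c3 _]] := col B sb; have [_ _ _ obt _] := sb.
have [Z [aZ bZ noe [cn1 cn2 alt]]] := separation r n B o0 E obt c1 c2 c3 a b ab xa xb.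
exists Z; first by split=> // z y zZ yZ ya yb; apply: wt_dot; apply: noe.
by case: alt => [->|[-> /wt_dot-> e]]; [left|right].
Qed.

(** Induction on the sum of the [|x v|]: a twist along two equal nonzero values makes both 0 and
    changes only signs elsewhere. Once no two are equal, nonzero values are pairwise opposite, so
    there are at most two of them. *)
Lemma reduce_to_unit B : sbase r n s B -> exists B' a b Z,
  [/\ sbase r n s B', a != b, separates r n B' a b Z,
      [/\ B' a 0 o0 = 1, B' b 0 o0 = -1 & forall v, v != a -> v != b -> B' v 0 o0 = 0] &
      planar_multigraph (gram r n B) -> planar_multigraph (gram r n B')].
Proof.
move: {2}(\sum_v `|(B v 0 o0)%R|)%N (leqnn (\sum_v `|(B v 0 o0)%R|)%N) => N.
elim: N B => [|N IH] B hN sb.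
  have [E [_ _ _ [f hf]]] := col B sb; exfalso; move: hf.
  have x0 v : B v 0 o0 = 0.
    by move: hN; rewrite leqn0 sum_nat_eq0 => /forallP/(_ v)/=; rewrite absz_eq0 => /eqP.
  by rewrite /lincomb summxE big1 // => i _; rewrite rowZ x0 mulr0.
have [/existsP[a /existsP[b /and4P[ab xa xb /eqP xab]]]|nsame] :=
  boolP [exists a, exists b, [&& a != b, B a 0 o0 != 0, B b 0 o0 != 0 & B a 0 o0 == B b 0 o0]].
  have [Z sep [ne|[_ dab sZ]]] := pair_step B a b sb ab xa xb.
    by move: xa xab ne; clear; lia.
  have [aZ bZ noe _ _] := sep; have [_ _ B0 _ _] := sb.
  pose B1 := flip r n B a b Z.
  have sb1 : sbase r n s B1 by apply: flip_sbase.
  have [] := IH B1 _ sb1; last first.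
    move=> B' [a' [b' [Z' [h1 h2 h3 h4 h5]]]]; exists B', a', b', Z'; split=> // pl; apply: h5.
    apply: (gram_glue _ _ _ B _ a b Z true) => //.
    - by move=> z z' zZ zZ'; apply: flip_ZZ.
    - by move=> y y' *; apply: flip_Y.
    - by move=> z zZ; apply: flip_Zab.
    - by move=> z y *; apply: flip_ZY.
  have xS : (\sum_(z in Z) B z) 0 o0 = - B a 0 o0 by rewrite summxE.
  have B1a : B1 a 0 o0 = 0 by rewrite /B1 /flip (negbTE aZ) eqxx scale1r rowD xS subrr.
  have B1b : B1 b 0 o0 = 0 by rewrite /B1 /flip (negbTE bZ) eqxx orbT scale1r rowD xS xab subrr.
  have le v : (`|(B1 v 0 o0)%R| <= `|(B v 0 o0)%R|)%N.
    have [->|va] := eqVneq v a; first by rewrite B1a.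
    have [->|vb] := eqVneq v b; first by rewrite B1b.
    rewrite /B1 /flip (negbTE va) (negbTE vb) scale0r addr0.
    by case: (v \in Z); rewrite // mxE abszN.
  rewrite -ltnS; apply: leq_trans hN; rewrite (bigD1 a) // [X in (_ < X)%N](bigD1 a) //= B1a.
  by rewrite absz0 add0n -add1n leq_add ?absz_gt0 //; apply: leq_sum.
have [E [_ _ _ [f hf]]] := col B sb.
have sx : \sum_v B v 0 o0 = 0 by have [_ _ B0 _ _] := sb; rewrite -summxE B0 mxE.
have [a xa|x0] := pickP (fun v => 0 < B v 0 o0); last first.
  have x0' v : B v 0 o0 = 0.
    have np u : 0 <= - B u 0 o0 by have := x0 u; clear; lia.
    have : \sum_v - B v 0 o0 = 0 by rewrite sumrN sx oppr0.
    by move/psumr_eq0P => h; have := h (fun u _ => np u) v isT; clear; lia.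
  by move: hf; rewrite /lincomb summxE big1 // => i _; rewrite rowZ x0' mulr0.
have alt u v : u != v -> B u 0 o0 != 0 -> B v 0 o0 != 0 -> B u 0 o0 = - B v 0 o0.
  move=> uv xu xv; have [Z _ [//|[e _ _]]] := pair_step B u v sb uv xu xv.
  case/negP: nsame; apply/existsP; exists u; apply/existsP; exists v.
  by rewrite uv xu xv e eqxx.
have xa0 : B a 0 o0 != 0 by rewrite gt_eqF.
have [b /andP[ab xb]|x0] := pickP (fun v => (a != v) && (B v 0 o0 != 0)); last first.
  move: sx; rewrite (bigD1 a) //= big1 ?addr0 => [e|v va]; first by rewrite e eqxx in xa0.
  by apply/eqP; move: (x0 v); rewrite eq_sym va /= => /negbFE.
have xab := alt a b ab xa0 xb.
have oth v : v != a -> v != b -> B v 0 o0 = 0.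
  move=> va vb; apply/eqP/negPn/negP => xv.
  by have := alt v a va xv xa0; have := alt v b vb xv xb; move: xab xa0; clear; lia.
have a1 : B a 0 o0 = 1.
  move: hf; rewrite /lincomb summxE (bigD1 a) //= (bigD1 b) /=; last by rewrite eq_sym.
  rewrite big1 ?addr0 => [|v /andP[va vb]]; last by rewrite rowZ oth // mulr0.
  (* Some vector has first coordinate 1, so [x a] divides 1. *)
  rewrite !rowZ => h; have : (B a 0 o0) * (f a - f b) = 1 by move: h; rewrite xab; clear; move=> <-; ring.
  move: xa; move: (B a 0 o0) (f a - f b) => p q; clear => p0 e.
  have : (p %| 1)%Z by apply/dvdzP; exists q; rewrite mulrC.
  by rewrite dvdz1; move: p0; clear; lia.
have [Z sep _] := pair_step B a b sb ab xa0 xb.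
exists B, a, b, Z; split=> //; split=> //; by move: xab; rewrite a1; clear; lia.
Qed.

End Reduce.

(** * Linear relations in a superbase *)

Section Kernel.
Variables (d k : nat) (b : 'I_k -> 'rV[int]_d) (B : 'I_k.+1 -> 'rV[int]_d).
Hypothesis bfree : forall c : 'I_k -> int, \sum_i c i *: b i = 0 -> forall i, c i = 0.
Variables (M : 'M[int]_(k.+1, k)) (N : 'M[int]_(k, k.+1)).
Hypothesis BE : forall i, B i = \sum_j M i j *: b j.
Hypothesis bE : forall j, b j = \sum_i N j i *: B i.
Hypothesis B0 : \sum_i B i = 0.

Let lincombM (f : 'I_k.+1 -> int) : lincomb d k.+1 B f = 0 -> (\row_i f i) *m M = 0.
Proof.
move=> h; apply/rowP => j; rewrite [RHS]mxE; move: j; apply: bfree; rewrite -[RHS]h /lincomb.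
under [RHS]eq_bigr => i _ do rewrite BE scaler_sumr.
rewrite exchange_big /=; apply: eq_bigr => j _; rewrite mxE scaler_suml.
by apply: eq_bigr => i _; rewrite scalerA mxE.
Qed.

Let NM : N *m M = 1%:M.
Proof.
apply/matrixP => i j; apply/eqP; rewrite -subr_eq0; apply/eqP; move: j; apply: bfree.
have e1 : \sum_j (1%:M : 'M[int]_k) i j *: b j = b i.
  rewrite (bigD1 i) //= mxE eqxx scale1r big1 ?addr0 // => j ji.
  by rewrite mxE eq_sym (negbTE ji) scale0r.
have e2 : \sum_j (N *m M) i j *: b j = b i.
  rewrite [RHS]bE; under [RHS]eq_bigr => l _ do rewrite BE scaler_sumr.
  rewrite exchange_big /=; apply: eq_bigr => j _.
  by rewrite mxE scaler_suml; apply: eq_bigr => l _; rewrite scalerA.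
by under eq_bigr => j _ do rewrite scalerBl; rewrite sumrB e1 e2 subrr.
Qed.

(** [N M = 1] gives [M] rank [k] over the rationals, so its left kernel is a line, spanned by the
    all-ones vector. *)
Lemma kernel_constant f : lincomb d k.+1 B f = 0 -> forall i j, f i = f j.
Proof.
move=> /lincombM fM i j.
have oM : (\row_i (1 : int)) *m M = 0.
  by apply: lincombM; rewrite /lincomb; under eq_bigr do rewrite scale1r.
pose Mq := map_mx (intr : int -> rat) M; pose Nq := map_mx (intr : int -> rat) N.
have rkM : \rank Mq = k.
  apply/eqP; rewrite eqn_leq rank_leq_col /=.
  have e : \rank (Nq *m Mq) = k by rewrite -map_mxM NM map_mx1 mxrank1.
  by have := mxrankM_maxr Nq Mq; rewrite e.
pose fq : 'rV[rat]_k.+1 := \row_i (f i)%:~R; pose oq : 'rV[rat]_k.+1 := const_mx 1.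
have fk : (fq <= kermx Mq)%MS.
  apply/sub_kermxP; rewrite -(map_mx0 (intr : int -> rat)) -fM map_mxM; congr (_ *m _).
  by apply/rowP => c; rewrite !mxE.
have ok : (oq <= kermx Mq)%MS.
  apply/sub_kermxP; rewrite -(map_mx0 (intr : int -> rat)) -oM map_mxM; congr (_ *m _).
  by apply/rowP => c; rewrite !mxE.
have rko : \rank oq = 1%N.
  by rewrite rank_rV; case: eqP => // /rowP/(_ 0); rewrite !mxE => /eqP; rewrite oner_eq0.
have ke : (kermx Mq <= oq)%MS.
  by rewrite -(mxrank_leqif_sup ok) mxrank_ker rkM rko subSnn.
have /sub_rVP[c hc] := submx_trans fk ke.
have e u : (f u)%:~R = c :> rat by have := congr1 (fun z : 'rV_k.+1 => z 0 u) hc; rewrite !mxE mulr1.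
by apply/eqP; rewrite -(eqr_int rat) !e.
Qed.
End Kernel.

Lemma superbase_sbase r (s : 'rV[int]_r) k (B : 'I_k.+1 -> 'rV[int]_r) :
  obtuse_superbase (cm_lattice s) B -> sbase r k.+1 s B.
Proof.
move=> [[b [bL [bfree bspan]]] [BL [Bspan [obt B0]]]]; split=> //.
(* Finite choice needs a finitely indexed family of finite functions, hence the compatibility with
   pointwise equality. *)
have choose n m (P : 'I_n -> ('I_m -> int) -> Prop) : (forall i, exists c, P i c) ->
    (forall i c c', c =1 c' -> P i c -> P i c') -> exists M : 'M[int]_(n, m), forall i, P i (M i).
  move=> h e; have [c hc] : exists c : 'I_n -> {ffun 'I_m -> int}, forall i, P i (c i).
    by apply: (@fin_all_exists _ (fun=> {ffun 'I_m -> int}) (fun i c => P i c)) => i; have [c hc] := h i; exists (finfun c); apply: (e i c _ _ hc) => j; rewrite ffunE.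
  by exists (\matrix_(i, j) c i j) => i; apply: (e i (c i) _ _ (hc i)) => j; rewrite mxE.
have [M hM] := choose _ _ (fun i c => B i = \sum_(j < k) c j *: b j) (fun i => bspan _ (BL i))
  (fun i c c' e h => etrans h (eq_bigr _ (fun j _ => congr1 (fun z => z *: b j) (e j)))).
have [N hN] := choose _ _ (fun i c => b i = \sum_(j < k.+1) c j *: B j) (fun i => Bspan _ (bL i))
  (fun i c c' e h => etrans h (eq_bigr _ (fun j _ => congr1 (fun z => z *: B j) (e j)))).
exact: (kernel_constant _ _ b B bfree M N).
Qed.

(** * Changemaker vectors *)

Section Changemaker.
Variables (r : nat) (s : 'rV[int]_r).
Hypothesis cm : is_changemaker s.

Lemma cm_ge1 i : 1 <= s 0 i.
Proof.
have [_ [h0 hS]] := cm; case: i => i; elim: i => [|i IH] hi; first by rewrite h0.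
apply: le_trans (IH (ltnW hi)) _.
by have [] := hS (Ordinal hi) (Ordinal (ltnW hi)) erefl.
Qed.

Lemma cm_mono (i j : 'I_r) : (i <= j)%N -> s 0 i <= s 0 j.
Proof.
have [_ [_ hS]] := cm; case: i => i hi; case: j => j /=; elim: j => [|j IH] hj /= ij.
  have e : i = 0%N by move: ij; rewrite leqn0 => /eqP.
  by rewrite (_ : Ordinal hi = Ordinal hj) //; apply: val_inj.
move: ij; rewrite leq_eqVlt => /orP[/eqP e|].
  by rewrite (_ : Ordinal hi = Ordinal hj) //; apply: val_inj.
rewrite ltnS => /(IH (ltnW hj)) h; apply: le_trans h _.
by have [] := hS (Ordinal hj) (Ordinal (ltnW hj)) erefl.
Qed.

Lemma cm_unit_or i : s 0 i = 1 \/ 1 < s 0 i.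
Proof. by have := cm_ge1 i; rewrite le_eqVlt => /orP[/eqP<-|]; [left|right]. Qed.

Lemma sorted_units (S : seq int) : sorted <=%R S -> all (<=%R 1) S ->
  S = nseq (count (pred1 1) S) 1 ++ [seq x <- S | 1 < x].
Proof.
elim: S => //= x S IH xS /andP[x1 S1].
move: x1; rewrite le_eqVlt => /orP[/eqP<-|x1].
  by rewrite eqxx ltxx /= -IH // (path_sorted xS).
rewrite x1 (gt_eqF x1) /=.
have allS : all (fun y => 1 < y) S.
  have /allP h := order_path_min le_trans xS.
  by apply/allP => y yS; exact: lt_le_trans x1 (h y yS).
rewrite (all_filterP allS).
have -> : count (pred1 1) S = 0%N.
  apply/eqP; rewrite -leqn0 leqNgt -has_count; apply/hasPn => y yS /=.
  by rewrite gt_eqF //; exact: (allP allS y yS).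
by [].
Qed.

Lemma nth_row i (hi : (i < r)%N) : nth 0 [seq s 0 i | i <- enum 'I_r] i = s 0 (Ordinal hi).
Proof.
rewrite (nth_map (Ordinal hi)) ?size_enum_ord //; congr (s 0 _).
by apply: val_inj; rewrite /= nth_enum_ord.
Qed.

Lemma cm_seq : [seq s 0 i | i <- enum 'I_r] =
  nseq (count (pred1 1) [seq s 0 i | i <- enum 'I_r]) 1 ++ stable_coeffs s.
Proof.
have so : sorted <=%R [seq s 0 i | i <- enum 'I_r].
  apply/(sortedP 0) => i; rewrite size_map size_enum_ord => hi.
  by rewrite (nth_row i (ltnW hi)) (nth_row i.+1 hi); apply: cm_mono => /=.
rewrite {1}(sorted_units _ so); first by rewrite /stable_coeffs filter_map.
by apply/allP => x /mapP[i _ ->]; apply: cm_ge1.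
Qed.

Hypothesis vs : very_slack s.

(** Greedy from the top. Very slackness, with the two initial ones moved out of the sum, bounds each
    entry by 1 plus the sum of the eligible entries below it, so no value is skipped. *)
Lemma subset_sum m (N : int) : (m <= r)%N -> 0 <= N <= \sum_(l < r | (1 < l < m)%N) s 0 l ->
  (forall l : 'I_r, (l <= 2)%N -> s 0 l = 1) ->
  exists A : {set 'I_r}, (forall l, l \in A -> (1 < l < m)%N) /\ \sum_(l in A) s 0 l = N.
Proof.
move=> mr hN units; elim: m mr N hN => [|m IH] mr N /andP[N0].
  rewrite big1 => [hN|l]; last by rewrite ltn0 andbF.
  exists set0; split=> [l|]; first by rewrite inE.
  by rewrite big_set0; apply/eqP; rewrite eq_le N0 hN.
have [m1|m1] := leqP m 1.
  rewrite big1 => [hN|l /andP[h1 h2]]; last by move: h1; rewrite ltnNge (leq_trans _ m1).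
  exists set0; split=> [l|]; first by rewrite inE.
  by rewrite big_set0; apply/eqP; rewrite eq_le N0 hN.
pose k := Ordinal mr.
have Sm : \sum_(l < r | (1 < l < m.+1)%N) s 0 l = s 0 k + \sum_(l < r | (1 < l < m)%N) s 0 l.
  rewrite (bigD1 k) /=; last by rewrite m1 /=.
  congr (_ + _); apply: eq_bigl => l; rewrite -val_eqE /= ltnS (ltn_neqAle l m).
  by case: (1 < l)%N; rewrite //= andbC.
have Sk : \sum_(l < r | (l < m)%N) s 0 l = 2 + \sum_(l < r | (1 < l < m)%N) s 0 l.
  have m0 : (0 < r)%N by exact: leq_trans (ltn0Sn m) mr.
  have m1' : (1 < r)%N by exact: leq_trans m1 (ltnW mr).
  rewrite (bigD1 (Ordinal m0)) /=; last by apply: ltnW.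
  rewrite (bigD1 (Ordinal m1')) /=; last by rewrite m1.
  rewrite !units // addrA; congr (_ + _); apply: eq_bigl => l; rewrite -!val_eqE /=.
  by case: (nat_of_ord l) => [|[|l']] //=; rewrite ?andbF ?andbT.
rewrite Sm => hN; have [le|gt] := leP N (\sum_(l < r | (1 < l < m)%N) s 0 l).
  have [|A [hA sA]] := IH (ltnW mr) N; first by rewrite N0.
  exists A; split=> // l /hA /andP[-> h] /=; exact: ltnW.
have kle : s 0 k <= 1 + \sum_(l < r | (1 < l < m)%N) s 0 l.
  case: (cm_unit_or k) => sk.
    by rewrite sk lerDl sumr_ge0 // => l _; apply: le_trans (cm_ge1 l).
  by have := vs k sk; rewrite /= Sk; move: (\sum_(l < r | _) _) => X; clear; lia.
have [|A [hA sA]] := IH (ltnW mr) (N - s 0 k).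
  by move: kle gt hN; move: (\sum_(l < r | _) _) => X; clear; lia.
have kA : k \notin A by apply/negP => /hA; rewrite /= ltnn andbF.
exists (k |: A); split=> [l|]; last by rewrite big_setU1 //= sA addrC subrK.
by rewrite !inE => /orP[/eqP->|/hA/andP[-> h]] /=; [rewrite m1 ltnSn|exact: ltnW].
Qed.

(** [k0] is the first stable index; very slackness puts at least three ones below it. The set [Ak k]
    is [o1] together with a solution of [subset_sum] for [s_k - 1], which uses neither [o0] nor
    [o1]. *)
Lemma standard_sets : (exists i, 1 < s 0 i) -> exists (o0 o1 o2 k0 : 'I_r) (Ak : 'I_r -> {set 'I_r}),
  [/\ [/\ o0 = 0%N :> nat, o1 = 1%N :> nat & o2 = 2%N :> nat],
      [/\ s 0 o0 = 1, s 0 o1 = 1 & s 0 o2 = 1],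
      forall k, 1 < s 0 k ->
        [/\ is_std r s (Ak k) k, o1 \in Ak k, o0 \notin Ak k & forall i, i \in Ak k -> (i < k)%N],
      1 < s 0 k0 & forall i, i \in Ak k0 -> s 0 i = 1].
Proof.
move=> [i0 hi0].
case: (@arg_minnP _ i0 (fun i => 1 < s 0 i) (@nat_of_ord r) hi0) => k0 k0s k0min.
have below (i : 'I_r) : (i < k0)%N -> s 0 i = 1.
  by move=> ik; case: (cm_unit_or i) => // /k0min; rewrite leqNgt ik.
have k03 : (2 < k0)%N.
  have := vs k0 k0s; rewrite (eq_bigr (fun=> 1)) => [|l]; last exact: below.
  have -> : \sum_(l < r | (l < k0)%N) (1 : int) = k0%:Z.
    rewrite (big_ord_narrow (ltnW (ltn_ord k0))) big_const_ord iter_addr addr0.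
    by rewrite -[RHS]natz.
  by move: k0s; clear; lia.
have lr i : (i <= 2)%N -> (i < r)%N by move=> i2; apply: leq_trans (ltn_ord k0); rewrite ltnS ltnW // (leq_ltn_trans i2).
pose o0 := Ordinal (lr 0%N isT); pose o1 := Ordinal (lr 1%N isT); pose o2 := Ordinal (lr 2%N isT).
have units (l : 'I_r) : (l <= 2)%N -> s 0 l = 1 by move=> l2; apply: below; apply: leq_ltn_trans k03.
have ge3 k : 1 < s 0 k -> (2 < k)%N.
  by rewrite ltnNge => h; apply/negP => /units e; move: h; rewrite e ltxx.
have ex k : exists A : {set 'I_r}, 1 < s 0 k ->
    (forall l, l \in A -> (1 < l < k)%N) /\ \sum_(l in A) s 0 l = s 0 k - 1.
  case: (cm_unit_or k) => [->|sk]; first by exists set0; rewrite ltxx.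
  have [|A hA] := subset_sum k (s 0 k - 1) (ltnW (ltn_ord k)) _ units; last by exists A.
  have := vs k sk; rewrite (bigD1 o0) /=; last exact: leq_trans (ge3 k sk).
  rewrite (bigD1 o1) /=; last by rewrite (leq_trans _ (ge3 k sk)).
  rewrite (units o0) // (units o1) //.
  have -> : \sum_(l < r | (l < k)%N && (l != o0) && (l != o1)) s 0 l = \sum_(l < r | (1 < l < k)%N) s 0 l.
    by apply: eq_bigl => l; rewrite -!val_eqE /=; case: (nat_of_ord l) => [|[|l']] //=; rewrite ?andbF ?andbT.
  by move: (\sum_(l < r | _) _) sk => X; clear; lia.
have [A hA] := fin_all_exists ex.
exists o0, o1, o2, k0, (fun k => o1 |: A k); split=> //; first by split; apply: units.
  move=> k sk; have [hl hs] := hA k sk.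
  have o1A : o1 \notin A k by apply/negP => /hl.
  have lt i : i \in o1 |: A k -> (i < k)%N.
    by rewrite !inE => /orP[/eqP->|/hl/andP[]//]; apply: leq_trans (ge3 k sk).
  split=> //; first split; first by apply/negP => /lt; rewrite ltnn.
  - by rewrite big_setU1 //= hs units // addrC subrK.
  - by rewrite !inE eqxx.
  - by rewrite !inE -val_eqE /=; apply/negP => /hl.
move=> i; have [hl _] := hA k0 k0s.
by rewrite !inE => /orP[/eqP->|/hl/andP[_ h]]; [apply: units|apply: below].
Qed.

End Changemaker.

(** * Changemakers with the same stable coefficients *)

Section SameStable.
Variables (r s n : nat) (sigma : 'rV[int]_r) (tau : 'rV[int]_s).
Hypotheses (cms : is_changemaker sigma) (cmt : is_changemaker tau).
Hypothesis same : stable_coeffs tau = stable_coeffs sigma.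
Hypotheses (ns : dot sigma sigma = n%:Z) (nt : dot tau tau = n%:Z - 1).

Lemma dot_seq d (v : 'rV[int]_d) : dot v v = \sum_(x <- [seq v 0 i | i <- enum 'I_d]) x * x.
Proof. by rewrite big_map big_enum. Qed.

(** A changemaker is a run of ones followed by its stable coefficients, and the norms differ by 1,
    so [sigma] has exactly one more unit. *)
Lemma cm_seq_cons : [seq sigma 0 i | i <- enum 'I_r] = 1 :: [seq tau 0 i | i <- enum 'I_s].
Proof.
move: ns nt; rewrite !dot_seq (cm_seq _ _ cms) (cm_seq _ _ cmt) same.
move: (count _ _) (count _ _) (stable_coeffs sigma) => u' u S.
have e v : \sum_(x <- nseq v 1 ++ S) x * x = v%:Z + \sum_(x <- S) x * x.
  by rewrite big_cat /= big_nseq iter_addr addr0 mulr1 natz.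
rewrite !e => h1 h2; have -> : u = u'.+1; last by [].
by move: h1 h2; move: (\sum_(x <- S) _) => X; clear; lia.
Qed.

Lemma cm_size : r = s.+1.
Proof.
have /(congr1 size) := cm_seq_cons; rewrite size_map size_enum_ord => ->.
by rewrite -[LHS]/(size _).+1 size_map size_enum_ord.
Qed.
End SameStable.

Lemma cm_shift s n (sigma : 'rV[int]_s.+1) (tau : 'rV[int]_s) :
  is_changemaker sigma -> is_changemaker tau -> stable_coeffs tau = stable_coeffs sigma ->
  dot sigma sigma = n%:Z -> dot tau tau = n%:Z - 1 ->
  forall i, sigma 0 (lift ord0 i) = tau 0 i.
Proof.
move=> cms cmt same ns nt i.
have e : nth 0 [seq sigma 0 i | i <- enum 'I_s.+1] i.+1 = nth 0 [seq tau 0 i | i <- enum 'I_s] i.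
  by rewrite (cm_seq_cons _ _ _ _ _ cms cmt same ns nt).
rewrite (nth_row _ _ i.+1 (ltn_ord (lift ord0 i))) (nth_row _ _ i (ltn_ord i)) in e.
have -> : lift ord0 i = Ordinal (ltn_ord (lift ord0 i)) by apply: val_inj.
by rewrite e; congr (tau 0 _); apply: val_inj.
Qed.

(** * Comparing the two smaller lattices with [L_n] *)

Section Half.
Variables (s : nat) (sigma : 'rV[int]_s.+1) (tau : 'rV[int]_s).
Hypothesis sig0 : sigma 0 ord0 = 1.
Hypothesis sigS : forall i, sigma 0 (lift ord0 i) = tau 0 i.

Lemma dot_recl d (u v : 'rV[int]_d.+1) :
  dot u v = u 0 ord0 * v 0 ord0 + \sum_i u 0 (lift ord0 i) * v 0 (lift ord0 i).
Proof. by rewrite /dot big_ord_recl. Qed.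

Lemma dot_sigma x : dot x sigma = x 0 ord0 + \sum_i x 0 (lift ord0 i) * tau 0 i.
Proof. by rewrite dot_recl sig0 mulr1; congr (_ + _); apply: eq_bigr => i _; rewrite sigS. Qed.

(* [e_{-1} - e_0] is orthogonal to [y] exactly when its first two coordinates agree. *)
Definition dup (x : 'rV[int]_s.+1) : 'rV[int]_s.+2 := \row_i x 0 (inord i.-1).

Lemma dup0 x : dup x 0 ord0 = x 0 ord0.
Proof. by rewrite mxE; congr (x 0 _); apply: val_inj; rewrite /= inordK. Qed.
Lemma dupS x i : dup x 0 (lift ord0 i) = x 0 i.
Proof. by rewrite mxE; congr (x 0 _); apply: val_inj; rewrite /= inordK //= ltn_ord. Qed.

Lemma dot_dup x y : dot (dup x) (dup y) = dot x y + x 0 ord0 * y 0 ord0.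
Proof.
rewrite dot_recl !dup0 addrC; congr (_ + _).
by apply: eq_bigr => i _; rewrite !dupS.
Qed.

Lemma dup_sum (I : finType) (c : I -> int) (F : I -> 'rV[int]_s.+1) :
  dup (\sum_i c i *: F i) = \sum_i c i *: dup (F i).
Proof.
by apply/rowP => j; rewrite mxE !summxE; apply: eq_bigr => i _; rewrite !mxE.
Qed.

Lemma dup_eq0 x : dup x = 0 -> x = 0.
Proof. by move=> h; apply/rowP => i; rewrite -dupS h !mxE. Qed.

Lemma half_dot y : half_cm_lattice tau y <-> y 0 ord0 = y 0 (lift ord0 ord0) /\
  y 0 (lift ord0 ord0) + \sum_i y 0 (lift ord0 (lift ord0 i)) * tau 0 i = 0.
Proof.
have e1 : dot y (coord_e s.+2 0 - coord_e s.+2 1) = y 0 ord0 - y 0 (lift ord0 ord0).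
  rewrite dot_recl big_ord_recl big1 => [|i _]; rewrite !mxE /=.
    by rewrite subr0 sub0r mulr1 mulrN1 addr0.
  by rewrite subrr mulr0.
have e2 : dot y (coord_e s.+2 1 + shift2 tau) =
    y 0 (lift ord0 ord0) + \sum_i y 0 (lift ord0 (lift ord0 i)) * tau 0 i.
  rewrite dot_recl big_ord_recl !mxE /= addr0 mulr0 add0r addr0 mulr1; congr (_ + _).
  apply: eq_bigr => i _; rewrite !mxE /= add0r; congr (_ * _).
  (* Positions 0 and 1 belong to [e_{-1}] and [e_0]; the two bumps undo the shift in [shift2]. *)
  have -> : (bump 0 (bump 0 i) - 2)%N = i by rewrite /bump /=; lia.
  by rewrite (valK i).
rewrite /half_cm_lattice e1 e2; split=> -[h1 h2]; split=> //.
  by apply/eqP; rewrite -subr_eq0 h1.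
by rewrite h1 subrr.
Qed.

Lemma dup_half x : cm_lattice sigma x -> half_cm_lattice tau (dup x).
Proof.
rewrite /cm_lattice dot_sigma => h; apply/half_dot; rewrite dup0 !dupS; split=> //.
by rewrite -[RHS]h; congr (_ + _); apply: eq_bigr => i _; rewrite dupS.
Qed.

Lemma half_dup y : half_cm_lattice tau y -> exists2 x, cm_lattice sigma x & y = dup x.
Proof.
move=> /half_dot[h1 h2]; exists (\row_i y 0 (lift ord0 i)).
  rewrite /cm_lattice dot_sigma mxE -[RHS]h2; congr (_ + _).
  by apply: eq_bigr => i _; rewrite mxE.
apply/rowP => i; case: (unliftP ord0 i) => [j|] ->; first by rewrite dupS mxE.
by rewrite dup0 mxE.
Qed.

Lemma half_rank k : lattice_rank (cm_lattice sigma) k -> lattice_rank (half_cm_lattice tau) k.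
Proof.
move=> [b [bL [bfree bspan]]]; exists (fun i => dup (b i)); split=> [i|].
  exact: dup_half.
split=> [c|v /half_dup[x /bspan[c ->] ->]]; last by exists c; rewrite dup_sum.
by rewrite -dup_sum => /dup_eq0/bfree.
Qed.

(** [dup] adds [x u * x v] to the form, which changes off-diagonal products only at the pair [a],
    [b], by -1. So obtuseness persists, and the drawing gains one edge without reflecting a side. *)
Lemma half_superbase k (B : 'I_k.+1 -> 'rV[int]_s.+1) a b Z :
  lattice_rank (cm_lattice sigma) k -> sbase s.+1 k.+1 sigma B -> a != b ->
  separates s.+1 k.+1 B a b Z ->
  [/\ B a 0 ord0 = 1, B b 0 ord0 = -1 & forall v, v != a -> v != b -> B v 0 ord0 = 0] ->
  obtuse_superbase (half_cm_lattice tau) (fun i => dup (B i)) /\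
  (planar_multigraph (gram s.+1 k.+1 B) -> planar_superbase (fun i => dup (B i))).
Proof.
move=> rk [BL Bspan B0 obt _] ab sep [xa xb x0]; have [aZ bZ _ _ _] := sep.
have nZ z : z \in Z -> z != a /\ z != b by move=> zZ; split; apply: contraTneq zZ => ->.
split; last first.
  apply: (gram_glue _ _ _ B (fun i => dup (B i)) a b Z false sep ab).
  - by move=> z z' /nZ[za zb] _; rewrite dot_dup (x0 z) // mul0r addr0.
  - by move=> y y' _ ya yb _; rewrite dot_dup (x0 y) // mul0r addr0.
  - by move=> z /nZ[za zb]; rewrite !dot_dup (x0 z) // !mul0r !addr0.
  - move=> z y zZ yZ ya yb; have [_ _ noe _ _] := sep.
    by rewrite dot_dup (x0 y) // mulr0 addr0 noe.
split; first exact: half_rank.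
split=> [i|]; first by apply: dup_half; apply: BL.
split=> [v /half_dup[x /Bspan[f ->] ->]|]; first by exists f; rewrite dup_sum.
split=> [i j ij|]; last first.
  have := dup_sum 'I_k.+1 (fun=> 1) B.
  under eq_bigr do rewrite scale1r; rewrite B0; under eq_bigr do rewrite scale1r.
  by move=> <-; apply/rowP => i; rewrite !mxE.
rewrite dot_dup; have := obt i j ij.
have [ia|ia] := eqVneq i a.
  have [jb|jb] := eqVneq j b; first by rewrite ia jb xa xb; clear; lia.
  by rewrite (x0 j) ?mulr0 ?addr0 // -ia eq_sym.
have [ib|ib] := eqVneq i b; last by rewrite (x0 i) // mul0r addr0.
have [ja|ja] := eqVneq j a; first by rewrite ib ja xa xb; clear; lia.
by rewrite (x0 j) ?mulr0 ?addr0 // -ib eq_sym.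
Qed.

(** An isometry of the lattice of [tau] onto the vectors of [L_n] with vanishing first
    coordinate. *)
Definition pad (y : 'rV[int]_s) : 'rV[int]_s.+1 :=
  \row_i (if unlift ord0 i is Some j then y 0 j else 0).

Lemma pad0 y : pad y 0 ord0 = 0. Proof. by rewrite mxE unlift_none. Qed.
Lemma padS y i : pad y 0 (lift ord0 i) = y 0 i. Proof. by rewrite mxE liftK. Qed.

Lemma pad_lin x y : pad (x - y) = pad x - pad y.
Proof.
by apply/rowP => i; rewrite !mxE; case: (unlift ord0 i) => [j|]; rewrite ?mxE ?subr0.
Qed.

Lemma dot_pad x y : dot (pad x) (pad y) = dot x y.
Proof.
rewrite dot_recl !pad0 mulr0 add0r; apply: eq_bigr => i _; by rewrite !padS.
Qed.

Lemma pad_orth y : dot (pad y) sigma = dot y tau.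
Proof. by rewrite dot_sigma pad0 add0r; apply: eq_bigr => i _; rewrite padS. Qed.

Lemma padP (x : 'rV[int]_s.+1) : x 0 ord0 = 0 -> exists y, x = pad y.
Proof.
move=> x0; exists (\row_i x 0 (lift ord0 i)); apply/rowP => i.
by case: (unliftP ord0 i) => [j|] ->; rewrite ?padS ?pad0 ?mxE.
Qed.

Lemma pad_inj : injective pad.
Proof. by move=> x y h; apply/rowP => i; rewrite -!padS h. Qed.

Lemma decomposable_pad :
  decomposable (fun x => dot x sigma = 0 /\ x 0 ord0 = 0) -> decomposable (cm_lattice tau).
Proof.
have pad00 : pad 0 = 0 by rewrite -[X in pad X](subrr 0) pad_lin subrr.
have sub M : sublattice (fun x => dot x sigma = 0 /\ x 0 ord0 = 0) M ->
    sublattice (cm_lattice tau) (fun y => M (pad y)).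
  move=> [M0 [MB Ms]]; split; first by rewrite pad00.
  by split=> [x y|x /Ms[h _]]; [rewrite pad_lin; apply: MB|rewrite /cm_lattice -pad_orth].
have non M : sublattice (fun x => dot x sigma = 0 /\ x 0 ord0 = 0) M ->
    (exists x, M x /\ x <> 0) -> exists y, M (pad y) /\ y <> 0.
  move=> [_ [_ Ms]] [x [xM xn]]; have [_ /padP[y xy]] := Ms x xM.
  by exists y; rewrite -xy; split=> // y0; apply: xn; rewrite xy y0 pad00.
move=> [M1 [M2 [s1 [s2 [n1 [n2 [orth [triv tot]]]]]]]].
exists (fun y => M1 (pad y)), (fun y => M2 (pad y)); split; first exact: sub.
split; first exact: sub.
split; first exact: non. split; first exact: non.
split=> [x y h1 h2|]; first by rewrite -dot_pad orth.
split=> [x h1 h2|v hv]; first by apply: pad_inj; rewrite pad00; apply: triv.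
have [|x [y [h1 [h2 e]]]] := tot (pad v); first by rewrite pad_orth pad0.
have [_ [_ Ms1]] := s1; have [_ [_ Ms2]] := s2.
have [_ /padP[x' ex]] := Ms1 x h1; have [_ /padP[y' ey]] := Ms2 y h2.
exists x', y'; rewrite -ex -ey; split=> //; split=> //; apply: pad_inj.
by rewrite e ex ey -[y' in RHS]opprK pad_lin -[- y']sub0r pad_lin pad00 sub0r opprK.
Qed.

End Half.

Theorem theorem5p11 (r n : nat) (sigma : 'rV[int]_r) (k : nat)
    (B : 'I_k.+1 -> 'rV[int]_r) (s : nat) (tau : 'rV[int]_s) :
  is_changemaker sigma -> very_slack sigma ->
  (forall i : 'I_r, (i.+1 = r)%N -> 1 < sigma 0 i) ->
  dot sigma sigma = n%:Z ->
  obtuse_superbase (cm_lattice sigma) B ->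
  is_changemaker tau -> dot tau tau = n%:Z - 1 ->
  stable_coeffs tau = stable_coeffs sigma ->
  ((exists (k' : nat) (B' : 'I_k'.+1 -> 'rV[int]_(s.+2)),
      obtuse_superbase (half_cm_lattice tau) B') /\
   (planar_superbase B ->
    exists (k' : nat) (B' : 'I_k'.+1 -> 'rV[int]_(s.+2)),
      obtuse_superbase (half_cm_lattice tau) B' /\ planar_superbase B')) /\
  decomposable (cm_lattice tau).
Proof.
move=> cms vs last ns ob cmt nt same.
have er : r = s.+1 by apply: (cm_size _ _ _ _ _ cms cmt same ns nt).
subst r.
have sigS := cm_shift _ _ _ _ cms cmt same ns nt.
have ex : exists i, 1 < sigma 0 i by exists ord_max; apply: last.
have [o0 [o1 [o2 [k0 [Ak [[o0E o1E o2E] [s0 s1 s2] st k0s k0u]]]]]] := standard_sets _ _ cms vs ex.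
have e0 : o0 = ord0 by apply: val_inj.
subst o0.
have pos i : 0 < sigma 0 i by apply: lt_le_trans (cm_ge1 _ _ cms i).
have sb := superbase_sbase _ _ _ _ ob.
have [rk _] := ob; split; last first.
  apply: (decomposable_pad _ _ _ s0 sigS); have [BL Bspan B0 obt Bker] := sb.
  exact: (ker_coord_decomposable _ _ _ B pos BL Bspan B0 obt Bker _ o1 o2 o0E o1E o2E s0 s1 s2 Ak st k0).
(* The colouring is provided for all superbases, because the reduction uses it again after every
   twist. *)
have col (B' : 'I_k.+1 -> 'rV_s.+1) : sbase s.+1 k.+1 sigma B' -> _ := fun h =>
  let: And5 BL Bspan B0 obt Bker := h in
  two_colouring _ _ _ B' pos BL Bspan B0 obt Bker ord0 o1 o2 o0E o1E o2E s0 s1 s2 Ak st k0 k0s k0u.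
have [B' [a [b [Z [sb' ab sep x pl]]]]] := reduce_to_unit _ _ _ _ col B sb.
have [ob' pl'] := half_superbase _ _ _ s0 sigS _ _ _ _ _ rk sb' ab sep x.
split; first by exists k, (fun i => dup s (B' i)).
by move=> plB; exists k, (fun i => dup s (B' i)); split=> //; apply: pl'; apply: pl.
Qed.
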